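(* Let $0<\mu<2$ and $\delta\in(0,1)$ be such that $\theta:=1+\delta-\mu>0$. Assume that $m$ is nonincreasing. Let $f:\mathbb H^\mu\times\mathbb H^\mu\to\mathbb H^{-\theta}$ satisfy $f(0,0)=0$, and suppose there are nonnegative functions $L_f,K_f$ on $(0,\infty)$ such that for all $\rho,\rho'>0$ $$\|f(v_1,w_1)-f(v_2,w_2)\|_{\mathbb H^{-\theta}}\le L_f(\rho)\|v_1-v_2\|_{\mathbb H^\mu}+K_f(\rho')\|w_1-w_2\|_{\mathbb H^\mu}$$ whenever $\|v_1\|_{\mathbb H^\mu},\|v_2\|_{\mathbb H^\mu}\le\rho$ and $\|w_1\|_{\mathbb H^\mu},\|w_2\|_{\mathbb H^\mu}\le\rho'$. Suppose that $$\limsup_{\rho\to0}L_f(\rho)=L_f^*,\qquad \limsup_{\rho'\to0}K_f(\rho')=K_f^*,$$ where $L_f^*,K_f^*$ are finite numbers such that $$8\,T^{1-\delta}(1-\delta)^{-1}\big((L_f^* )^2+(K_f^* )^2\|\ell\|_{L^1(0,T)}^2\big)<1.$$ Suppose moreover that for some $\gamma\in(\frac12\delta,\frac12)$, $$\ell_1^*:=\sup_{h>0,\ t\in(0,T-h]}\Big(\frac th\Big)^\gamma\int_t^{t+h}|\ell(\tau)|\,d\tau<\infty,\qquad \ell_2^*:=\sup_{t\in(0,T]}t^\gamma\int_0^t\frac{|\ell(\tau)|}{(t-\tau)^\gamma}\,d\tau<\infty,$$ and $$16\,B(1-\delta,1-2\gamma)\,T^{1-\delta}\big((L_f^* )^2+(K_f^*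 )^2(\ell_2^* )^2\big)<1,$$ where $B(\cdot,\cdot)$ is the Beta function. Then there exists $\rho^*>0$ such that for every $\xi\in\mathbb H^\mu$ with $\|\xi\|_{\mathbb H^\mu}\le\frac12\rho^*$, the problem $$\partial_tu-(1+D_t^{\{m\}})\Delta u=f(u,\mathcal Hu)\ \text{in }\Omega,\ t\in(0,T),\qquad u=0\ \text{on }\partial\Omega,\qquad u(0)=\xi\ \text{in }\Omega,$$ has a unique mild solution $u$ on $[0,T]$ obeying $\|u(t)\|_{\mathbb H^\mu}\le\rho^*$ for all $t\in[0,T]$, and this solution is Hölder continuous on $(0,T]$ with exponent $\gamma$, in the sense that $$\sup_{h>0,\ t\in(0,T-h]}\frac{t^\gamma\|u(t+h)-u(t)\|_{\mathbb H^\mu}}{h^\gamma}<\infty.$$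
   Context: $\Omega\subset\mathbb R^d$ is a bounded domain with smooth boundary, $T>0$, and $\ell\in L^1(0,T)$. $\mathcal H$ is the convolution operator $\mathcal Hv(t)=\int_0^t\ell(t-\tau)v(\tau)\,d\tau$. The operator $D_t^{\{m\}}$ is $D_t^{\{m\}}v(t)=\frac{d}{dt}\int_0^tm(t-s)v(s)\,ds$. Hilbert scales: $\{e_n\}_{n\ge1}$ is an orthonormal basis of $L^2(\Omega)$ of eigenfunctions of the Dirichlet Laplacian $-\Delta$, with eigenvalues $0<\lambda_1\le\lambda_2\le\dots$. For $\varrho\ge0$, $\mathbb H^\varrho=\{\varphi\in L^2(\Omega):\|\varphi\|_{\mathbb H^\varrho}^2=\sum_n\lambda_n^{\varrho}(\varphi,e_n)^2<\infty\}$; $\mathbb H^{-\varrho}$ is the dual of $\mathbb H^\varrho$, with norm $\|\varphi\|_{\mathbb H^{-\varrho}}^2=\sum_n\lambda_n^{-\varrho}\langle\varphi,e_n\rangle^2$. Standing assumption on $m$: $m\in L^1_{loc}(\mathbb R^+)$ is nonnegative and unbounded on $\mathbb R^+$, and $a(t):=1+m(t)$ is completely positive, i.e. for every $\theta_0>0$ the solutions $s,r$ of $s(t)+\theta_0\int_0^ta(t-\tau)s(\tau)d\tau=1$ $(t\ge0)$ and $r(t)+\theta_0\int_0^ta(t-\tau)r(\tau)d\tau=a(t)$ $(t>0)$ are nonnegative. For $\lambda>0$, $\omega(\cdot,\lambda)$ denotes the solution of $\omega(t)+\lambda\int_0^t(1+m(t-\tau))\omega(\tau)\,d\tau=1$,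 $t\ge0$. The resolvent operator is $S(t)\xi=\sum_{n\ge1}\omega(t,\lambda_n)\xi_ne_n$, where $\xi_n=(\xi,e_n)$ (for $\xi$ in a space $\mathbb H^{-\varrho}$, $\xi_n=\langle\xi,e_n\rangle$). Mild solution: for $\xi\in\mathbb H^\mu$, a function $u\in C([0,T];\mathbb H^\mu)$ is a mild solution on $[0,T]$ if $u(t)=S(t)\xi+\int_0^tS(t-\tau)f(u(\tau),\mathcal Hu(\tau))\,d\tau$ for all $t\in[0,T]$. *)

(* Defs.v *)
From HB Require Import structures.
From mathcomp Require Import all_boot all_order all_algebra.
From mathcomp Require Import all_classical all_reals all_analysis.
From mathcomp Require Import measurable_realfun.

Set Implicit Arguments.
Unset Strict Implicit.
Unset Printing Implicit Defensive.

Import Order.TTheory GRing.Theory Num.Theory.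
Import numFieldNormedType.Exports.

Local Open Scope classical_set_scope.
Local Open Scope ring_scope.

Section lebesgue_rV.
Context {R : realType}.

(* The library instance carries the measurability proof as an argument, so it
   cannot be inferred from `pushforward m f` alone. *)
Definition image_measure d1 d2 (T1 : measurableType d1) (T2 : measurableType d2)
    (m : {measure set T1 -> \bar R}) (f : T1 -> T2)
    (mf : measurable_fun [set: T1] f) : {measure set T2 -> \bar R} :=
  measure_function_pushforward__canonical__measure_function_Measure m mf.

Definition tcons (n : nat)
    (p : n.-tuple (measurableTypeR R) * measurableTypeR R) :
  n.+1.-tuple (measurableTypeR R) := [tuple of p.2 :: p.1].

Lemma measurable_tcons n : measurable_fun setT (@tcons n).
Proof. exact: measurable_cons. Qed.

Fixpoint lebesgue_tuple (d : nat) :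
    {measure set (d.-tuple (measurableTypeR R)) -> \bar R} :=
  match d with
  | 0%N => dirac [tuple]
  | n.+1 => image_measure
              (product_measure1 (lebesgue_tuple n) (@lebesgue_measure R))
              (@measurable_tcons n)
  end.

Definition borel_rV (d : nat) := g_sigma_algebraType (@open 'rV[R]_d).

Definition row_of_tuple (d : nat) (t : d.-tuple (measurableTypeR R)) :
  borel_rV d := (\row_i tnth t i : 'rV[R]_d).

Lemma measurable_row_of_tuple d : measurable_fun setT (@row_of_tuple d).
Proof.
apply: (@measurability _ _ _ (borel_rV d) setT (@row_of_tuple d) 
  (@open 'rV[R]_d) erefl).
move=> _ [U oU <-]; rewrite setTI.
pose B (q : 'rV[rat]_d * nat) : set 'rV[R]_d :=
  [set x | forall i, `|x ord0 i - ratr (q.1 ord0 i)| < q.2.+1%:R^-1].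
pose D : set ('rV[rat]_d * nat) := [set q | B q `<=` U].
have -> : @row_of_tuple d @^-1` U = \bigcup_(q in D) (@row_of_tuple d @^-1` B q).
  apply/seteqP; split=> [t Ut|t [q Dq Bq]]; last exact: Dq Bq.
  have /nbhs_ballP[e /= e0 eU] : nbhs (row_of_tuple t : 'rV[R]_d) U.
    by move: oU; rewrite openE; apply.
  have [k ke] : exists k : nat, k.+1%:R^-1 < e / 2.
    have /ltr_add_invr : 0 < e / 2 by rewrite divr_gt0.
    by move=> [k]; rewrite add0r => ?; exists k.
  have /choice[q qE] : forall i, exists q : rat, `|tnth t i - ratr q| < k.+1%:R^-1.
    move=> i.
    have [|x [xb [q _ qx]]] := @dense_rat R (ball (tnth t i) k.+1%:R^-1) _ (ball_open _ _).
      by exists (tnth t i); apply: ballxx.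
    by exists q; rewrite qx; exact: xb.
  exists (\row_i q i, k) => [x Bx|i]; last by rewrite !mxE.
  apply: eU; split=> // i j; rewrite ord1 /ball /= !mxE.
  have := Bx j; rewrite /= mxE => xq.
  rewrite (le_lt_trans (ler_distD (ratr (q j)) _ _))//.
  rewrite [ltRHS]splitr ltrD// ?(lt_trans (qE j))//.
  by rewrite distrC (lt_trans xq).
rewrite bigcup_mkcond; apply: countable_bigcupT_measurable => [|q].
  exact: countableP.
case: ifPn => // _.
have -> : @row_of_tuple d @^-1` B q = \bigcap_(i in [set: 'I_d])
    (fun t : d.-tuple (measurableTypeR R) => tnth t i) @^-1`
      ball (ratr (q.1 ord0 i) : R) q.2.+1%:R^-1.
  apply/seteqP; split=> t /= Bt i => [_|].
    by rewrite /= /ball/= distrC; have := Bt i; rewrite mxE.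
  by have := Bt i I; rewrite /= /ball/= distrC mxE.
apply: fin_bigcap_measurable => // i _.
rewrite -[X in measurable X]setTI; apply: measurable_tnth => //.
exact: measurable_ball.
Qed.

Definition lebesgue_rV (d : nat) : {measure set (borel_rV d) -> \bar R} :=
  image_measure (lebesgue_tuple d) (@measurable_row_of_tuple d).
End lebesgue_rV.

Section domains.
Context {R : realType} {d : nat}.
Implicit Types (Om U : set 'rV[R]_d) (g : 'rV[R]_d -> R).

Definition partial (i : 'I_d) g : 'rV[R]_d -> R :=
  fun x => 'D_(delta_mx ord0 i) g x.

Fixpoint Ck_on (k : nat) U g : Prop :=
  match k with
  | 0%N => forall x, U x -> {for x, continuous g}
  | k'.+1 => forall i, (forall x, U x -> derivable g x (delta_mx ord0 i)) /\
                       Ck_on k' U (partial i g)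
  end.

Definition laplacian g : 'rV[R]_d -> R :=
  fun x => \sum_(i < d) partial i (partial i g) x.

Definition boundary Om : set 'rV[R]_d := closure Om `\` Om°.

(* Near each boundary point the domain is a strict sublevel set of a C^oo
   function with nonvanishing gradient. *)
Definition smooth_boundary Om : Prop :=
  forall x, boundary Om x -> exists U (phi : 'rV[R]_d -> R),
    [/\ open_nbhs x U, forall k, Ck_on k U phi,
        exists i, partial i phi x != 0 &
        forall y, U y -> (Om y <-> phi y < 0)].

Definition smooth_bounded_domain Om : Prop :=
  [/\ open Om, connected Om, Om !=set0, bounded_set Om & smooth_boundary Om].

(* Elements of L^2(Om) are represented by functions; functions that agree
   almost everywhere on Om represent the same element. *)
Definition L2 Om : set ('rV[R]_d -> R) :=
  [set g | measurable_fun (Om : set (borel_rV d)) (g : borel_rV d -> R) /\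
     (\int[lebesgue_rV d]_(x in Om) (g x ^+ 2)%:E < +oo)%E].

Definition eq_L2 Om (g h : 'rV[R]_d -> R) : Prop :=
  {ae lebesgue_rV d, forall x, Om x -> g x = h x}.

Definition inner Om (g h : 'rV[R]_d -> R) : R :=
  (\int[lebesgue_rV d]_(x in Om) (g x * h x))%R.

Definition L2norm Om g : R := Num.sqrt (inner Om g g).

(* `e n` and `lam n` stand for e_(n+1) and lambda_(n+1). Since the boundary is
   smooth, the eigenfunctions of the Dirichlet Laplacian are its classical
   ones. *)
Definition dirichlet_eigenbasis Om (lam : nat -> R)
    (e : nat -> 'rV[R]_d -> R) : Prop :=
  [/\ 0 < lam 0%N /\ {homo lam : n k / (n <= k)%N >-> n <= k},
      forall n, [/\ Ck_on 2 Om (e n), {within closure Om, continuous (e n)},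
        forall x, boundary Om x -> e n x = 0 &
        forall x, Om x -> - laplacian (e n) x = lam n * e n x],
      forall n, L2 Om (e n),
      forall n k, inner Om (e n) (e k) = (n == k)%:R &
      forall g, L2 Om g ->
        L2norm Om (g - \sum_(n < N) inner Om g (e n) *: e n) @[N --> \oo] --> 0].

End domains.

Section hilbert_scale.
Context {R : realType} {d : nat}.
Variables (Om : set 'rV[R]_d) (lam : nat -> R) (e : nat -> 'rV[R]_d -> R).
Implicit Types (g h : 'rV[R]_d -> R) (c : nat -> R).

Definition wseries (s : R) c : \bar R :=
  (\sum_(0 <= n <oo) (lam n `^ s * c n ^+ 2)%:E)%E.

Definition wnorm (s : R) c : R := Num.sqrt (fine (wseries s c)).

Definition coef g : nat -> R := fun n => inner Om g (e n).

Definition Hspace (rho : R) : set ('rV[R]_d -> R) :=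
  [set g | L2 Om g /\ (wseries rho (coef g) < +oo)%E].

Definition Hnorm (rho : R) g : R := wnorm rho (coef g).

(* The space H^(-rho): functionals of which only the restriction to H^rho
   matters. *)
Definition Hdual (rho : R) : set (('rV[R]_d -> R) -> R) :=
  [set phi |
    (forall (a : R) g h, Hspace rho g -> Hspace rho h ->
       phi (a *: g + h) = a * phi g + phi h) /\
    exists C : R, forall g, Hspace rho g -> `|phi g| <= C * Hnorm rho g].

Definition dual_coef (phi : ('rV[R]_d -> R) -> R) : nat -> R :=
  fun n => phi (e n).

Definition Hdual_norm (rho : R) phi : R := wnorm (- rho) (dual_coef phi).

Definition Hcontinuous (rho T : R) (u : R -> 'rV[R]_d -> R) : Prop :=
  (forall t, 0 <= t <= T -> Hspace rho (u t)) /\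
  forall t, 0 <= t <= T ->
    Hnorm rho (u s - u t) @[s --> within `[0, T] (nbhs t)] --> 0.

(* `I` is the Bochner integral of `g` over `D` in H^rho (`D` of finite
   measure): limit of the integrals of simple functions converging to `g`
   almost everywhere and in mean. *)
Definition is_bochner (rho : R) (D : set R) (g : R -> 'rV[R]_d -> R)
    (I : 'rV[R]_d -> R) : Prop :=
  [/\ forall t, D t -> Hspace rho (g t), Hspace rho I &
    exists (K : nat -> nat) (A : nat -> nat -> set R)
           (v : nat -> nat -> 'rV[R]_d -> R),
    let simple j t := \sum_(i < K j) \1_(A j i) t *: v j i in
    [/\ forall j i, measurable (A j i) /\ Hspace rho (v j i),
        {ae lebesgue_measure, forall t, D t ->
          Hnorm rho (g t - simple j t) @[j --> \oo] --> 0},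
        (\int[lebesgue_measure]_(t in D) (Hnorm rho (g t - simple j t))%:E)%E
          @[j --> \oo] --> 0%E &
        Hnorm rho (I - \sum_(i < K j)
            fine (lebesgue_measure (A j i `&` D)) *: v j i)
          @[j --> \oo] --> 0]].

(* The value of the operator H with kernel ell: convolution in H^rho. *)
Definition memory (rho : R) (ell : R -> R) (u : R -> 'rV[R]_d -> R) (t : R) :
    'rV[R]_d -> R :=
  xget 0 [set I | is_bochner rho `]0, t[ (fun tau => ell (t - tau) *: u tau) I].

(* The sum in H^rho of the series with terms `c n *: e n`. *)
Definition Hsum (rho : R) c : 'rV[R]_d -> R :=
  xget 0 [set g | Hspace rho g /\
    Hnorm rho (g - \sum_(n < N) c n *: e n) @[N --> \oo] --> 0].

End hilbert_scale.

Section kernels.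
Context {R : realType}.
Implicit Types (a m g s : R -> R).

(* L^1_loc([0, +oo[): integrability up to 0 is included. *)
Definition L1loc g : Prop :=
  measurable_fun (`]0, +oo[%classic : set R) g /\
  forall b, lebesgue_measure.-integrable `]0, b[ (EFin \o g).

Definition conv a g (t : R) : R :=
  \int[lebesgue_measure]_(tau in `]0, t[) (a (t - tau) * g tau).

Definition volterra_s a (theta : R) s : Prop :=
  {within `[0, +oo[, continuous s} /\
  forall t, 0 <= t -> s t + theta * conv a s t = 1.

Definition volterra_r a (theta : R) r : Prop :=
  L1loc r /\
  {ae lebesgue_measure, forall t, 0 < t -> r t + theta * conv a r t = a t}.

(* Solutions of both equations are unique (almost everywhere for r). *)
Definition completely_positive a : Prop :=
  forall theta, 0 < theta ->
    (exists2 s, volterra_s a theta s & forall t, 0 <= t -> 0 <= s t) /\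
    (exists2 r, volterra_r a theta r &
       {ae lebesgue_measure, forall t, 0 < t -> 0 <= r t}).

Definition omega m (t l : R) : R :=
  (xget (fun=> 0) (volterra_s (fun x => 1 + m x) l)) t.

Definition standing_assumption m : Prop :=
  [/\ L1loc m, forall t, 0 < t -> 0 <= m t,
      forall M, exists2 t, 0 < t & M < m t &
      completely_positive (fun t => 1 + m t)].

Definition beta_integral (a b : R) : R :=
  \int[lebesgue_measure]_(s in `]0, 1[) (s `^ (a - 1) * (1 - s) `^ (b - 1)).

Definition ell1_star (ell : R -> R) (T gamma : R) : \bar R :=
  ereal_sup [set z | exists h t : R, [/\ 0 < h, 0 < t <= T - h &
    z = (((t / h) `^ gamma)%:E *
         \int[lebesgue_measure]_(tau in `]t, (t + h)%R[) `|ell tau|%:E)%E]].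

Definition ell2_star (ell : R -> R) (T gamma : R) : \bar R :=
  ereal_sup [set z | exists t : R, 0 < t <= T /\
    z = ((t `^ gamma)%:E * \int[lebesgue_measure]_(tau in `]0%R, t[)
           (`|ell tau| / (t - tau) `^ gamma)%:E)%E].

Definition L1norm (ell : R -> R) (T : R) : R :=
  \int[lebesgue_measure]_(tau in `]0, T[) `|ell tau|.

End kernels.

Section mild_solutions.
Context {R : realType} {d : nat}.
Variables (Om : set 'rV[R]_d) (lam : nat -> R) (e : nat -> 'rV[R]_d -> R).

(* The resolvent operator, with values in H^mu, in terms of the coefficients
   `c n` of its argument. *)
Definition resolvent (mu : R) (m : R -> R) (t : R) (c : nat -> R) :
    'rV[R]_d -> R :=
  Hsum Om lam e mu (fun n => omega m t (lam n) * c n).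

Definition mild_solution (mu T : R) (m ell : R -> R)
    (f : ('rV[R]_d -> R) -> ('rV[R]_d -> R) -> ('rV[R]_d -> R) -> R)
    (xi : 'rV[R]_d -> R) (u : R -> 'rV[R]_d -> R) : Prop :=
  Hcontinuous Om lam e mu T u /\
  forall t, 0 <= t <= T -> exists I,
    is_bochner Om lam e mu `]0, t[
      (fun tau => resolvent mu m (t - tau)
         (dual_coef e (f (u tau) (memory Om lam e mu ell u tau)))) I /\
    eq_L2 Om (u t) (resolvent mu m t (coef Om e xi) + I).

Definition holder_quotients (mu T gamma : R) (u : R -> 'rV[R]_d -> R) :
    set (\bar R) :=
  [set z | exists h t : R, [/\ 0 < h, 0 < t <= T - h &
    z = (t `^ gamma * Hnorm Om lam e mu (u (t + h) - u t) / h `^ gamma)%:E]].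

End mild_solutions.

(* Main.v *)
(* In the eigenbasis the equation decouples into the scalar Volterra kernels
   w_n(t) = omega(t, lambda_n). Complete positivity gives w_n = 1 - lambda_n int r_n with
   r_n >= 0, so w_n decreases from 1 and stays nonnegative. As a = 1 + m >= 1 is
   nonincreasing, 1 - w_n = lambda_n (a * w_n) yields
   lambda_n int w_n <= 1, w_n(t) <= 1 / (1 + lambda_n t) and w_n(t) - w_n(t + h) <= h / t.
   By Cauchy-Schwarz, with w_n(t) <= (lambda_n t)^(-delta),
   |S * g (t)|_mu^2 <= int_0^t (t - s)^(-delta) |g(s)|_(-theta)^2 ds.
   On trajectories in a small ball the first smallness condition makes Picard's map a
   contraction of ratio 1/2. The differences u(t + h) - u(t) obey the same estimate, with
   |u(s + h) - u(s)| <= H (h / s)^gamma under the integral, which produces the Beta function;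
   the second smallness condition provides an H that is preserved by the iteration, and
   hence by its limit. Riesz-Fischer turns coefficient sequences into elements of H^mu, and
   Bochner integrals are identified by their coefficients. *)
Require Import Defs.
From mathcomp Require Import all_boot all_order all_algebra.
From mathcomp Require Import all_classical all_reals all_analysis.
From mathcomp Require Import measurable_realfun.
From mathcomp Require Import ring lra.
Set Implicit Arguments.
Unset Strict Implicit.
Unset Printing Implicit Defensive.
Import Order.TTheory GRing.Theory Num.Theory.
Import numFieldNormedType.Exports.
Local Open Scope classical_set_scope.
Local Open Scope ring_scope.


(** * Integrals and changes of variables *)

(** Estimates are carried out on coefficient sequences. A norm bound is a constant that dominates
    all partial sums, so no series has to be shown finite before it is estimated. The relation
    [theta = 1 + delta - mu] says that the resolvent must gain the weight [1 + delta]. Pointwise in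
    time this costs (t - s)^(-(1 + delta)/2): integrable, but with other constants. In
    Cauchy-Schwarz the unit 1 is paid by the mass bound and only [delta] by the decay, whence (t -
    s)^(-delta) against the squared norm. Increments of convolutions are taken by shifting the
    variable of integration, so that they fall on the trajectory and not on the kernel. What remains
    is a piece over []0, h[]: for the resolvent it is small by decay, for the memory term by the
    condition on [ell1_star], while [ell2_star] controls the shifted part. The ratio 1/2 leaves half
    of the ball to the initial value, whence the bound [rhostar / 2] on it. Since [f] acts on
    functions while the iteration acts on sequences, representatives are chosen; the Lipschitz
    condition itself shows that the choice is immaterial. *)

Lemma eq_leW d (T : porderType d) (x y : T) : x = y -> (x <= y)%O.
Proof. by move=> ->. Qed.

Section integrable_reals.
Context d (T : measurableType d) (R : realType) (nu : {measure set T -> \bar R}).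
Implicit Types (D : set T) (f g : T -> R).

Definition intble D f := nu.-integrable D (EFin \o f).

Lemma intble_measurable D f : intble D f -> measurable_fun D f.
Proof. by move=> /measurable_int/measurable_EFinP. Qed.

Lemma le_intble D f g : measurable D -> measurable_fun D f -> intble D g ->
  (forall x, D x -> `|f x| <= g x) -> intble D f.
Proof.
move=> mD mf ig fg; apply: (le_integrable mD _ _ ig) => /=.
  exact/measurable_EFinP.
by move=> x Dx /=; rewrite lee_fin (le_trans (fg _ Dx))// ler_norm.
Qed.

Lemma intbleD D f g : measurable D -> intble D f -> intble D g ->
  intble D (fun x => f x + g x).
Proof. by move=> mD /= fi gi; exact: (integrableD mD fi gi). Qed.

Lemma intbleB D f g : measurable D -> intble D f -> intble D g ->
  intble D (fun x => f x - g x).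
Proof. by move=> mD /= fi gi; exact: (integrableB mD fi gi). Qed.

Lemma intbleZ D f k : measurable D -> intble D f -> intble D (fun x => k * f x).
Proof. by move=> mD /= fi; exact: (@integrableZl _ _ _ _ _ mD k (EFin \o f) fi). Qed.

Lemma intbleZr D f k : measurable D -> intble D f -> intble D (fun x => f x * k).
Proof. by move=> mD /= fi; exact: (@integrableZr _ _ _ _ _ mD k (EFin \o f) fi). Qed.

Lemma intble_sum D (I : Type) (s : seq I) (h : I -> T -> R) : measurable D ->
  (forall i, intble D (h i)) -> intble D (fun x => \sum_(i <- s) h i x).
Proof.
move=> mD hi; elim: s => [|i s ih].
  rewrite (_ : (fun _ => _) = cst 0); last by apply/funext => x; rewrite big_nil.
  exact: integrable0.
rewrite (_ : (fun _ => _) = (fun x => h i x + \sum_(i <- s) h i x)).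
  exact: intbleD.
by apply/funext => x; rewrite big_cons.
Qed.

Lemma Rintegral_sum D (I : Type) (s : seq I) (h : I -> T -> R) : measurable D ->
  (forall i, intble D (h i)) ->
  \int[nu]_(x in D) (\sum_(i <- s) h i x) = \sum_(i <- s) \int[nu]_(x in D) h i x.
Proof.
move=> mD hi; elim: s => [|i s ih].
  rewrite big_nil -[RHS](mul0r (fine (nu D))) -Rintegral_cst//.
  by apply: eq_Rintegral => x _; rewrite big_nil.
rewrite big_cons -ih -(RintegralD mD (hi i) (intble_sum s mD hi)).
by apply: eq_Rintegral => x _; rewrite big_cons.
Qed.

Lemma intbleS D E f : measurable E -> measurable D -> D `<=` E ->
  intble E f -> intble D f.
Proof. by move=> mE mD DE; exact: integrableS. Qed.

Lemma eq_intble D f g : measurable D -> {in D, f =1 g} -> intble D f -> intble D g.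
Proof.
by move=> mD fg; apply: eq_integrable => // x xD /=; rewrite fg.
Qed.

Lemma intble_norm D f : intble D f -> intble D (fun x => `|f x|).
Proof. exact: integrable_norm. Qed.

Lemma intble_bounded D f M : measurable D -> (nu D < +oo)%E ->
  measurable_fun D f -> (forall x, D x -> `|f x| <= M) -> intble D f.
Proof.
move=> mD Doo mf fM; apply: measurable_bounded_integrable => //.
by exists M; split; [exact: num_real|move=> y My x Dx /=; rewrite (le_trans (fM x Dx))// ltW].
Qed.

Lemma intbleMb D f g M : measurable D -> measurable_fun D f ->
  (forall x, D x -> `|f x| <= M) -> intble D g -> intble D (fun x => f x * g x).
Proof.
move=> mD mf fM ig.
apply: (@le_intble _ _ (fun x => M * `|g x|)) => //.
- by apply: measurable_funM => //; exact: intble_measurable.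
- by apply: intbleZ => //; exact: intble_norm.
- by move=> x Dx; rewrite normrM ler_wpM2r// fM.
Qed.

Lemma EFin_Rintegral D f : measurable D -> intble D f ->
  (\int[nu]_(x in D) f x)%:E = (\int[nu]_(x in D) (f x)%:E)%E.
Proof.
by move=> mD fi; rewrite /Rintegral fineK//; exact: integrable_fin_num.
Qed.

Lemma intble_lty D f : measurable D -> measurable_fun D f ->
  (forall x, D x -> 0 <= f x) -> (\int[nu]_(x in D) (f x)%:E < +oo)%E ->
  intble D f.
Proof.
move=> mD mf f0 foo; apply/integrableP; split; first exact/measurable_EFinP.
rewrite (eq_integral (fun x => (f x)%:E))// => x /set_mem Dx /=.
by rewrite ger0_norm// f0.
Qed.

Lemma Rintegral_le_lee D f M : measurable D -> intble D f ->
  (\int[nu]_(x in D) (f x)%:E <= M%:E)%E -> \int[nu]_(x in D) f x <= M.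
Proof. by move=> mD fi; rewrite -EFin_Rintegral// lee_fin. Qed.

Lemma ge0_subset_Rintegral A B f : measurable A -> measurable B -> intble B f ->
  (forall x, B x -> 0 <= f x) -> A `<=` B ->
  \int[nu]_(x in A) f x <= \int[nu]_(x in B) f x.
Proof.
move=> mA mB fi f0 AB.
have fA : intble A f := intbleS mB mA AB fi.
rewrite -lee_fin !EFin_Rintegral//; apply: ge0_subset_integral => //=.
exact/measurable_EFinP/intble_measurable.
Qed.

End integrable_reals.

Section change_of_variables.
Context {R : realType}.
Local Notation mu := (@lebesgue_measure R).
Variables (phi : measurableTypeR R -> measurableTypeR R) (k : R).
Hypothesis mphi : measurable_fun setT phi.
Hypothesis k0 : 0 < k.
Hypothesis mu_phi : forall A, measurable A -> mu A = (k%:E * mu (phi @^-1` A))%E.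

Lemma ge0_integral_comp D (F : R -> \bar R) : measurable D ->
  measurable_fun D F -> (forall x, D x -> 0 <= F x)%E ->
  (\int[mu]_(x in D) F x = k%:E * \int[mu]_(x in phi @^-1` D) F (phi x))%E.
Proof.
move=> mD mF F0.
have kn0 : 0 <= k by exact: ltW.
(* [mu_phi] says that [mu] is [k] times its image under [phi]. *)
transitivity (\int[mscale (NngNum kn0) (image_measure mu mphi)]_(x in D) F x)%E.
  apply: eq_measure_integral => A mA AD.
  by rewrite /mscale/= /mscale/= /pushforward -mu_phi.
rewrite ge0_integral_mscale//=; congr (_ * _)%E.
by rewrite ge0_integral_pushforward// => x /set_mem; exact: F0.
Qed.

Lemma measurable_preimage_phi D : measurable D -> measurable (phi @^-1` D).
Proof. by move=> mD; rewrite -[X in measurable X]setTI; exact: mphi. Qed.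

Lemma measurable_fun_comp_phi D (F : R -> R) : measurable D ->
  measurable_fun D F -> measurable_fun (phi @^-1` D) (F \o phi).
Proof.
move=> mD mF; apply: (measurable_comp mD) => //.
  by move=> _ [x Dx <-].
exact: measurable_funS mphi.
Qed.

Lemma intble_comp D f : measurable D -> intble mu D f ->
  intble mu (phi @^-1` D) (f \o phi).
Proof.
move=> mD /[dup] fi /integrableP[_ foo]; apply/integrableP; split.
  apply/measurable_EFinP; apply: measurable_fun_comp_phi => //.
  exact: intble_measurable fi.
(* Were the substituted integral infinite, so would be its product with [k > 0], which is the finite
   integral of [|f|]. *)
rewrite ltNge leye_eq; apply/negP => /eqP Eoo.
move: foo; rewrite ge0_integral_comp//=; last first.
  apply/measurable_EFinP; apply: measurableT_comp => //.
  exact: intble_measurable fi.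
by rewrite Eoo gt0_muley ?lte_fin// ltxx.
Qed.

Lemma Rintegral_comp D f : measurable D -> intble mu D f ->
  \int[mu]_(x in D) f x = k * \int[mu]_(x in phi @^-1` D) f (phi x).
Proof.
move=> mD fi.
have fphi := intble_comp mD fi.
have mphiD := measurable_preimage_phi mD.
apply: EFin_inj; rewrite EFinM !EFin_Rintegral//.
have mf : measurable_fun D (EFin \o f) by apply/measurable_EFinP; exact: intble_measurable fi.
rewrite integralE [in RHS]integralE.
rewrite (ge0_integral_comp mD (measurable_funepos mf))//.
rewrite (ge0_integral_comp mD (measurable_funeneg mf))//.
have Ep : (EFin \o (f \o phi))^\+%E = (EFin \o f)^\+%E \o phi by exact: (funepos_comp (EFin \o f) phi).
have En : (EFin \o (f \o phi))^\-%E = (EFin \o f)^\-%E \o phi by exact: (funeneg_comp (EFin \o f) phi).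
have add_def := integrable_add_def mphiD fphi.
rewrite {}Ep {}En in add_def; rewrite -muleBr//.
rewrite -[fun x => (f (phi x))%:E]/((EFin \o f) \o phi).
by rewrite (funepos_comp (EFin \o f) phi) (funeneg_comp (EFin \o f) phi).
Qed.

End change_of_variables.

Section lebesgue_affine.
Context {R : realType}.
Local Notation mu := (@lebesgue_measure R).
Implicit Types (c k : R) (D : set R).

(** Lebesgue measure is determined by its values on the intervals []a, b]], where the identity is a
    computation. The factor [1%:E] puts it in the form of [mu_phi]. *)
Lemma lebesgue_measure_shift c A : measurable A ->
  mu A = (1%:E * mu ((fun x : R => x + c)%R @^-1` A))%E.
Proof.
move=> mA; rewrite mul1e.
have mphi : measurable_fun setT ((fun x => x + c) : measurableTypeR R -> measurableTypeR R).
  exact: measurable_funD.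
apply: (@lebesgue_measure_unique _ (image_measure mu mphi)) => //= _ [[a b]] _ <-.
rewrite /pushforward.
rewrite (_ : _ @^-1` _ = `]a - c, b - c]%classic).
  rewrite !lebesgue_measure_itv/= !lte_fin ltrD2r; case: ifPn => // _.
  by rewrite -!EFinD; congr EFin; ring.
by apply/seteqP; split => x /=; rewrite !in_itv/= ltrBlDr lerBrDr.
Qed.

Lemma lebesgue_measure_refl c A : measurable A ->
  mu A = (1%:E * mu ((fun x : R => c - x)%R @^-1` A))%E.
Proof.
move=> mA; rewrite mul1e.
have mphi : measurable_fun setT ((fun x => c - x) : measurableTypeR R -> measurableTypeR R).
  exact: measurable_funB.
apply: (@lebesgue_measure_unique _ (image_measure mu mphi)) => //= _ [[a b]] _ <-.
rewrite /pushforward.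
rewrite (_ : _ @^-1` _ = `[c - b, c - a[%classic).
  rewrite !lebesgue_measure_itv/= !lte_fin ltrD2l ltrN2; case: ifPn => // _.
  by rewrite -!EFinD; congr EFin; ring.
by apply/seteqP; split => x /=; rewrite !in_itv/= => /andP[? ?]; apply/andP; split; lra.
Qed.

Lemma lebesgue_measure_scale k A : 0 < k -> measurable A ->
  mu A = (k%:E * mu ((fun x : R => k * x)%R @^-1` A))%E.
Proof.
move=> k0 mA.
have mphi : measurable_fun setT ((fun x => k * x) : measurableTypeR R -> measurableTypeR R).
  exact: measurable_funM.
apply: (@lebesgue_measure_unique _ (mscale (NngNum (ltW k0)) (image_measure mu mphi))) => //= _ [[a b]] _ <-.
rewrite /mscale/= /pushforward.
rewrite (_ : _ @^-1` _ = `]a / k, b / k]%classic).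
  rewrite !lebesgue_measure_itv/= !lte_fin ltr_pM2r ?invr_gt0//; case: ifPn => // _.
    by rewrite -!EFinD -EFinM; congr EFin; field; rewrite gt_eqF.
  by rewrite mule0.
by apply/seteqP; split => x /=; rewrite !in_itv/= ltr_pdivrMr// ler_pdivlMr// mulrC.
Qed.

Lemma ge0_integral_shift c D (F : R -> \bar R) : measurable D ->
  measurable_fun D F -> (forall x, D x -> 0 <= F x)%E ->
  (\int[mu]_(x in D) F x = \int[mu]_(x in (fun y => y + c)%R @^-1` D) F (x + c)%R)%E.
Proof.
move=> mD mF F0; rewrite (ge0_integral_comp _ ltr01 (lebesgue_measure_shift c))// ?mul1e//.
exact: measurable_funD.
Qed.

Lemma ge0_integral_refl c D (F : R -> \bar R) : measurable D ->
  measurable_fun D F -> (forall x, D x -> 0 <= F x)%E ->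
  (\int[mu]_(x in D) F x = \int[mu]_(x in (fun y => c - y)%R @^-1` D) F (c - x)%R)%E.
Proof.
move=> mD mF F0; rewrite (ge0_integral_comp _ ltr01 (lebesgue_measure_refl c))// ?mul1e//.
exact: measurable_funB.
Qed.

Lemma Rintegral_shift c D f : measurable D -> intble mu D f ->
  \int[mu]_(x in D) f x = \int[mu]_(x in (fun y => y + c) @^-1` D) f (x + c).
Proof.
move=> mD fi; rewrite (Rintegral_comp _ ltr01 (lebesgue_measure_shift c))// ?mul1r//.
exact: measurable_funD.
Qed.

Lemma intble_shift c D f : measurable D -> intble mu D f ->
  intble mu ((fun y => y + c) @^-1` D) (fun x => f (x + c)).
Proof.
move=> mD; apply: (intble_comp _ ltr01 (lebesgue_measure_shift c)) => //.
exact: measurable_funD.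
Qed.

Lemma Rintegral_refl c D f : measurable D -> intble mu D f ->
  \int[mu]_(x in D) f x = \int[mu]_(x in (fun y => c - y) @^-1` D) f (c - x).
Proof.
move=> mD fi; rewrite (Rintegral_comp _ ltr01 (lebesgue_measure_refl c))// ?mul1r//.
exact: measurable_funB.
Qed.

Lemma intble_refl c D f : measurable D -> intble mu D f ->
  intble mu ((fun y => c - y) @^-1` D) (fun x => f (c - x)).
Proof.
move=> mD; apply: (intble_comp _ ltr01 (lebesgue_measure_refl c)) => //.
exact: measurable_funB.
Qed.

Lemma ge0_integral_scale k D (F : R -> \bar R) : 0 < k -> measurable D ->
  measurable_fun D F -> (forall x, D x -> 0 <= F x)%E ->
  (\int[mu]_(x in D) F x =
   k%:E * \int[mu]_(x in (fun y => k * y)%R @^-1` D) F (k * x)%R)%E.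
Proof.
move=> k0 mD mF F0.
rewrite (ge0_integral_comp _ k0 (fun A => @lebesgue_measure_scale k A k0))//.
exact: measurable_funM.
Qed.

Lemma refl_itvoo c a b :
  (fun y : R => c - y) @^-1` `]a, b[ = `](c - b), (c - a)[%classic.
Proof.
by apply/seteqP; split => x /=; rewrite !in_itv/= => /andP[? ?]; apply/andP; split; lra.
Qed.

Lemma shift_itvoo c a b :
  (fun y : R => y + c) @^-1` `]a, b[ = `](a - c), (b - c)[%classic.
Proof.
by apply/seteqP; split => x /=; rewrite !in_itv/= => /andP[? ?]; apply/andP; split; lra.
Qed.

End lebesgue_affine.

(** * Integrals of powers and the Beta kernel *)

Section power_integrals.
Context {R : realType}.
Local Notation mu := (@lebesgue_measure R).
Implicit Types (a b t x y : R).

Lemma ler_powRN a x y : 0 <= a -> 0 < x -> x <= y -> y `^ (- a) <= x `^ (- a).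
Proof.
move=> a0 x0 xy; rewrite !powRN lef_pV2 ?posrE ?powR_gt0//; last exact: lt_le_trans xy.
by rewrite ge0_ler_powR// ?nnegrE ltW//; exact: lt_le_trans xy.
Qed.

Lemma powR_invl x a : 0 <= x -> x^-1 `^ a = x `^ (- a).
Proof. by move=> x0; rewrite -powR_inv1// -powRrM mulN1r. Qed.

Lemma measurable_fun_powRr_itv (D : set R) a : measurable_fun D (fun x => x `^ a).
Proof. exact: measurable_funS (measurable_powR a). Qed.

(** The fundamental theorem of calculus applies away from the singularity, on []b / n.+2, b[];
    monotone convergence then moves the left end to 0. The index [n.+2] keeps this end below [b]
    already for [n = 0]. *)
Lemma integral_powRN_le a b : 0 < a < 1 -> 0 < b ->
  (\int[mu]_(x in `]0%R, b[) (x `^ (- a))%:E <= (b `^ (1 - a) / (1 - a))%:E)%E.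
Proof.
move=> /andP[a0 a1] b0.
pose F (n : nat) : set R := `]b / n.+2%:R, b[%classic.
have FU : `]0%R, b[%classic = \bigcup_i F i.
  apply/seteqP; split=> [x /=|x [n _]]; rewrite /F/= !in_itv/= => /andP[x0 xb].
    exists (Num.bound (b / x)) => //=; rewrite in_itv/= xb andbT.
    rewrite ltr_pdivrMr// mulrC -ltr_pdivrMr//.
    rewrite (lt_le_trans (archi_boundP _)) ?ler_nat ?divr_ge0 ?ltW//.
    by rewrite -addn2 leq_addr.
  by rewrite xb andbT (lt_trans _ x0)// divr_gt0.
rewrite FU.
have : (\int[mu]_(x in F i) (x `^ (- a))%:E @[i --> \oo] -->
        \int[mu]_(x in \bigcup_i F i) (x `^ (- a))%:E)%E.
  apply: ge0_nondecreasing_set_cvg_integral => //.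
  - apply/nondecreasing_seqP => n; rewrite subsetEset => x /=.
    rewrite /F/= !in_itv/= => /andP[bx ->]; rewrite andbT (le_lt_trans _ bx)//.
    by rewrite ler_pM2l// lef_pV2 ?posrE// ler_nat.
  - by move=> n; apply: measurable_itv.
  - by move=> n; apply/measurable_EFinP; exact: measurable_fun_powRr_itv.
  - by move=> n x _; rewrite lee_fin powR_ge0.
move=> h; rewrite -(cvg_lim _ h)//; apply: lime_le; first by apply/cvg_ex; eexists; exact: h.
apply: nearW => n.
have c0 : 0 < b / n.+2%:R by rewrite divr_gt0.
have cb : b / n.+2%:R < b by rewrite ltr_pdivrMr// ltr_pMr// ltr1n.
rewrite /F -(@integral_itv_bndoo _ _ _ _ true false); last first.
  by apply/measurable_EFinP; exact: measurable_fun_powRr_itv.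
have a1' : 1 - a != 0 by rewrite subr_eq0 eq_sym lt_eqF.
pose G x := (1 - a)^-1 * x `^ (1 - a).
have dG x : 0 < x -> is_derive x 1 G (x `^ (- a)).
  move=> x0.
  have -> : x `^ (- a) = (1 - a)^-1 *: ((1 - a) * x `^ ((1 - a) - 1)).
    by rewrite /GRing.scale/= mulrA mulVf// mul1r; congr (_ `^ _); lra.
  by apply: is_deriveZ; exact: is_derive1_powR.
have cG x : 0 < x -> {for x, continuous G}.
  move=> x0; apply/differentiable_continuous/derivable1_diffP.
  by have [] := dG _ x0.
rewrite (@continuous_FTC2 _ _ G)//.
- rewrite -EFinB lee_fin /G mulrC lerBlDr lerDl mulr_ge0 ?powR_ge0// invr_ge0; lra.
- apply: continuous_in_subspaceT => x; rewrite inE/= in_itv/= => /andP[cx _].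
  have x0 : 0 < x by exact: lt_le_trans cx.
  apply/differentiable_continuous/derivable1_diffP.
  by have [] := is_derive1_powR (- a) x0.
- split.
  + by move=> x; rewrite in_itv/= => /andP[cx _]; have [] := dG _ (lt_trans c0 cx).
  + by apply: cvg_at_right_filter; exact: cG.
  + by apply: cvg_at_left_filter; exact: cG.
- move=> x; rewrite in_itv/= => /andP[cx _].
  by rewrite derive1E; have [_ ->] := dG _ (lt_trans c0 cx).
Qed.

Lemma intble_powRN a b : 0 < a < 1 -> intble mu `]0, b[ (fun x => x `^ (- a)).
Proof.
move=> a01; have [b0|b0] := leP b 0.
  rewrite set_itv_ge; last by rewrite bnd_simp -leNgt.
  exact: integrable_set0.
apply: intble_lty => //.
- exact: measurable_fun_powRr_itv.
- by move=> x _; exact: powR_ge0.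
- by rewrite (le_lt_trans (integral_powRN_le a01 b0))// ltry.
Qed.

Lemma Rintegral_powRN_le a b : 0 < a < 1 -> 0 <= b ->
  \int[mu]_(x in `]0, b[) (x `^ (- a)) <= b `^ (1 - a) / (1 - a).
Proof.
move=> a01; rewrite le_eqVlt => /predU1P[<-|b0].
  rewrite set_itv_ge ?bnd_simp ?ltxx// Rintegral_set0.
  by rewrite divr_ge0 ?powR_ge0//; lra.
apply: Rintegral_le_lee => //; [exact: intble_powRN|exact: integral_powRN_le].
Qed.

Lemma refl_itv0 t : (fun y : R => t - y) @^-1` `]0, t[ = `]0, t[%classic.
Proof. by rewrite refl_itvoo subrr subr0. Qed.

Lemma intble_refl_powRN a t : 0 < a < 1 ->
  intble mu `]0, t[ (fun x => (t - x) `^ (- a)).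
Proof.
move=> a01; have := intble_refl t (measurable_itv `]0, t[) (intble_powRN t a01).
by rewrite refl_itv0.
Qed.

Lemma Rintegral_refl_powRN_le a t : 0 < a < 1 -> 0 <= t ->
  \int[mu]_(x in `]0, t[) ((t - x) `^ (- a)) <= t `^ (1 - a) / (1 - a).
Proof.
move=> a01 t0; have := Rintegral_refl t (measurable_itv `]0, t[) (intble_powRN t a01).
by rewrite refl_itv0 => <-; exact: Rintegral_powRN_le.
Qed.

(** Each half of the interval contains one singularity; there the other factor is at most its value
    at 1/2. *)
Lemma intble_beta a b : 0 < a < 1 -> 0 < b < 1 ->
  intble mu `]0, 1[ (fun s => s `^ (- a) * (1 - s) `^ (- b)).
Proof.
move=> a01 b01.
apply: (@le_intble _ (measurableTypeR R) R mu _ _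
  (fun s => 2^-1 `^ (- b) * s `^ (- a) + 2^-1 `^ (- a) * (1 - s) `^ (- b))) => //.
- apply: measurable_funM; first exact: measurable_fun_powRr_itv.
  apply: (measurableT_comp (measurable_powR (- b))) => //.
  exact: measurable_funB.
- apply: intbleD => //; apply: intbleZ => //; first exact: intble_powRN.
  exact: intble_refl_powRN.
- move=> s; rewrite /= in_itv/= => /andP[s0 s1].
  rewrite ger0_norm ?mulr_ge0 ?powR_ge0//.
  have [sl|sl] := leP s 2^-1.
    rewrite mulrC ler_wpDr ?mulr_ge0 ?powR_ge0// ler_wpM2r ?powR_ge0//.
    by apply: ler_powRN; lra.
  rewrite ler_wpDl ?mulr_ge0 ?powR_ge0// ler_wpM2r ?powR_ge0//.
  by apply: ler_powRN; lra.
Qed.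

(** The substitution [s = t * (1 - x)] produces the Beta integrand with its exponents in the right
    order and releases the power of [t]. The identity is proved in [\bar R], so that integrability
    comes with it. *)
Lemma intble_beta_kernel a b t : 0 < a < 1 -> 0 < b < 1 -> 0 < t ->
  intble mu `]0, t[ (fun s => (t - s) `^ (- a) * s `^ (- b)) /\
  \int[mu]_(s in `]0, t[) ((t - s) `^ (- a) * s `^ (- b)) =
    t `^ (1 - a - b) * beta_integral (1 - a) (1 - b).
Proof.
move=> a01 b01 t0.
have mF : measurable_fun `]0, t[ (fun s => (t - s) `^ (- a) * s `^ (- b)).
  apply: measurable_funM; last exact: measurable_fun_powRr_itv.
  apply: (measurableT_comp (measurable_powR (- a))) => //.
  exact: measurable_funB.
have scale01 : (fun y => t * y) @^-1` `]0, t[ = `]0, 1[%classic.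
  apply/seteqP; split => x /=; rewrite !in_itv/= pmulr_rgt0// => /andP[->] /=.
    by rewrite -[ltRHS]mulr1 ltr_pM2l.
  by move=> ?; rewrite -[ltRHS]mulr1 ltr_pM2l.
have E : (\int[mu]_(s in `]0%R, t[) ((t - s) `^ (- a) * s `^ (- b))%:E =
    (t `^ (1 - a - b) * beta_integral (1 - a) (1 - b))%:E)%E.
  rewrite (ge0_integral_scale t0)//; last 2 first.
  - exact/measurable_EFinP.
  - by move=> x _; rewrite lee_fin mulr_ge0 ?powR_ge0.
  rewrite scale01 (ge0_integral_refl 1)//; last 2 first.
  - apply/measurable_EFinP; apply: measurable_funM.
      apply: (measurableT_comp (measurable_powR (- a))) => //.
      by apply: measurable_funB => //; exact: measurable_funM.
    exact: (measurableT_comp (measurable_powR (- b))) => //.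
  - by move=> x _; rewrite lee_fin mulr_ge0 ?powR_ge0.
  rewrite refl_itv0 /beta_integral.
  have -> : 1 - a - 1 = - a by lra.
  have -> : 1 - b - 1 = - b by lra.
  rewrite EFinM (@EFin_Rintegral _ (measurableTypeR R) _ mu _ _ (measurable_itv _) (intble_beta a01 b01)).
  have -> : t `^ (1 - a - b) = t * t `^ (- a - b).
    rewrite -[X in X * _](powRr1 (ltW t0)) -powRD; last by rewrite (gt_eqF t0) implybT.
    by congr (_ `^ _); ring.
  rewrite EFinM -muleA; congr (_ * _)%E.
  rewrite -ge0_integralZl//; last 3 first.
  - by apply/measurable_EFinP; exact: intble_measurable (intble_beta a01 b01).
  - by move=> x _; rewrite lee_fin mulr_ge0 ?powR_ge0.
  - by rewrite lee_fin powR_ge0.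
  apply: eq_integral => s /set_mem; rewrite /= in_itv/= => /andP[s0 s1].
  rewrite -EFinM; congr EFin.
  have -> : t - t * (1 - s) = t * s by ring.
  rewrite !powRM ?(ltW t0) ?(ltW s0)//; last lra.
  rewrite mulrACA -powRD //; last by rewrite (gt_eqF t0) implybT.
have fi : intble mu `]0, t[ (fun s => (t - s) `^ (- a) * s `^ (- b)).
  apply: intble_lty => //; first by move=> x _; rewrite mulr_ge0 ?powR_ge0.
  by rewrite E ltry.
by split=> //; apply: EFin_inj; rewrite EFin_Rintegral.
Qed.

End power_integrals.

Section interval_integrals.
Context {R : realType}.
Local Notation mu := (@lebesgue_measure R).
Implicit Types (a b c t : R) (f : R -> R).

Lemma lebesgue_measure_itvoo a b : (mu `]a, b[ < +oo)%E.
Proof. by rewrite lebesgue_measure_itv/=; case: ifP => _; rewrite -?EFinB ltry. Qed.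

Lemma fine_lebesgue_itvoo a b : a <= b -> fine (mu `]a, b[) = b - a.
Proof.
rewrite le_eqVlt => /predU1P[->|ab]; rewrite lebesgue_measure_itv/= lte_fin.
  by rewrite ltxx subrr.
by rewrite ab.
Qed.

Lemma intbleSoo a b c e f : a <= c -> e <= b ->
  intble mu `]a, b[ f -> intble mu `]c, e[ f.
Proof.
move=> ac eb; apply: intbleS => //.
by apply: subset_itv; rewrite bnd_simp.
Qed.

Lemma Rintegral_itv_split a b c f : a <= b -> b <= c -> intble mu `]a, c[ f ->
  \int[mu]_(x in `]a, c[) f x =
  \int[mu]_(x in `]a, b[) f x + \int[mu]_(x in `]b, c[) f x.
Proof.
rewrite le_eqVlt => /predU1P[->|ab].
  by move=> bc fi; rewrite (@set_itv_ge _ _ (BRight b) (BLeft b)) ?bnd_simp ?ltxx// Rintegral_set0 add0r.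
rewrite le_eqVlt => /predU1P[->|bc] fi.
  by rewrite (@set_itv_ge _ _ (BRight c) (BLeft c)) ?bnd_simp ?ltxx// Rintegral_set0 addr0.
have U : `]a, c[%classic = `]a, b[ `|` `[b, c[.
  by rewrite -itv_bndbnd_setU// bnd_simp ltW.
rewrite U Rintegral_setU//; last 2 first.
- by rewrite -U.
- rewrite disj_set2E; apply/eqP/seteqP; split => x //= [].
  by rewrite !in_itv/= => /andP[_ xb] /andP[bx _]; have := le_lt_trans bx xb; rewrite ltxx.
rewrite -Rintegral_itv_obnd_cbnd//.
by apply: intbleSoo fi => //; exact: ltW.
Qed.

Lemma cst_intble a b k : intble mu `]a, b[ (cst k).
Proof.
apply: (@intble_bounded _ (measurableTypeR R) _ _ _ _ `|k|) => //.
exact: lebesgue_measure_itvoo.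
Qed.

Lemma Rintegral_cst_itvoo a b k : a <= b -> \int[mu]_(x in `]a, b[) k = k * (b - a).
Proof. by move=> ab; rewrite Rintegral_cst// fine_lebesgue_itvoo. Qed.

Lemma intble_patch D f : measurable D -> intble mu D f <-> intble mu setT (f \_ D).
Proof.
move=> mD; rewrite /intble -restrict_EFin.
by rewrite -(setTI D) -integrable_restrict ?setTI.
Qed.

Lemma intble_refl0 t f : intble mu `]0, t[ f -> intble mu `]0, t[ (fun x => f (t - x)).
Proof. by move=> fi; have := intble_refl t (measurable_itv _) fi; rewrite refl_itv0. Qed.

Lemma Rintegral_refl0 t f : intble mu `]0, t[ f ->
  \int[mu]_(x in `]0, t[) f (t - x) = \int[mu]_(x in `]0, t[) f x.
Proof.
by move=> fi; have := Rintegral_refl t (measurable_itv _) fi; rewrite refl_itv0 => ->.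
Qed.

End interval_integrals.

(** * Exchange of integrals in a triple convolution *)

Section Fubini_convolution.
Context {R : realType}.
Local Notation mu := (@lebesgue_measure R).
Local Notation RR := (measurableTypeR R).

(** By translation invariance the integral of [|a (y - x)|] in [y] does not depend on [x], so
    Tonelli bounds the double integral by [M] times the product of the L^1 norms of [r] and [a]. *)
Let prod_intble (r a w : RR -> R) M :
  intble mu setT r -> intble mu setT a ->
  measurable_fun setT w -> (forall x, `|w x| <= M) ->
  intble (mu \x mu)%E setT (fun z => r z.1 * a (z.2 - z.1) * w z.2).
Proof.
move=> ri ai mw wM.
have mr : measurable_fun setT r := intble_measurable ri.
have ma : measurable_fun setT a := intble_measurable ai.
have mf : measurable_fun setT (fun z : RR * RR => r z.1 * a (z.2 - z.1) * w z.2).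
  apply: measurable_funM; last exact: measurableT_comp.
  apply: measurable_funM; first exact: measurableT_comp.
  apply: (measurableT_comp ma); exact: measurable_funB.
apply/integrable12ltyP; first exact/measurable_EFinP.
have M0 : 0 <= M by exact: le_trans (wM 0).
have aE (x : R) : (\int[mu]_y (`|a (y - x)|%:E) = \int[mu]_y (`|a y|%:E))%E.
  rewrite [RHS](ge0_integral_shift (- x))//.
  by apply/measurable_EFinP; exact: measurableT_comp.
apply: (@le_lt_trans _ _ (\int[mu]_x (`|r x|%:E * (M%:E * \int[mu]_y (`|a y|%:E))))%E).
  apply: ge0_le_integral => //.
  - by move=> x _; exact: integral_ge0.
  - apply: (measurable_fun_fubini_tonelli_F (fun z : RR * RR => `|(r z.1 * a (z.2 - z.1) * w z.2)%:E|%E)) => //.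
    by apply: measurableT_comp => //; exact/measurable_EFinP.
  - apply: emeasurable_funM => //; apply/measurable_EFinP; exact: measurableT_comp.
  - move=> x _; rewrite -(aE x).
    have mayx : measurable_fun setT (fun y : RR => `|a (y - x)|).
      apply: measurableT_comp => //; apply: (measurableT_comp ma).
      exact: measurable_funB.
    rewrite -ge0_integralZl//; last exact/measurable_EFinP.
    rewrite -ge0_integralZl//; last 2 first.
    - by apply/measurable_EFinP; exact: measurable_funM.
    - by move=> y _; rewrite lee_fin mulr_ge0.
    apply: ge0_le_integral => //=.
    - apply/measurable_EFinP; apply: measurableT_comp => //.
      apply: measurable_funM => //; apply: measurable_funM => //.
      apply: (measurableT_comp ma); exact: measurable_funB.
    - apply/measurable_EFinP; apply: measurable_funM => //.
      by apply: measurable_funM.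
    - move=> y _; rewrite lee_fin !normrM -mulrA ler_wpM2l// mulrC.
      by rewrite ler_wpM2r.
under eq_integral do rewrite muleC.
rewrite ge0_integralZl//; last 2 first.
- by apply/measurable_EFinP; exact: measurableT_comp.
- by rewrite mule_ge0// integral_ge0.
have fin (g : RR -> R) : intble mu setT g -> (\int[mu]_y (`|g y|%:E) < +oo)%E.
  by move=> /integrableP[].
apply: lte_mul_pinfty; [|rewrite ge0_fin_numE|exact: fin].
- by rewrite mule_ge0// integral_ge0.
- by apply: lte_mul_pinfty => //; exact: fin.
- by rewrite mule_ge0// integral_ge0.
Qed.

(** The convolution of [r] and [a] is prescribed only almost everywhere and only where [w] does not
    vanish: this is what the equation of a resolvent kernel offers on a bounded interval. *)
Lemma Rintegral_conv_swap (r a w c : RR -> R) M :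
  intble mu setT r -> intble mu setT a ->
  measurable_fun setT w -> (forall x, `|w x| <= M) ->
  intble mu setT (fun y => w y * c y) ->
  {ae mu, forall y, w y != 0 -> \int[mu]_x (r x * a (y - x)) = c y} ->
  \int[mu]_x (r x * \int[mu]_y (a (y - x) * w y)) = \int[mu]_y (w y * c y).
Proof.
move=> ri ai mw wM wci rac.
have ma : measurable_fun setT a := intble_measurable ai.
have fi := prod_intble ri ai mw wM.
(* With the weight 1, Fubini gives for almost every [y] the integrability of [r x * a (y - x)] in
   [x]. *)
have hi := @prod_intble r a (cst 1) 1 ri ai (@measurable_cst _ _ _ _ _ _) (fun=> ltac:(by rewrite normr1)).
have awi x : intble mu setT (fun y : RR => a (y - x) * w y).
  rewrite (_ : (fun _ => _) = (fun y : RR => w y * a (y - x))); last first.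
    by apply/funext => y; rewrite mulrC.
  apply: (@intbleMb _ _ _ _ _ _ _ M) => //.
  by have := intble_shift (- x) measurableT ai; rewrite preimage_setT.
apply: EFin_inj; rewrite [RHS]EFin_Rintegral//.
rewrite /Rintegral; set F := (X in fine X).
suff -> : F = (\int[mu]_y (w y * c y)%:E)%E by rewrite -EFin_Rintegral.
transitivity (\int[mu]_x \int[mu]_y (r x * a (y - x) * w y)%:E)%E.
  apply: eq_integral => x _; rewrite EFinM EFin_Rintegral//.
  rewrite -integralZl//; last exact: awi.
  by apply: eq_integral => y _; rewrite -EFinM mulrA.
rewrite (Fubini fi); apply: ae_eq_integral => //.
- exact: (measurable_fubini_G fi).
- by apply/measurable_EFinP; exact: intble_measurable wci.
- have := ae_integrable2 hi; apply: filterS2 rac => y + yi _ /=.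
  have [w0 _|wn0 /(_ isT) <-] := eqVneq (w y) 0.
    by rewrite w0 mul0r; under eq_integral do rewrite mulr0; rewrite integral0.
  have {}yi : intble mu setT (fun x : RR => r x * a (y - x)).
    by apply: eq_intble yi => // x _; rewrite /= mulr1.
  rewrite EFinM EFin_Rintegral// -integralZl//.
  by apply: eq_integral => x _; rewrite -EFinM mulrC.
Qed.

End Fubini_convolution.

(** * The scalar relaxation function *)

Section continuous_on_half_line.
Context {R : realType}.
Local Notation RR := (measurableTypeR R).
Local Notation mu := (@lebesgue_measure R).
Implicit Types (w : R -> R) (t : R).

Lemma continuous_itvcy_bounded w t : 0 <= t ->
  {within `[0, +oo[, continuous w} ->
  exists M, forall x, 0 <= x <= t -> `|w x| <= M.
Proof.
move=> t0 cw.
have cwt : {within `[0, t], continuous w}.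
  by apply: continuous_subspaceW cw; apply: subset_itvl; rewrite bnd_simp.
have /compact_bounded [M [_ wM]] := continuous_compact cwt (@segment_compact _ 0 t).
exists (M + 1) => x xt; apply: (wM (M + 1)); first by rewrite ltrDl.
by exists x => //; rewrite /= in_itv.
Qed.

Lemma measurable_itv_subcy w t : {within `[0, +oo[, continuous w} ->
  measurable_fun (`]0, t[%classic : set RR) w.
Proof.
move=> cw; have := subspace_continuous_measurable_fun (measurable_itv _) cw.
apply: measurable_funS => //.
by apply: subset_itv; rewrite bnd_simp.
Qed.

Lemma intble_continuous w t : {within `[0, +oo[, continuous w} ->
  intble mu `]0, t[ w.
Proof.
move=> cw; have [t0|t0] := ltP t 0.
  rewrite set_itv_ge; last by rewrite bnd_simp -leNgt ltW.
  exact: integrable_set0.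
have [M wM] := continuous_itvcy_bounded t0 cw.
apply: (@intble_bounded _ RR _ _ _ _ M) => //.
- exact: lebesgue_measure_itvoo.
- exact: measurable_itv_subcy.
- by move=> x; rewrite /= in_itv/= => /andP[x0 xt]; apply: wM; rewrite !ltW.
Qed.

End continuous_on_half_line.

Section volterra.
Context {R : realType}.
Local Notation mu := (@lebesgue_measure R).
Local Notation RR := (measurableTypeR R).
Variables (a : R -> R) (l : R).
Hypothesis l0 : 0 < l.
Hypothesis a_intble : forall t, intble mu `]0, t[ a.

(* Convolving the equation of [r] with [w] and that of [w] with [r] and subtracting
   leaves [1 * r = w * a]. *)
Lemma volterra_s_from_r (r w : R -> R) t : volterra_r a l r ->
  volterra_s a l w -> 0 <= t -> w t = 1 - l * \int[mu]_(x in `]0, t[) r x.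
Proof.
move=> [[_ rL1] rE] [cw wE]; rewrite le_eqVlt => /predU1P[<-|t0].
  have e : `]0, 0[%classic = set0 :> set RR by rewrite set_itv_ge ?bnd_simp ?ltxx.
  by have := wE 0 (lexx _); rewrite /Defs.conv e !Rintegral_set0 mulr0 addr0 subr0.
have ri : intble mu `]0, t[ r := rL1 t.
have ai := a_intble t.
have wi := intble_continuous t cw.
have [M wM] := continuous_itvcy_bounded (ltW t0) cw.
have wM' x : 0 < x < t -> `|w (t - x)| <= M.
  by move=> /andP[x0 xt]; apply: wM; rewrite subr_ge0 gerBl !ltW.
have wgi g : intble mu `]0, t[ g -> intble mu `]0, t[ (fun y => w (t - y) * g y).
  apply: (@intbleMb _ RR _ _ _ _ _ M) => //.
  exact: intble_measurable (intble_refl0 wi).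
have wri := wgi r ri; have wai := wgi a ai.
pose D := `]0, t[%classic : set RR.
have mD : measurable D by exact: measurable_itv.
(* Extended by zero from []0, t[], the factors have whole-line convolutions that agree with [conv]
   at times in []0, t[]; [c] is the value that the equation of [r] gives to [conv a r]. *)
pose r' := r \_ D. pose a' := a \_ D.
pose w' := (fun y => w (t - y)) \_ D.
pose c y := (a y - r y) / l.
have w'M x : `|w' x| <= M.
  rewrite /w' patchE; case: ifPn => [|_]; first by rewrite inE /D/= in_itv/=; exact: wM'.
  by rewrite normr0 (le_trans _ (wM 0 _))// lexx ltW.
have wc : (fun y => w' y * c y) = (fun y => w (t - y) * c y) \_ D.
  by apply/funext => y; rewrite /w' !patchE; case: ifP => // _; rewrite mul0r.
have wcE : \int[mu]_y (w' y * c y) =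
    (\int[mu]_(y in D) (w (t - y) * a y) - \int[mu]_(y in D) (w (t - y) * r y)) / l.
  rewrite wc -Rintegral_mkcond -RintegralB// -RintegralZr//; last exact: intbleB.
  by apply: eq_Rintegral => y _; rewrite /c mulrA mulrBr.
have wci : intble mu setT (fun y => w' y * c y).
  rewrite wc; apply: (intble_patch _ mD).1.
  apply: (eq_intble mD _ (intbleZ l^-1 mD (intbleB mD wai wri))) => y _.
  by rewrite /c; ring.
have r'i : intble mu setT r' := (intble_patch r mD).1 ri.
have a'i : intble mu setT a' := (intble_patch a mD).1 ai.
have convE y : 0 < y < t -> \int[mu]_x (r' x * a' (y - x)) = Defs.conv a r y.
  move=> /andP[y0 yt]; rewrite /Defs.conv [RHS]Rintegral_mkcond.
  apply: eq_Rintegral => x _; rewrite /r' /a' !patchE !mem_setE !in_itv/=.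
  have [x0|x0] := ltP 0 x; last by rewrite !mul0r.
  have [xy|xy] /= := ltP x y.
    have -> : x < t by exact: lt_trans yt.
    have -> : (0 < y - x < t) by apply/andP; split; lra.
    by rewrite mulrC.
  have -> : (0 < y - x) = false by apply/negbTE; rewrite -leNgt; lra.
  by rewrite mulr0.
have := @Rintegral_conv_swap _ r' a' w' c M.
rewrite wcE; move=> h.
have {}h : \int[mu]_x (r' x * \int[mu]_y (a' (y - x) * w' y)) =
    (\int[mu]_(y in D) (w (t - y) * a y) - \int[mu]_(y in D) (w (t - y) * r y)) / l.
  apply: h => //.
  - apply/(measurable_restrictT _ mD).
    exact: intble_measurable (intble_refl0 wi).
  - move: rE; apply: filterS; first exact: (ae_filter_ringOfSetsType mu).
    move=> y ry; rewrite /w' patchE; case: ifPn => [|_]; last by rewrite eqxx.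
    rewrite inE /D/= in_itv/= => /andP[y0 yt] _.
    rewrite convE ?y0// /c -(ry y0).
    by rewrite addrC addKr mulrC mulKf// gt_eqF.
have innerE x : 0 < x < t -> \int[mu]_y (a' (y - x) * w' y) = (1 - w (t - x)) / l.
  move=> /andP[x0 xt].
  have tx : 0 <= t - x by rewrite subr_ge0 ltW.
  have awi : intble mu setT (fun y => a' (y - x) * w' y).
    rewrite (_ : (fun _ => _) = (fun y => w' y * a' (y - x))); last first.
      by apply/funext => y; rewrite mulrC.
    apply: (@intbleMb _ RR _ _ _ _ _ M) => //.
    - apply/(measurable_restrictT _ mD).
      exact: intble_measurable (intble_refl0 wi).
    - by have := intble_shift (- x) measurableT a'i; rewrite preimage_setT.
  rewrite (Rintegral_refl t measurableT awi) preimage_setT.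
  have <- : Defs.conv a w (t - x) = (1 - w (t - x)) / l.
    by rewrite -(wE _ tx) addrAC subrr add0r mulrC mulKf// gt_eqF.
  rewrite /Defs.conv [RHS]Rintegral_mkcond; apply: eq_Rintegral => y _.
  rewrite /a' /w' !patchE !mem_setE !in_itv/=.
  have -> : t - (t - y) = y by ring.
  have -> : t - y - x = t - x - y by ring.
  have [y0|y0] := ltP 0 y; last first.
    have -> : (t - y < t) = false by apply/negbTE; rewrite -leNgt; lra.
    by rewrite andbF mulr0.
  have [yt|yt] := ltP y (t - x).
    have -> : 0 < t - x - y < t by apply/andP; split; lra.
    by have -> : 0 < t - y < t by apply/andP; split; lra.
  have -> : (0 < t - x - y) = false by apply/negbTE; rewrite -leNgt; lra.
  by rewrite mul0r.
have outerE : \int[mu]_x (r' x * \int[mu]_y (a' (y - x) * w' y)) =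
    (\int[mu]_(x in D) r x - \int[mu]_(x in D) (w (t - x) * r x)) / l.
  rewrite -RintegralB// -RintegralZr//; last exact: intbleB.
  rewrite [RHS]Rintegral_mkcond; apply: eq_Rintegral => x _.
  rewrite /r' !patchE; case: ifPn => [|_]; last by rewrite mul0r.
  rewrite inE /D/= in_itv/= => xt; rewrite innerE//; ring.
(* The integral of [w (t - x) * r x] occurs in both orders of integration and cancels. *)
have E : \int[mu]_(x in D) r x = \int[mu]_(y in D) (w (t - y) * a y).
  move: h; rewrite outerE => /(congr1 (fun z => z * l)).
  by rewrite !divfK ?gt_eqF// => /addIr.
rewrite E.
have -> : \int[mu]_(y in D) (w (t - y) * a y) = Defs.conv a w t.
  rewrite -(Rintegral_refl0 wai) /Defs.conv; apply: eq_Rintegral => y _.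
  by rewrite mulrC; congr (_ * w _); ring.
by rewrite -(wE t (ltW t0)); ring.
Qed.

End volterra.

Section relaxation_function.
Context {R : realType}.
Local Notation mu := (@lebesgue_measure R).
Local Notation RR := (measurableTypeR R).
Variables (m : R -> R) (l : R).
Hypothesis l0 : 0 < l.
Hypothesis m_std : standing_assumption m.
Hypothesis m_noninc : forall s t, 0 < s -> s <= t -> m t <= m s.

Let a x := 1 + m x.
Let w t := omega m t l.

Let a_intble t : intble mu `]0, t[ a.
Proof.
have [[_ mi] _ _ _] := m_std.
by apply: intbleD => //; [exact: cst_intble|exact: mi].
Qed.

Let a_ge1 t : 0 < t -> 1 <= a t.
Proof. by move=> t0; rewrite lerDl; have [_ + _ _] := m_std; apply. Qed.

Lemma omega_volterra : volterra_s a l w.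
Proof.
have [_ _ _ /(_ _ l0) [[s sE _] _]] := m_std.
rewrite /w /omega (_ : (fun t => _) = xget (fun=> 0) (volterra_s a l))//.
exact: (xgetPex _ (ex_intro _ s sE)).
Qed.

Let cw : {within `[0, +oo[, continuous w}. Proof. by have [] := omega_volterra. Qed.

Lemma omega_intble t : intble mu `]0, t[ w.
Proof. exact: intble_continuous. Qed.

(* [volterra_s_from_r] identifies [w] with the nonnegative solution provided by complete
   positivity. *)
Lemma omega_ge0 t : 0 <= t -> 0 <= w t.
Proof.
move=> t0; have [_ _ _ /(_ _ l0) [[s sE s0] [r rE _]]] := m_std.
rewrite (volterra_s_from_r l0 a_intble rE omega_volterra t0).
by rewrite -(volterra_s_from_r l0 a_intble rE sE t0); exact: s0.
Qed.

Lemma omega_noninc s t : 0 <= s -> s <= t -> w t <= w s.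
Proof.
move=> s0 st; have t0 := le_trans s0 st.
have [_ _ _ /(_ _ l0) [_ [r rE r0]]] := m_std.
rewrite !(volterra_s_from_r l0 a_intble rE omega_volterra)//.
rewrite lerD2l lerN2 ler_pM2l//.
have [[_ rL1] _] := rE.
(* Nonnegativity of [r] holds only almost everywhere; the positive part has it everywhere and has
   the same integrals. *)
pose r' x := Num.max (r x) 0.
have ri b : intble mu `]0, b[ r by exact: rL1.
have r'i b : intble mu `]0, b[ r'.
  apply: (le_intble _ _ (intble_norm (ri b))) => //.
    by apply: measurable_maxr => //; exact: intble_measurable (ri b).
  move=> x _; rewrite /r' ger0_norm ?le_max ?lexx ?orbT//.
  by rewrite ge_max ler_norm normr_ge0.
have E b : \int[mu]_(x in `]0, b[) r x = \int[mu]_(x in `]0, b[) r' x.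
  congr fine; apply: ae_eq_integral => //.
  - by apply/measurable_EFinP; exact: intble_measurable (ri b).
  - by apply/measurable_EFinP; exact: intble_measurable (r'i b).
  - move: r0; apply: filterS; first exact: (ae_filter_ringOfSetsType mu).
    move=> x rx; rewrite /= in_itv/= => /andP[x0 _].
    by rewrite /r' (max_idPl _)//; exact: rx.
rewrite !E; apply: ge0_subset_Rintegral => //.
- by move=> x _; rewrite /r' le_max lexx orbT.
- by apply: subset_itv; rewrite bnd_simp.
Qed.

Lemma omega0 : w 0 = 1.
Proof.
have [_ /(_ 0 (lexx _))] := omega_volterra.
have e : `]0, 0[%classic = set0 :> set RR by rewrite set_itv_ge ?bnd_simp ?ltxx.
by rewrite /Defs.conv e !Rintegral_set0 mulr0 addr0.
Qed.

Lemma omega_le1 t : 0 <= t -> w t <= 1.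
Proof. by move=> t0; rewrite -omega0 omega_noninc. Qed.

Let w_bound t x : 0 < x < t -> `|w (t - x)| <= 1.
Proof.
move=> /andP[x0 xt]; have tx : 0 <= t - x by rewrite subr_ge0 ltW.
by rewrite ger0_norm ?omega_ge0 ?omega_le1.
Qed.

Let aw_intble t : intble mu `]0, t[ (fun x => a x * w (t - x)).
Proof.
apply: (@eq_intble _ RR _ _ _ (fun x => w (t - x) * a x)) => //.
  by move=> x _; rewrite mulrC.
apply: (@intbleMb _ RR _ _ _ _ _ 1) => //.
- exact: intble_measurable (intble_refl0 (omega_intble t)).
- by move=> x; rewrite /= in_itv/=; exact: w_bound.
Qed.

Let omegaE t : 0 <= t -> 1 - w t = l * \int[mu]_(x in `]0, t[) (a x * w (t - x)).
Proof.
move=> t0; have [_ /(_ _ t0) <-] := omega_volterra.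
rewrite addrAC subrr add0r; congr (_ * _).
rewrite -(Rintegral_refl0 (aw_intble t)) /Defs.conv; apply: eq_Rintegral => x _.
by congr (_ * w _); ring.
Qed.

(** As [a >= 1], the integral is at most the convolution of [a] and [w], and [l] times that is
    [1 - w t]. *)
Lemma omega_Rintegral_le t : 0 <= t -> l * \int[mu]_(x in `]0, t[) w x <= 1.
Proof.
move=> t0; apply: (@le_trans _ _ (1 - w t)); last by rewrite gerBl omega_ge0.
rewrite omegaE// ler_pM2l// -(Rintegral_refl0 (omega_intble t)).
apply: le_Rintegral => //; [exact: intble_refl0 (omega_intble t)|exact: aw_intble|].
move=> x; rewrite /= in_itv/= => /andP[x0 xt].
by rewrite ler_peMl ?a_ge1 ?omega_ge0// subr_ge0 ltW.
Qed.

(** On []0, t[] both [a x] and [w (t - x)] are at least their values at time [t]. The factor [a t]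
    is kept because it cancels in [omega_lipschitz]. *)
Let omega_decay_a t : 0 < t -> w t * (1 + l * (a t * t)) <= 1.
Proof.
move=> t0; have t0' := ltW t0.
suff : l * (w t * a t * t) <= 1 - w t by nra.
rewrite omegaE// ler_pM2l// -[X in _ * X]subr0 -Rintegral_cst_itvoo//.
apply: le_Rintegral => //; [exact: cst_intble|exact: aw_intble|].
move=> x; rewrite /= in_itv/= => /andP[x0 xt]; rewrite mulrC.
have tx : 0 <= t - x by rewrite subr_ge0 ltW.
apply: ler_pM.
- by rewrite (le_trans ler01) ?a_ge1.
- exact: omega_ge0.
- by rewrite lerD2l m_noninc// ltW.
- by apply: omega_noninc => //; rewrite gerBl ltW.
Qed.

Lemma omega_decay t : 0 < t -> w t * (1 + l * t) <= 1.
Proof.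
move=> t0; apply: le_trans (omega_decay_a t0).
rewrite ler_wpM2l ?omega_ge0 ?(ltW t0)// lerD2l ler_pM2l// ler_peMl ?a_ge1//.
exact: ltW.
Qed.

(** In the equation of [w], write [a x = (a x - a t) + a t]. The contribution of the first part does
    not increase from [t] to [t + h], so the decrease of [w] is at most [l * a t] times the integral
    of [w] over []t, t + h[], hence at most [l * a t * w t * h]; [omega_decay_a] absorbs everything
    but [h / t]. *)
Lemma omega_lipschitz t h : 0 < t -> 0 <= h -> w t - w (t + h) <= h / t.
Proof.
move=> t0 h0; have th0 : 0 <= t + h by apply: addr_ge0 => //; exact: ltW.
have t0' := ltW t0; have a1 := a_ge1 t0.
have tth : t <= t + h by rewrite lerDl.
have wi c : intble mu `]0, c[ (fun x => w (c - x)) := intble_refl0 (omega_intble c).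
have bwi c : intble mu `]0, c[ (fun x => a x * w (c - x) - a t * w (c - x)).
  apply: intbleB => //; exact: intbleZ.
have splitE c : 0 <= c -> \int[mu]_(x in `]0, c[) (a x * w (c - x)) =
    \int[mu]_(x in `]0, c[) (a x * w (c - x) - a t * w (c - x))
    + a t * \int[mu]_(x in `]0, c[) w x.
  move=> c0; rewrite (RintegralB _ (aw_intble c) (intbleZ (a t) _ (wi c)))//.
  by rewrite (RintegralZl (a t) _ (wi c))// (Rintegral_refl0 (omega_intble c)) subrK.
(* [x |-> a x - a t] is nonnegative before [t] and nonpositive after [t], and [w] is
   nonincreasing. *)
have diff : \int[mu]_(x in `]0, t + h[) (a x * w (t + h - x) - a t * w (t + h - x))
    <= \int[mu]_(x in `]0, t[) (a x * w (t - x) - a t * w (t - x)).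
  rewrite (Rintegral_itv_split t0' tth (bwi (t + h))).
  rewrite -[leRHS]addr0; apply: lerD.
    apply: le_Rintegral => //; [|exact: bwi|].
      by apply: intbleSoo (bwi (t + h)); rewrite ?lerDl.
    move=> x; rewrite /= in_itv/= => /andP[x0 xt]; rewrite -!mulrBl.
    rewrite ler_wpM2l//; first by rewrite subr_ge0 lerD2l m_noninc// ltW.
    by apply: omega_noninc; lra.
  rewrite -oppr_ge0 -[X in 0 <= X]mulN1r -RintegralZl//; last first.
    exact: (intbleSoo t0' (lexx _) (bwi _)).
  apply: Rintegral_ge0 => x; rewrite /= in_itv/= => /andP[x0 xt].
  rewrite mulN1r oppr_ge0 -mulrBl mulr_le0_ge0//.
    by rewrite subr_le0 lerD2l m_noninc// ltW.
  by apply: omega_ge0; lra.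
have wth : \int[mu]_(x in `]t, t + h[) w x <= w t * h.
  have -> : w t * h = w t * (t + h - t) by ring.
  rewrite -Rintegral_cst_itvoo ?lerDl//; apply: le_Rintegral => //.
  - exact: (intbleSoo t0' (lexx _) (omega_intble _)).
  - exact: cst_intble.
  - by move=> x; rewrite /= in_itv/= => /andP[tx _]; apply: omega_noninc => //; exact: ltW.
have key : w t - w (t + h) <= l * (a t * (w t * h)).
  have -> : w t - w (t + h) = (1 - w (t + h)) - (1 - w t) by ring.
  rewrite !omegaE// -mulrBr ler_pM2l// (splitE _ th0) (splitE _ t0').
  rewrite (Rintegral_itv_split t0' tth (omega_intble (t + h))).
  have : a t * \int[mu]_(x in `]t, t + h[) w x <= a t * (w t * h).
    by rewrite ler_pM2l// (lt_le_trans ltr01).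
  by move: diff; lra.
apply: (le_trans key); rewrite ler_pdivlMr//.
have := omega_decay_a t0; have := omega_ge0 t0'.
set W := w t; set A := a t => W0 WA.
have : W * (l * (A * t)) <= 1 by nra.
move=> /(ler_wpM2l h0); rewrite mulr1; apply: le_trans.
by apply: eq_leW; ring.
Qed.

End relaxation_function.

(** * Weighted sequences *)

Section weighted_sequences.
Context {R : realType}.
Variable lam : nat -> R.
Hypothesis lam_gt0 : forall n, 0 < lam n.
Implicit Types (s C : R) (c : nat -> R).

(* [C] bounds the norm of weight [s] of the sequence [c]. *)
Definition wbounded s c C := 0 <= C /\
  forall N, \sum_(n < N) lam n `^ s * c n ^+ 2 <= C ^+ 2.
Local Notation hb := wbounded.

Lemma weight_gt0 s n : 0 < lam n `^ s.
Proof. exact: powR_gt0. Qed.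

Lemma hb_ge0 s c C : hb s c C -> 0 <= C. Proof. by case. Qed.

Lemma hb_le s c C C' : hb s c C -> C <= C' -> hb s c C'.
Proof.
move=> [C0 cC] CC'; split=> [|N]; first exact: le_trans CC'.
by apply: (le_trans (cC N)); rewrite lerXn2r// ?nnegrE ?(le_trans C0).
Qed.

Lemma hb0 s C : 0 <= C -> hb s (fun=> 0) C.
Proof.
move=> C0; split=> // N; rewrite big1 ?sqr_ge0// => n _.
by rewrite expr0n mulr0.
Qed.

Lemma hb_coef s c C n : hb s c C -> lam n `^ s * c n ^+ 2 <= C ^+ 2.
Proof.
move=> [_ /(_ n.+1)]; apply: le_trans; rewrite big_ord_recr/= lerDr.
by apply: sumr_ge0 => i _; rewrite mulr_ge0 ?sqr_ge0// ltW// weight_gt0.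
Qed.

Lemma hb_abs s c C n : hb s c C -> `|c n| <= Num.sqrt (lam n `^ s)^-1 * C.
Proof.
move=> /[dup] /hb_ge0 C0 /hb_coef - /(_ n) cC.
rewrite -(ler_pXn2r (n := 2))// ?nnegrE ?mulr_ge0 ?sqrtr_ge0//.
rewrite real_normK ?num_real// exprMn sqr_sqrtr ?invr_ge0 ?powR_ge0//.
by rewrite mulrC ler_pdivlMr ?weight_gt0// mulrC.
Qed.

Lemma hb_eq0 s c n : hb s c 0 -> c n = 0.
Proof. by move=> /hb_abs - /(_ n); rewrite mulr0 normr_le0 => /eqP. Qed.

Lemma eq_hb s c c' C : c =1 c' -> hb s c C -> hb s c' C.
Proof. by move=> /funext ->. Qed.

Lemma hb_dom s c c' k C : 0 <= k -> (forall n, `|c' n| <= k * `|c n|) ->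
  hb s c C -> hb s c' (k * C).
Proof.
move=> k0 cc' [C0 cC]; split=> [|N]; first exact: mulr_ge0.
rewrite exprMn (le_trans _ (ler_wpM2l (sqr_ge0 k) (cC N)))//.
rewrite mulr_sumr ler_sum// => n _; rewrite [leRHS]mulrCA ler_wpM2l ?powR_ge0//.
rewrite -exprMn -[leLHS]real_normK ?num_real// -[leRHS]real_normK ?num_real//.
by rewrite lerXn2r// ?nnegrE// normrM (ger0_norm k0).
Qed.

Lemma hbZ s c k C : hb s c C -> hb s (fun n => k * c n) (`|k| * C).
Proof. by apply: hb_dom => // n; rewrite normrM. Qed.

Lemma cauchy_schwarz_sum (p x y : nat -> R) N : (forall n, 0 < p n) ->
  (\sum_(n < N) p n * (x n * y n)) ^+ 2 <=
  (\sum_(n < N) p n * x n ^+ 2) * (\sum_(n < N) p n * y n ^+ 2).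
Proof.
move=> p0.
set A := \sum_(n < N) p n * x n ^+ 2; set D := \sum_(n < N) p n * y n ^+ 2.
set B := \sum_(n < N) _.
have A0 : 0 <= A by apply: sumr_ge0 => i _; rewrite mulr_ge0 ?sqr_ge0// ltW.
have expand (a b : R) : \sum_(n < N) p n * (a * y n - b * x n) ^+ 2 =
    a ^+ 2 * D - 2 * (a * b) * B + b ^+ 2 * A.
  rewrite /A /D /B !mulr_sumr -!sumrN -!big_split/=.
  by apply: eq_bigr => n _; ring.
(* For this choice the sum of squares is [A] times the difference to be shown nonnegative; if
   [A = 0], every [x n] vanishes. *)
have E : \sum_(n < N) p n * (A * y n - B * x n) ^+ 2 = A * (A * D - B ^+ 2).
  by rewrite expand; ring.
have E0 : 0 <= A * (A * D - B ^+ 2).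
  by rewrite -E; apply: sumr_ge0 => i _; rewrite mulr_ge0 ?sqr_ge0// ltW.
move: A0; rewrite le_eqVlt => /predU1P[A0|A0]; last first.
  by move: E0; rewrite pmulr_rge0// subr_ge0.
have x0 (n : 'I_N) : x n = 0.
  have : p n * x n ^+ 2 = 0.
    have := @psumr_eq0P _ _ xpredT (fun n : 'I_N => p n * x n ^+ 2).
    by apply=> // i _; rewrite mulr_ge0 ?sqr_ge0// ltW.
  by move/eqP; rewrite mulf_eq0 gt_eqF//= expf_eq0/= => /eqP.
have -> : B = 0 by rewrite /B big1// => n _; rewrite x0 mul0r mulr0.
by rewrite -A0 mul0r expr0n.
Qed.

Lemma hb_pairing s x y X Y N : hb s x X -> hb s y Y ->
  \sum_(n < N) lam n `^ s * (x n * y n) <= X * Y.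
Proof.
move=> [X0 xX] [Y0 yY]; apply: (le_trans (ler_norm _)).
rewrite -(ler_pXn2r (n := 2))// ?nnegrE ?mulr_ge0// real_normK ?num_real//.
apply: (le_trans (cauchy_schwarz_sum x y N (weight_gt0 s))); rewrite exprMn.
by apply: ler_pM => //; apply: sumr_ge0 => n _; rewrite mulr_ge0 ?powR_ge0 ?sqr_ge0.
Qed.

Lemma hbD s x y X Y : hb s x X -> hb s y Y -> hb s (fun n => x n + y n) (X + Y).
Proof.
move=> hx hy; split=> [|N]; first by rewrite addr_ge0 ?(hb_ge0 hx) ?(hb_ge0 hy).
have -> : \sum_(n < N) lam n `^ s * (x n + y n) ^+ 2 =
    \sum_(n < N) lam n `^ s * x n ^+ 2 + \sum_(n < N) lam n `^ s * y n ^+ 2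
    + 2 * \sum_(n < N) lam n `^ s * (x n * y n).
  by rewrite mulr_sumr -!big_split/=; apply: eq_bigr => n _; ring.
have := hb_pairing N hx hy; have [_ /(_ N)] := hx; have [_ /(_ N)] := hy; lra.
Qed.

Lemma hbN s x X : hb s x X -> hb s (fun n => - x n) X.
Proof.
by move=> [X0 xX]; split=> // N; under eq_bigr do rewrite sqrrN; exact: xX.
Qed.

Lemma hbB s x y X Y : hb s x X -> hb s y Y -> hb s (fun n => x n - y n) (X + Y).
Proof. by move=> hx /hbN; exact: hbD. Qed.

(** Each partial sum involves finitely many coefficients, so coefficientwise convergence suffices.
    This carries the bounds of Picard's iterates to their limit. *)
Lemma hb_lim s (c_ : nat -> nat -> R) c C : (forall k, hb s (c_ k) C) ->
  (forall n, c_ k n @[k --> \oo] --> c n) -> hb s c C.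
Proof.
move=> cC cc; split=> [|N]; first exact: hb_ge0 (cC 0%N).
have h : \sum_(n < N) lam n `^ s * c_ k n ^+ 2 @[k --> \oo] -->
         \sum_(n < N) lam n `^ s * c n ^+ 2.
  elim: N => [|N ih].
    by under eq_fun do rewrite big_ord0; rewrite big_ord0; exact: cvg_cst.
  under eq_fun do rewrite big_ord_recr/=; rewrite big_ord_recr/=.
  apply: cvgD => //; apply: cvgMr; under eq_fun do rewrite expr2.
  by rewrite expr2; exact: cvgM.
rewrite -(cvg_lim _ h)//; apply: limr_le; first by apply/cvg_ex; eexists; exact: h.
by apply: nearW => k; have [_] := cC k.
Qed.

Lemma hb_small s c C : (forall e, 0 < e -> hb s c (C + e)) -> hb s c C.
Proof.
move=> cC; have C0 : 0 <= C.
  by apply/ler_addgt0Pr => e e0; rewrite (hb_ge0 (cC e e0)).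
split=> // N; set S := \sum_(n < N) _.
have S0 : 0 <= S by apply: sumr_ge0 => n _; rewrite mulr_ge0 ?powR_ge0 ?sqr_ge0.
rewrite -(sqr_sqrtr S0) lerXn2r// ?nnegrE ?sqrtr_ge0//.
apply/ler_addgt0Pr => e e0; have [Ce0 /(_ N)] := cC e e0.
by rewrite -/S -{1}(sqr_sqrtr S0) ler_pXn2r// nnegrE sqrtr_ge0.
Qed.

End weighted_sequences.

Section integrals_of_sequences.
Context {R : realType}.
Local Notation mu := (@lebesgue_measure R).
Variable lam : nat -> R.
Hypothesis lam_gt0 : forall n, 0 < lam n.
Local Notation hb := (wbounded lam).

Lemma hb_intble s (D : set (measurableTypeR R)) (G : R -> nat -> R) C n :
  measurable D -> (forall n, measurable_fun D (G ^~ n)) -> intble mu D C ->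
  (forall x, D x -> hb s (G x) (C x)) -> intble mu D (G ^~ n).
Proof.
move=> mD mG iC GC.
apply: (le_intble mD (mG n) (intbleZ (Num.sqrt (lam n `^ s)^-1) mD iC)).
by move=> x Dx; apply: hb_abs => //; exact: GC.
Qed.

(* Duality: [\sum p I_n^2 = \int \sum p I_n G_n <= (\sum p I_n^2)^(1/2) \int C]. *)
Lemma hb_Rintegral s (D : set (measurableTypeR R)) (G : R -> nat -> R) C :
  measurable D -> (forall n, measurable_fun D (G ^~ n)) -> intble mu D C ->
  (forall x, D x -> hb s (G x) (C x)) ->
  hb s (fun n => \int[mu]_(x in D) G x n) (\int[mu]_(x in D) C x).
Proof.
move=> mD mG iC GC.
have iG n : intble mu D (G ^~ n) := hb_intble n mD mG iC GC.
have C0 : 0 <= \int[mu]_(x in D) C x.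
  by apply: Rintegral_ge0 => x Dx; exact: hb_ge0 (GC x Dx).
split=> // N; set I := fun n => \int[mu]_(x in D) G x n.
set S := \sum_(n < N) _.
have S0 : 0 <= S by apply: sumr_ge0 => n _; rewrite mulr_ge0 ?powR_ge0 ?sqr_ge0.
have iIG : intble mu D (fun x => \sum_(n < N) lam n `^ s * I n * G x n).
  apply: (@intble_sum _ _ _ mu D _ _ (fun (n : 'I_N) x => lam n `^ s * I n * G x n)) => // n.
  exact: (intbleZ _ mD (iG n)).
have SE : S = \int[mu]_(x in D) (\sum_(n < N) lam n `^ s * I n * G x n).
  rewrite (@Rintegral_sum _ _ _ mu D _ _ (fun (n : 'I_N) x => lam n `^ s * I n * G x n))//.
    apply: eq_bigr => n _; rewrite (RintegralZl _ mD (iG n)) -mulrA.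
    by rewrite -expr2.
  by move=> n; exact: (intbleZ _ mD (iG n)).
have key : S <= Num.sqrt S * \int[mu]_(x in D) C x.
  rewrite {1}SE -RintegralZl//; apply: le_Rintegral => //; first exact: (intbleZ _ mD iC).
  move=> x Dx.
  have [_ GN] := GC x Dx; have Cx0 := hb_ge0 (GC x Dx).
  apply: (le_trans (ler_norm _)).
  rewrite -(ler_pXn2r (n := 2))// ?nnegrE ?mulr_ge0 ?sqrtr_ge0// real_normK ?num_real//.
  under eq_bigr do rewrite -mulrA.
  apply: (le_trans (cauchy_schwarz_sum I (G x) N (weight_gt0 lam_gt0 s))).
  rewrite exprMn sqr_sqrtr//; apply: ler_wpM2l => //; exact: GN.
have [S0'|Sn0] := eqVneq S 0; first by rewrite S0' sqr_ge0.
have sS0 : 0 < Num.sqrt S by rewrite sqrtr_gt0 lt_neqAle eq_sym Sn0.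
rewrite -{1}(sqr_sqrtr S0) lerXn2r// ?nnegrE ?sqrtr_ge0//.
by rewrite -(ler_pM2l sS0) -expr2 sqr_sqrtr.
Qed.

End integrals_of_sequences.

(** * Smoothing by the family of relaxation functions *)

Section relaxation_family.
Context {R : realType}.
Local Notation mu := (@lebesgue_measure R).
Local Notation RR := (measurableTypeR R).
Variable lam : nat -> R.
Hypothesis lam_gt0 : forall n, 0 < lam n.
Local Notation hb := (wbounded lam).

Lemma powR_le_onem (x k : R) : 0 < x -> 0 <= k <= 1 -> x `^ k <= 1 + x.
Proof.
move=> x0 /andP[k0 k1]; have [x1|x1] := leP x 1.
  rewrite (@le_trans _ _ 1)//; last by rewrite lerDl ltW.
  by rewrite -(powRr0 x) ger_powR// x0.
by rewrite (le_trans (ler1_powR (ltW x1) k1))// lerDr.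
Qed.

(** Turns the two bounds 1 and [h / t] of an increment of the resolvent into one Hölder bound. *)
Lemma min1_le_powR (x k : R) : 0 < x -> 0 <= k <= 1 -> Num.min 1 x <= x `^ k.
Proof.
move=> x0 /andP[k0 k1]; rewrite ge_min; have [x1|x1] := leP x 1.
  by rewrite (ger1_powR _ k1) ?x0// orbT.
by rewrite -{1}(powRr0 x) ler_powR// ltW.
Qed.

(* Abstracts the family [W n t = omega m t (lam n)]. *)
Record relaxation (W : nat -> R -> R) : Prop := Relaxation {
  relax_cont : forall n, {within `[0, +oo[, continuous (W n)};
  relax_intble : forall n t, intble mu `]0, t[ (W n);
  relax_ge0 : forall n t, 0 <= t -> 0 <= W n t;
  relax_le1 : forall n t, 0 <= t -> W n t <= 1;
  relax_noninc : forall n s t, 0 <= s -> s <= t -> W n t <= W n s;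
  relax_int : forall n t, 0 <= t -> lam n * \int[mu]_(x in `]0, t[) W n x <= 1;
  relax_decay : forall n t, 0 < t -> W n t * (1 + lam n * t) <= 1;
  relax_lip : forall n t h, 0 < t -> 0 <= h -> W n t - W n (t + h) <= h / t }.

Variable W : nat -> R -> R.
Hypothesis relaxW : relaxation W.

Lemma relax_powR n t k : 0 < t -> 0 <= k <= 1 -> W n t <= (lam n * t) `^ (- k).
Proof.
move=> t0 k01; have lt0 : 0 < lam n * t by rewrite mulr_gt0.
rewrite powRN -div1r ler_pdivlMr ?powR_gt0//.
apply: le_trans (relax_decay relaxW n t0).
by apply: ler_wpM2l; [exact: (relax_ge0 relaxW n (ltW t0))|exact: powR_le_onem].
Qed.

(** Smoothing at a fixed time: the decay enters squared, so the weight [k + k] costs the factor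
    t^(-k). It serves to show that the integrand of the mild equation is Bochner integrable; the
    bounds of the fixed point argument rest on [relax_conv_hb]. *)
Lemma relax_pointwise s s' k t (c : nat -> R) C : 0 < t -> 0 <= k <= 1 ->
  s = s' + k + k -> hb s' c C -> hb s (fun n => W n t * c n) (t `^ (- k) * C).
Proof.
move=> t0 k01 sE [C0 cC]; split=> [|N]; first by rewrite mulr_ge0 ?powR_ge0.
rewrite exprMn (le_trans _ (ler_wpM2l (sqr_ge0 _) (cC N)))//.
rewrite mulr_sumr ler_sum// => n _.
have W0 := relax_ge0 relaxW n (ltW t0).
have h := relax_powR n t0 k01.
rewrite exprMn mulrA [leRHS]mulrA ler_wpM2r ?sqr_ge0//.
have -> : t `^ (- k) ^+ 2 * lam n `^ s' = lam n `^ s * ((lam n * t) `^ (- k)) ^+ 2.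
  rewrite powRM ?(ltW t0) ?(ltW (lam_gt0 n))// exprMn mulrA [RHS]mulrC; congr (_ * _).
  by rewrite expr2 mulrA -!powRD ?(gt_eqF (lam_gt0 n)) ?implybT//; congr (_ `^ _); rewrite sE; ring.
by rewrite ler_wpM2l ?powR_ge0// lerXn2r// nnegrE ?powR_ge0.
Qed.

Lemma relax_refl_bounded n t x : 0 < x < t -> `|W n (t - x)| <= 1.
Proof.
move=> /andP[x0 xt]; have tx : 0 <= t - x by rewrite subr_ge0 ltW.
by rewrite ger0_norm ?(relax_ge0 relaxW) ?(relax_le1 relaxW).
Qed.

Lemma relax_refl_measurable n b t : b <= t ->
  measurable_fun (`]0, b[%classic : set RR) (fun x => W n (t - x)).
Proof.
move=> bt; have := intble_measurable (intble_refl0 (relax_intble relaxW n t)).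
by apply: measurable_funS => //; apply: subset_itv; rewrite bnd_simp.
Qed.

Lemma relax_convM_intble n b t g : b <= t -> intble mu `]0, b[ g ->
  intble mu `]0, b[ (fun x => W n (t - x) * g x).
Proof.
move=> bt; apply: (@intbleMb _ RR _ _ _ _ _ 1) => //.
  exact: relax_refl_measurable.
move=> x; rewrite /= in_itv/= => /andP[x0 xb].
by apply: relax_refl_bounded; rewrite x0 (lt_le_trans xb).
Qed.

Lemma relax_refl_Rintegral n b t : 0 <= b <= t ->
  \int[mu]_(x in `]0, b[) W n (t - x) <= (lam n)^-1.
Proof.
move=> /andP[b0 bt]; have t0 := le_trans b0 bt.
rewrite -div1r ler_pdivlMr// mulrC; apply: le_trans (relax_int relaxW n t0).
rewrite ler_pM2l// -(Rintegral_refl0 (relax_intble relaxW n t)).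
apply: ge0_subset_Rintegral => //.
- exact: intble_refl0 (relax_intble relaxW n t).
- by move=> x; rewrite /= in_itv/= => /andP[x0 xt]; rewrite (relax_ge0 relaxW)// subr_ge0 ltW.
- by apply: subset_itv; rewrite bnd_simp.
Qed.

Section convolution_estimate.
Variables (s s' k : R).
Hypothesis k01 : 0 < k < 1.
Hypothesis sE : s = s' + 1 + k.

(* Cauchy-Schwarz for the measure [W n (t - x) dx], whose mass is at most [1 / lam n]; the
   remaining factor [W n (t - x)] is at most [(lam n * (t - x)) `^ (- k)]. *)
Let scalar_estimate (n : nat) (b t : R) (g : R -> R) : 0 <= b <= t ->
  measurable_fun (`]0, b[%classic : set RR) g ->
  intble mu `]0, b[ (fun x => (t - x) `^ (- k) * g x ^+ 2) ->
  intble mu `]0, b[ (fun x => W n (t - x) * g x) /\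
  lam n `^ s * (\int[mu]_(x in `]0, b[) (W n (t - x) * g x)) ^+ 2 <=
  lam n `^ s' * \int[mu]_(x in `]0, b[) ((t - x) `^ (- k) * g x ^+ 2).
Proof.
move=> /andP[b0 bt] mg ig.
have mD : measurable (`]0, b[%classic : set RR) by exact: measurable_itv.
have l0 := lam_gt0 n.
have Wx x : `]0, b[%classic x ->
    0 <= W n (t - x) /\ W n (t - x) <= lam n `^ (- k) * (t - x) `^ (- k).
  rewrite /= in_itv/= => /andP[x0 xb]; have tx : 0 < t - x by rewrite subr_gt0 (lt_le_trans xb).
  split; first by rewrite (relax_ge0 relaxW)// ltW.
  rewrite -powRM; [|exact: ltW|exact: ltW]; apply: relax_powR => //.
  by case/andP: k01 => k0 k1; rewrite !ltW.
have mW := @relax_refl_measurable n b t bt.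
have iW : intble mu `]0, b[ (fun x => W n (t - x)).
  have := relax_convM_intble n bt (cst_intble 0 b 1).
  by apply: eq_intble => // x _ /=; rewrite mulr1.
have iWg2 : intble mu `]0, b[ (fun x => W n (t - x) * g x ^+ 2).
  apply: (le_intble mD _ (intbleZ (lam n `^ (- k)) mD ig)).
    by apply: measurable_funM => //; exact: measurable_funX.
  move=> x Dx; have [W0 Wle] := Wx _ Dx.
  by rewrite (ger0_norm (mulr_ge0 W0 (sqr_ge0 _))) mulrA ler_wpM2r ?sqr_ge0.
have iWg : intble mu `]0, b[ (fun x => W n (t - x) * g x).
  apply: (le_intble mD _ (intbleD mD iW iWg2)); first exact: measurable_funM.
  move=> x Dx; have [W0 _] := Wx _ Dx.
  rewrite normrM (ger0_norm W0) [leRHS](_ : _ = W n (t - x) * (1 + g x ^+ 2)); last by rewrite mulrDr mulr1.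
  apply: ler_wpM2l => //.
  have := sqr_ge0 (`|g x| - 1); rewrite sqrrB mulr1 expr1n real_normK ?num_real//.
  have := normr_ge0 (g x); have := sqr_ge0 (g x); lra.
split=> //.
set Q := \int[mu]_(x in _) (W n (t - x) * g x).
set S := \int[mu]_(x in `]0, b[) (W n (t - x) * g x ^+ 2).
have QS : lam n * Q ^+ 2 <= S.
  (* This value minimizes [S - 2 * y * Q + y ^+ 2 / lam n], the bound for the integral of
     [W n (t - x) * (g x - y) ^+ 2] when the mass is at most [1 / lam n]. *)
  pose y := lam n * Q.
  have Wb : \int[mu]_(x in `]0, b[) W n (t - x) <= (lam n)^-1.
    by apply: relax_refl_Rintegral; rewrite b0.
  have : 0 <= \int[mu]_(x in `]0, b[) (W n (t - x) * (g x - y) ^+ 2).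
    by apply: Rintegral_ge0 => x Dx; have [W0 _] := Wx _ Dx; rewrite mulr_ge0 ?sqr_ge0.
  have -> : \int[mu]_(x in `]0, b[) (W n (t - x) * (g x - y) ^+ 2) =
      S - 2 * y * Q + y ^+ 2 * \int[mu]_(x in `]0, b[) W n (t - x).
    rewrite /S /Q -RintegralZl// -RintegralB//; last exact: intbleZ.
    rewrite -RintegralZl// -RintegralD//; last 2 first.
    - by apply: intbleB => //; exact: intbleZ.
    - exact: intbleZ.
    by apply: eq_Rintegral => x _; ring.
  have : y ^+ 2 * \int[mu]_(x in `]0, b[) W n (t - x) <= y ^+ 2 * (lam n)^-1.
    by rewrite ler_wpM2l ?sqr_ge0.
  have -> : y ^+ 2 * (lam n)^-1 = lam n * Q ^+ 2 by rewrite /y; field; rewrite gt_eqF.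
  have -> : 2 * y * Q = 2 * (lam n * Q ^+ 2) by rewrite /y; ring.
  lra.
have SI : S <= lam n `^ (- k) * \int[mu]_(x in `]0, b[) ((t - x) `^ (- k) * g x ^+ 2).
  rewrite -RintegralZl//; apply: le_Rintegral => //; first exact: intbleZ.
  by move=> x Dx; have [_ Wle] := Wx _ Dx; rewrite mulrA ler_wpM2r ?sqr_ge0.
have lsE : lam n `^ s = lam n `^ s' * lam n `^ k * lam n.
  rewrite -[X in _ * _ * X](powRr1 (ltW l0)) -!powRD ?(gt_eqF l0) ?implybT//.
  by congr (_ `^ _); rewrite sE; ring.
rewrite lsE -[leLHS]mulrA -[leLHS]mulrA ler_wpM2l ?powR_ge0//.
apply: (@le_trans _ _ (lam n `^ k * S)); first by rewrite ler_wpM2l ?powR_ge0.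
apply: (le_trans (ler_wpM2l (powR_ge0 _ _) SI)).
by rewrite mulrA powRN mulfV ?mul1r// gt_eqF// powR_gt0.
Qed.

(** The scalar estimates are summed under the integral, where the weighted squares of [g x] are
    bounded by [q x ^+ 2]. The upper limit [b] may lie below [t], because an increment of the
    convolution contains its part over []0, h[] at time [t + h]. *)
Lemma relax_conv_hb (b t : R) (g : R -> nat -> R) (q : R -> R) Q :
  0 <= b <= t -> 0 <= Q ->
  (forall n, measurable_fun (`]0, b[%classic : set RR) (g ^~ n)) ->
  (forall x, 0 < x < b -> hb s' (g x) (q x)) ->
  intble mu `]0, b[ (fun x => (t - x) `^ (- k) * q x ^+ 2) ->
  \int[mu]_(x in `]0, b[) ((t - x) `^ (- k) * q x ^+ 2) <= Q ^+ 2 ->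
  (forall n, intble mu `]0, b[ (fun x => W n (t - x) * g x n)) /\
  hb s (fun n => \int[mu]_(x in `]0, b[) (W n (t - x) * g x n)) Q.
Proof.
move=> bt Q0 mg gq iq qQ.
have mD : measurable (`]0, b[%classic : set RR) by exact: measurable_itv.
have mtk : measurable_fun (`]0, b[%classic : set RR) (fun x => (t - x) `^ (- k)).
  by apply: (measurableT_comp (measurable_powR (- k))) => //; exact: measurable_funB.
have ig n : intble mu `]0, b[ (fun x => (t - x) `^ (- k) * g x n ^+ 2).
  apply: (le_intble mD _ (intbleZ (lam n `^ s')^-1 mD iq)).
    by apply: measurable_funM => //; exact: measurable_funX.
  move=> x; rewrite /= in_itv/= => Dx.
  rewrite (ger0_norm (mulr_ge0 (powR_ge0 _ _) (sqr_ge0 _))) [leRHS]mulrCA ler_wpM2l ?powR_ge0//.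
  by rewrite ler_pdivlMl ?weight_gt0//; apply: hb_coef => //; exact: gq.
split=> [n|]; first by have [] := scalar_estimate n bt (mg n) (ig n).
split=> // N; apply: le_trans qQ.
apply: (@le_trans _ _ (\sum_(n < N)
    lam n `^ s' * \int[mu]_(x in `]0, b[) ((t - x) `^ (- k) * g x n ^+ 2))).
  by apply: ler_sum => n _; have [] := scalar_estimate n bt (mg n) (ig n).
have il (n : 'I_N) : intble mu `]0, b[
    (fun x => lam n `^ s' * ((t - x) `^ (- k) * g x n ^+ 2)) := intbleZ _ mD (ig n).
under eq_bigr do rewrite -(RintegralZl _ mD (ig _)).
rewrite -(Rintegral_sum _ mD il); apply: le_Rintegral => //; first exact: intble_sum.
move=> x; rewrite /= in_itv/= => Dx.
under eq_bigr do rewrite mulrCA.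
rewrite -mulr_sumr ler_wpM2l ?powR_ge0//.
by have [_ /(_ N)] := gq _ Dx.
Qed.

End convolution_estimate.

End relaxation_family.

(** * Trajectories and memory terms *)

Section trajectories.
Context {R : realType}.
Local Notation mu := (@lebesgue_measure R).
Local Notation RR := (measurableTypeR R).
Variable lam : nat -> R.
Hypothesis lam_gt0 : forall n, 0 < lam n.
Local Notation hb := (wbounded lam).
Variable T : R.
Implicit Types (U V : R -> nat -> R) (s t h : R).

Lemma shift_itv t h : 0 <= t -> 0 <= h -> t + h <= T ->
  0 <= t <= T /\ 0 <= t + h <= T.
Proof. by move=> t0 h0 thT; split; [rewrite t0 (le_trans _ thT)// lerDl|rewrite thT addr_ge0]. Qed.

(** Continuity is required uniformly in [t], since the increment of a convolution involves the
    increments of its argument at all earlier times. Forward increments match the shift of the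
    variable of integration. *)
Definition ucont s U := forall e, 0 < e -> exists2 eta, 0 < eta &
  forall t h, 0 <= t -> 0 <= h -> h < eta -> t + h <= T ->
    hb s (fun n => U (t + h) n - U t n) e.

Lemma ucont0 s : ucont s (fun _ _ => 0).
Proof.
move=> e e0; exists 1 => // t h _ _ _ _.
by apply: (eq_hb (c := fun=> 0)) => [n|]; [rewrite subrr|exact/hb0/ltW].
Qed.

Lemma ucontD s U V : ucont s U -> ucont s V -> ucont s (fun t n => U t n + V t n).
Proof.
move=> cU cV e e0; have e20 : 0 < e / 2 by rewrite divr_gt0.
have [x x0 Ux] := cU _ e20; have [y y0 Vy] := cV _ e20.
exists (Num.min x y) => [|t h t0 h0]; first by rewrite lt_min x0.
rewrite lt_min => /andP[hx hy] thT.
rewrite [e]splitr; apply: eq_hb (hbD lam_gt0 (Ux _ _ t0 h0 hx thT) (Vy _ _ t0 h0 hy thT)) => n /=.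
ring.
Qed.

Lemma ucont_measurable s U n : ucont s U ->
  measurable_fun (`]0, T[%classic : set RR) (U ^~ n).
Proof.
move=> cU; apply: open_continuous_measurable_fun; first exact: interval_open.
move=> x; rewrite inE/= in_itv/= => /andP[x0 xT].
set k := Num.sqrt (lam n `^ s)^-1.
have k0 : 0 < k + 1 by rewrite ltr_wpDl// sqrtr_ge0.
apply/cvgrPdist_le => e e0.
have [eta eta0 Ueta] := cU (e / (k + 1)) (divr_gt0 e0 k0).
have bnd (f : nat -> R) : hb s f (e / (k + 1)) -> `|f n| <= e.
  move=> /(hb_abs lam_gt0 n) /le_trans; apply; rewrite -/k mulrA ler_pdivrMr//.
  by rewrite mulrC ler_pM2l// lerDl.
near=> y.
have yx : `|x - y| < eta by near: y; exact: cvgr_dist_lt.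
have y0 : 0 < y by near: y; exact: lt_nbhsr.
have yT : y < T by near: y; exact: lt_nbhsl.
have [xy|xy] := leP x y.
  rewrite distrC; have := bnd _ (Ueta x (y - x) (ltW x0) _ _ _).
  rewrite /= (_ : x + (y - x) = y); last by ring.
  apply; rewrite ?subr_ge0//; last exact: ltW.
  by move: yx; rewrite ler0_norm ?opprB// subr_le0.
have := bnd _ (Ueta y (x - y) (ltW y0) _ _ _).
rewrite /= (_ : y + (x - y) = x); last by ring.
apply; rewrite ?subr_ge0//; [exact: ltW| |exact: ltW].
by move: yx; rewrite gtr0_norm// subr_gt0.
Unshelve. all: by end_near. Qed.

Lemma ucont_measurable_sub s U n b : b <= T -> ucont s U ->
  measurable_fun (`]0, b[%classic : set RR) (U ^~ n).
Proof.
move=> bT /(ucont_measurable n); apply: measurable_funS => //.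
by apply: subset_itv; rewrite bnd_simp.
Qed.

Lemma measurable_fun_shift (f : R -> R) t h : 0 <= h -> t + h <= T ->
  measurable_fun (`]0, T[%classic : set RR) f ->
  measurable_fun (`]0, t[%classic : set RR) (fun x => f (x + h)).
Proof.
move=> h0 thT mf; apply: (measurable_comp _ _ mf) => //; last exact: measurable_funD.
by move=> _ [x + <-]; rewrite /= !in_itv/= => /andP[x0 xt]; apply/andP; split; lra.
Qed.

(** After []0, h[] is cut off, the rest of the longer integral is shifted by [h]: both integrals
    then have the same kernel and the increment falls on [f]. *)
Lemma Rintegral_shift_decomp (k f : R -> R) t h : 0 <= t -> 0 <= h ->
  intble mu `]0, t + h[ (fun x => k (t + h - x) * f x) ->
  intble mu `]0, t[ (fun x => k (t - x) * f x) ->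
  \int[mu]_(x in `]0, t + h[) (k (t + h - x) * f x) -
  \int[mu]_(x in `]0, t[) (k (t - x) * f x) =
  \int[mu]_(x in `]0, h[) (k (t + h - x) * f x) +
  \int[mu]_(x in `]0, t[) (k (t - x) * (f (x + h) - f x)).
Proof.
move=> t0 h0 i1 i2.
have hth : h <= t + h by rewrite lerDr.
rewrite (Rintegral_itv_split h0 hth i1).
have i3 : intble mu `]h, t + h[ (fun x => k (t + h - x) * f x).
  exact: (intbleSoo h0 (lexx _) i1).
have e : (fun y : R => y + h) @^-1` `]h, t + h[ = `]0, t[%classic.
  by rewrite shift_itvoo subrr addrK.
have i4 := intble_shift h (measurable_itv _) i3.
rewrite (Rintegral_shift h _ i3)//; rewrite e in i4 *.
rewrite -addrA; congr (_ + _).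
have -> : \int[mu]_(x in `]0, t[) (k (t + h - (x + h)) * f (x + h)) =
    \int[mu]_(x in `]0, t[) (k (t - x) * f (x + h)).
  by apply: eq_Rintegral => x _; congr (k _ * _); ring.
rewrite -RintegralB//; last first.
  by apply: eq_intble i4 => // x _; congr (k _ * _); ring.
by apply: eq_Rintegral => x _; rewrite mulrBr.
Qed.

(** * The memory operator on coefficient trajectories *)

Section memory_term.
Variables (ell : R -> R) (mu_ : R).
Hypothesis ell_i : intble mu `]0, T[ ell.

Definition history U t n := \int[mu]_(x in `]0, t[) (ell (t - x) * U x n).

Local Notation nell := (L1norm ell T).

Lemma ell_intble a b : 0 <= a -> b <= T -> intble mu `]a, b[ ell.
Proof. by move=> a0 bT; exact: intbleSoo ell_i. Qed.

Lemma ell_refl_intble t : t <= T -> intble mu `]0, t[ (fun x => `|ell (t - x)|).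
Proof. by move=> tT; exact/intble_norm/intble_refl0/ell_intble. Qed.

Lemma L1norm_ge0 : 0 <= nell. Proof. by apply: Rintegral_ge0. Qed.

Lemma ell_refl_le_L1norm t : t <= T -> \int[mu]_(x in `]0, t[) `|ell (t - x)| <= nell.
Proof.
move=> tT; rewrite (Rintegral_refl0 (intble_norm (ell_intble (lexx 0) tT))).
apply: ge0_subset_Rintegral => //; first exact: intble_norm.
by apply: subset_itv; rewrite bnd_simp.
Qed.

(* [B] bounds the integrand pointwise in time. *)
Lemma ell_conv_hb U (B : R -> R) b t : 0 <= b -> b <= t -> t <= T ->
  (forall n, measurable_fun (`]0, b[%classic : set RR) (U ^~ n)) ->
  intble mu `]0, b[ (fun x => `|ell (t - x)| * B x) ->
  (forall x, 0 < x < b -> hb mu_ (U x) (B x)) ->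
  (forall n, intble mu `]0, b[ (fun x => ell (t - x) * U x n)) /\
  hb mu_ (fun n => \int[mu]_(x in `]0, b[) (ell (t - x) * U x n))
         (\int[mu]_(x in `]0, b[) (`|ell (t - x)| * B x)).
Proof.
move=> b0 bt tT mU iB UB.
have mD : measurable (`]0, b[%classic : set RR) by exact: measurable_itv.
have mell : measurable_fun (`]0, b[%classic : set RR) (fun x => ell (t - x)).
  have := intble_measurable (intble_refl0 (ell_intble (lexx 0) tT)).
  by apply: measurable_funS => //; apply: subset_itv; rewrite bnd_simp.
have mG n : measurable_fun (`]0, b[%classic : set RR) (fun x => ell (t - x) * U x n).
  exact: measurable_funM.
have GB x : (`]0, b[%classic : set RR) x ->
    hb mu_ (fun n => ell (t - x) * U x n) (`|ell (t - x)| * B x).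
  by rewrite /= in_itv/= => Dx; apply: hbZ => //; exact: UB.
split=> [n|]; first exact: (hb_intble lam_gt0 n mD mG iB GB).
exact: (hb_Rintegral lam_gt0 mD mG iB GB).
Qed.

Lemma mem_hb U A t : 0 <= t <= T ->
  (forall n, measurable_fun (`]0, t[%classic : set RR) (U ^~ n)) ->
  (forall x, 0 < x < t -> hb mu_ (U x) A) -> 0 <= A ->
  (forall n, intble mu `]0, t[ (fun x => ell (t - x) * U x n)) /\
  hb mu_ (history U t) (nell * A).
Proof.
move=> /andP[t0 tT] mU UA A0.
have iB : intble mu `]0, t[ (fun x => `|ell (t - x)| * A).
  by apply: intbleZr => //; exact: ell_refl_intble.
have [iU hU] := ell_conv_hb t0 (lexx t) tT mU iB UA.
split=> //; apply: (hb_le hU); rewrite RintegralZr//; last exact: ell_refl_intble.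
by rewrite ler_wpM2r// ell_refl_le_L1norm.
Qed.

Lemma memB_hb U V A t : 0 <= t <= T ->
  (forall n, measurable_fun (`]0, t[%classic : set RR) (U ^~ n)) ->
  (forall n, measurable_fun (`]0, t[%classic : set RR) (V ^~ n)) ->
  (forall n, intble mu `]0, t[ (fun x => ell (t - x) * U x n)) ->
  (forall n, intble mu `]0, t[ (fun x => ell (t - x) * V x n)) ->
  (forall x, 0 < x < t -> hb mu_ (fun n => U x n - V x n) A) -> 0 <= A ->
  hb mu_ (fun n => history U t n - history V t n) (nell * A).
Proof.
move=> tT mU mV iU iV UVA A0.
have mUV n : measurable_fun (`]0, t[%classic : set RR) (fun x => U x n - V x n).
  exact: measurable_funB.
have [_] := mem_hb tT mUV UVA A0; apply: eq_hb => n.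
rewrite /history -(RintegralB _ (iU n) (iV n))//.
by apply: eq_Rintegral => x _; rewrite mulrBr.
Qed.

(** In the part over []0, h[], reflection turns the kernel into [ell] on []t, t + h[], and only the
    size of [U] is used. The bound [B] may vary with time: it is constant for continuity and
    singular at 0 for the Hölder estimate. *)
Lemma mem_shift_hb U A (B : R -> R) t h : 0 <= t -> 0 <= h -> t + h <= T ->
  ucont mu_ U -> 0 <= A -> (forall x, 0 <= x <= T -> hb mu_ (U x) A) ->
  intble mu `]0, t[ (fun x => `|ell (t - x)| * B x) ->
  (forall x, 0 < x < t -> hb mu_ (fun n => U (x + h) n - U x n) (B x)) ->
  hb mu_ (fun n => history U (t + h) n - history U t n)
    (\int[mu]_(x in `]t, t + h[) `|ell x| * A +
     \int[mu]_(x in `]0, t[) (`|ell (t - x)| * B x)).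
Proof.
move=> t0 h0 thT cU A0 UA iB UB.
have th0 : 0 <= t + h by exact: addr_ge0.
have tT : t <= T by apply: le_trans thT; rewrite lerDl.
have hth : h <= t + h by rewrite lerDr.
have tth : t <= t + h by rewrite lerDl.
have hT : h <= T by exact: le_trans thT.
have mU n b : b <= T -> measurable_fun (`]0, b[%classic : set RR) (U ^~ n).
  by move=> bT; exact: ucont_measurable_sub cU.
have UA' b : b <= T -> forall x, 0 < x < b -> hb mu_ (U x) A.
  by move=> bT x /andP[x0 xb]; apply: UA; rewrite ltW//= (le_trans (ltW xb)).
have [i1 _] := mem_hb (ltac:(by rewrite th0) : 0 <= t + h <= T) (fun n => mU n _ thT) (UA' _ thT) A0.
have [i2 _] := mem_hb (ltac:(by rewrite t0) : 0 <= t <= T) (fun n => mU n _ tT) (UA' _ tT) A0.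
have mUh n : measurable_fun (`]0, t[%classic : set RR) (fun x => U (x + h) n - U x n).
  apply: measurable_funB; last exact: mU.
  by apply: (measurable_fun_shift h0 thT (mU n _ (lexx T))).
have [_ hb2] := ell_conv_hb t0 (lexx t) tT mUh iB UB.
have ith : intble mu `]0, h[ (fun x => `|ell (t + h - x)|).
  by apply: (intbleSoo (lexx 0) hth); exact: ell_refl_intble.
have iA : intble mu `]0, h[ (fun x => `|ell (t + h - x)| * A).
  exact: intbleZr.
have [_ hb1] := ell_conv_hb h0 hth thT (fun n => mU n _ hT) iA (UA' _ hT).
have E : \int[mu]_(x in `]0, h[) (`|ell (t + h - x)| * A) =
    \int[mu]_(x in `]t, t + h[) `|ell x| * A.
  rewrite RintegralZr//; congr (_ * _).
  rewrite (Rintegral_refl (t + h) _ (intble_norm (ell_intble t0 thT)))//.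
  by rewrite refl_itvoo subrr (addrC t h) addrK.
rewrite -E; apply: eq_hb (hbD lam_gt0 hb1 hb2) => n.
by rewrite /history (Rintegral_shift_decomp t0 h0 (i1 n) (i2 n)).
Qed.

Lemma ell_absolutely_continuous e : 0 < e -> exists2 eta, 0 < eta &
  forall t h, 0 <= t -> 0 <= h -> h < eta -> t + h <= T ->
    \int[mu]_(x in `]t, t + h[) `|ell x| <= e.
Proof.
move=> e0.
have mD : measurable (`]0, T[%classic : set RR) by exact: measurable_itv.
have i' := (intble_patch ell mD).1 ell_i.
have [eta [eta0 etaP]] := integral_normr_continuous i' e0.
exists eta => // t h t0 h0 heta thT.
have tth : t <= t + h by rewrite lerDl.
have -> : \int[mu]_(x in `]t, t + h[) `|ell x| =
    \int[mu]_(x in `]t, t + h[) `|(ell \_ (`]0, T[%classic : set RR)) x|.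
  apply: eq_Rintegral => x; rewrite inE/= in_itv/= => /andP[tx xth].
  by rewrite patchE mem_setE in_itv/= (le_lt_trans t0 tx) (lt_le_trans xth).
apply/ltW/etaP => //.
have Em : mu `]t, t + h[ = h%:E.
  rewrite -(@fineK _ (mu _)) ?fine_lebesgue_itvoo//; first by congr EFin; ring.
  by rewrite ge0_fin_numE// lebesgue_measure_itvoo.
have htE : (h%:E < eta%:E)%E by rewrite lte_fin.
exact: (@eq_ind_r _ _ (fun z => (z < eta%:E)%E) htE _ Em).
Qed.

Lemma mem_ucont U A : 0 <= A -> ucont mu_ U ->
  (forall x, 0 <= x <= T -> hb mu_ (U x) A) -> ucont mu_ (history U).
Proof.
move=> A0 cU UA e e0.
(* The summand 1 keeps the divisors positive when [A] or the L^1 norm of [ell] is 0. *)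
have A10 : 0 < A + 1 by rewrite ltr_wpDl.
have n10 : 0 < nell + 1 by rewrite ltr_wpDl// L1norm_ge0.
have e20 : 0 < e / 2 by rewrite divr_gt0.
have [x x0 xP] := ell_absolutely_continuous (divr_gt0 e20 A10).
have [y y0 yP] := cU _ (divr_gt0 e20 n10).
exists (Num.min x y) => [|t h t0 h0]; first by rewrite lt_min x0.
rewrite lt_min => /andP[hx hy] thT.
have tT : t <= T by apply: le_trans thT; rewrite lerDl.
set B := e / 2 / (nell + 1).
have iB : intble mu `]0, t[ (fun x => `|ell (t - x)| * B).
  by apply: intbleZr => //; exact: ell_refl_intble.
have UB z : 0 < z < t -> hb mu_ (fun n => U (z + h) n - U z n) B.
  move=> /andP[z0 zt]; apply: yP => //; first exact: ltW.
  by apply: le_trans thT; rewrite lerD2r ltW.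
apply: (hb_le (mem_shift_hb t0 h0 thT cU A0 UA iB UB)).
rewrite [leRHS]splitr; apply: lerD.
  apply: (@le_trans _ _ (e / 2 / (A + 1) * A)); first by rewrite ler_wpM2r// xP.
  by rewrite mulrAC ler_pdivrMr// ler_pM2l// lerDl.
rewrite RintegralZr//; last exact: ell_refl_intble.
apply: (@le_trans _ _ (nell * B)).
  by rewrite ler_wpM2r ?ell_refl_le_L1norm// /B divr_ge0 ?ltW.
rewrite /B [leLHS]mulrA ler_pdivrMr// mulrC ler_pM2l// lerDl.
exact: ler01.
Qed.

End memory_term.

End trajectories.

Lemma geometric_cvg (R : realType) (u : nat -> R) c : 0 <= c ->
  (forall i j, `|u (j + i)%N - u j| <= c * 2^-1 ^+ j) -> cvgn u.
Proof.
move=> c0 cau; apply: cauchy_cvg; apply: cauchy_exP => e e0.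
have h0 : c * 2^-1 ^+ j @[j --> \oo] --> (0 : R).
  by apply: cvg_geometric; rewrite ger0_norm// invf_lt1// ltr1n.
have /cvgrPdist_lt/(_ _ e0)[N _ NP] := h0.
exists (u N); exists N => // j /= Nj; rewrite /ball/= distrC -(subnKC Nj).
apply: (le_lt_trans (cau _ _)); have := NP N (leqnn N).
by rewrite /= sub0r normrN ger0_norm// mulr_ge0 ?exprn_ge0.
Qed.

(** * Uniform continuity on a compact interval *)

Section uniform_continuity.
Context {R : realType}.
Implicit Types (T e eta : R) (E : R -> R -> R -> Prop).

(** The relation [E e x y] expresses closeness up to [e] of the values at [x] and [y]. In this form
    the argument covers both real functions and trajectories whose increments are measured by
    [wbounded]. *)
Lemma heine_cantor T E :
  (forall e r x y, E e x r -> E e y r -> E (e + e) x y) ->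
  (forall r, 0 <= r <= T -> forall e, 0 < e -> exists2 eta, 0 < eta &
     forall x, 0 <= x <= T -> `|x - r| < eta -> E e x r) ->
  forall e, 0 < e -> exists2 eta, 0 < eta &
    forall x y, 0 <= x <= T -> 0 <= y <= T -> `|x - y| < eta -> E e x y.
Proof.
move=> E2 Ec e e0.
pose P (eta x : R) := 0 <= x <= T -> forall y, 0 <= y <= T -> `|y - x| < eta -> E e y x.
have cov : near_covering (`[0, T]%classic : set R).
  by apply/compact_near_coveringP; exact: segment_compact.
have [d /= d0 dP] : \forall eta \near 0^'+, `[0, T] `<=` P eta.
  apply: cov => r; rewrite /= in_itv/= => rT.
  have e20 : 0 < e / 2 by rewrite divr_gt0.
  have [eta eta0 etaP] := Ec r rT _ e20.
  have eta20 : 0 < eta / 2 by rewrite divr_gt0.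
  exists (ball r (eta / 2), [set x | 0 < x < eta / 2]).
    split; first exact: nbhsx_ballx.
    by near=> z; apply/andP; split; near: z; [exact: nbhs_right_gt|exact: nbhs_right_lt].
  move=> [x i]/= [rx /andP[i0 ieta]] xT y yT yx.
  rewrite [e]splitr; apply: (E2 _ r); apply: etaP => //.
    rewrite (le_lt_trans (ler_distD x _ _))// [eta]splitr ltrD//.
      exact: lt_trans ieta.
    by move: rx; rewrite /ball/= distrC.
  move: rx; rewrite /ball/= distrC => /lt_trans; apply.
  by rewrite ltr_pdivrMr// ltr_pMr// ltr1n.
have d20 : 0 < d / 2 by rewrite divr_gt0.
exists (d / 2) => // x y xT yT xy; apply: (dP (d / 2)) => //=.
by rewrite sub0r normrN gtr0_norm// ltr_pdivrMr// ltr_pMr// ltr1n.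
Unshelve. all: by end_near. Qed.

Lemma continuous_itvcy_uniform (w : R -> R) T : {within `[0, +oo[, continuous w} ->
  forall e, 0 < e -> exists2 eta, 0 < eta &
    forall x y, 0 <= x <= T -> 0 <= y <= T -> `|x - y| < eta -> `|w x - w y| <= e.
Proof.
move=> cw; apply: (@heine_cantor T (fun e x y => `|w x - w y| <= e)).
  move=> e r x y xr yr; rewrite (le_trans (ler_distD (w r) _ _))// lerD//.
  by rewrite distrC.
move=> r /andP[r0 _] e e0.
have rin : `[0, +oo[%classic r by rewrite /= in_itv/= r0.
have /subspace_continuousP/(_ _ rin)/cvgrPdist_le/(_ _ e0) := cw.
rewrite /prop_near1/= /within/= => /nbhs_ballP[eta /= eta0 etaP].
exists eta => // x /andP[x0 _] xr; rewrite distrC; apply: etaP.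
  by rewrite /ball/= distrC.
by rewrite /= in_itv/= x0.
Qed.

End uniform_continuity.

Section tails.
Context {R : realType}.
Variable lam : nat -> R.
Hypothesis lam_gt0 : forall n, 0 < lam n.
Local Notation hb := (wbounded lam).

(** [N] is chosen so that the partial sum up to [N] is within [e ^+ 2] of the supremum of all
    partial sums; a later cut only removes further terms. *)
Lemma hb_tail s c C : hb s c C -> forall e, 0 < e ->
  exists N, forall M, (N <= M)%N -> hb s (fun n => if (n < M)%N then 0 else c n) e.
Proof.
move=> [C0 cC] e e0.
pose S N := \sum_(n < N) lam n `^ s * c n ^+ 2.
have hs : has_sup (range S).
  split; first by exists (S 0%N), 0%N.
  by exists (C ^+ 2) => _ [N _ <-]; exact: cC.
have e20 : 0 < e ^+ 2 by rewrite exprn_gt0.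
have [_ [N _ <-] SN] := sup_adherent e20 hs.
suff hN : hb s (fun n => if (n < N)%N then 0 else c n) e.
  exists N => M NM; rewrite -[e]mul1r; apply: hb_dom hN => // n; rewrite mul1r.
  case: (ltnP n M) => nM; first by rewrite normr0.
  by rewrite ltnNge (leq_trans NM nM).
split=> [|M]; first exact: ltW.
have Sub M' : S M' <= sup (range S) by apply: ub_le_sup; [case: hs|exists M'].
have t0 n : 0 <= lam n `^ s * c n ^+ 2 by rewrite mulr_ge0 ?powR_ge0 ?sqr_ge0.
have [MN|NM] := leqP M N.
  rewrite big1 ?ltW// => n _.
  by rewrite (leq_trans (ltn_ord n) MN) expr0n/= mulr0.
have -> : \sum_(n < M) lam n `^ s * (if (n < N)%N then 0 else c n) ^+ 2 = S M - S N.
  rewrite /S -!(big_mkord xpredT (fun n => lam n `^ s * c n ^+ 2)).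
  rewrite -(big_mkord xpredT (fun n => lam n `^ s * (if (n < N)%N then 0 else c n) ^+ 2)).
  rewrite (big_cat_nat (n := N))//= ?(ltnW NM)// [in RHS](big_cat_nat (n := N))//= ?(ltnW NM)//.
  rewrite [X in _ = X - _]addrC addrK big_nat big1 ?add0r//; last first.
    by move=> n /andP[_ ->]; rewrite expr0n/= mulr0.
  by apply: eq_big_nat => n /andP[Nn _]; rewrite ltnNge Nn.
have := Sub M; move: SN; rewrite /S; lra.
Qed.

End tails.

(** * Regularity of the resolvent and of its convolutions *)

Section resolvent_trajectories.
Context {R : realType}.
Local Notation mu := (@lebesgue_measure R).
Local Notation RR := (measurableTypeR R).
Variable lam : nat -> R.
Hypothesis lam_gt0 : forall n, 0 < lam n.
Local Notation hb := (wbounded lam).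
Variables (W : nat -> R -> R) (T : R).
Hypothesis relaxW : relaxation lam W.
Hypothesis T0 : 0 < T.
Local Notation ucont := (ucont lam T).

Definition resolve (xi : nat -> R) t n := W n t * xi n.

Lemma resolve_hb s xi C t : 0 <= t -> hb s xi C -> hb s (resolve xi t) C.
Proof.
move=> t0 hxi; rewrite -[C]mul1r; apply: hb_dom hxi => // n.
rewrite normrM ler_wpM2r// ger0_norm; first exact: relax_le1 relaxW _ _ t0.
exact: relax_ge0 relaxW _ _ t0.
Qed.

Lemma resolve_diff_norm n t h : 0 <= t -> 0 <= h -> `|W n (t + h) - W n t| <= 1.
Proof.
move=> t0 h0; have th0 : 0 <= t + h by exact: addr_ge0.
rewrite ler_norml; have := relax_ge0 relaxW n t0; have := relax_le1 relaxW n t0.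
have := relax_ge0 relaxW n th0; have := relax_le1 relaxW n th0; lra.
Qed.

(** Finitely many coefficients are handled by the uniform continuity of their functions [W n]; the
    remaining ones are uniformly small because an increment of [W n] is at most 1 in absolute
    value. *)
Lemma resolve_ucont s xi C : hb s xi C -> ucont s (resolve xi).
Proof.
move=> hxi e e0; have C0 := hb_ge0 hxi.
have e20 : 0 < e / 2 by rewrite divr_gt0.
have C10 : 0 < C + 1 by rewrite ltr_wpDl.
have [N /(_ N (leqnn N)) hN] := hb_tail hxi e20.
have d0 : 0 < e / 2 / (C + 1) by rewrite divr_gt0.
have [eta eta0 etaP] : exists2 eta, 0 < eta & forall n, (n < N)%N ->
    forall x y, 0 <= x <= T -> 0 <= y <= T -> `|x - y| < eta ->
      `|W n x - W n y| <= e / 2 / (C + 1).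
  elim: (N) => [|M [x x0 xP]]; first by exists 1.
  have [y y0 yP] := @continuous_itvcy_uniform _ _ T (relax_cont relaxW (n := M)) _ d0.
  exists (Num.min x y) => [|n]; first by rewrite lt_min x0.
  rewrite ltnS leq_eqVlt => /predU1P[->|nM] z z' zT z'T.
    by rewrite lt_min => /andP[_]; exact: yP.
  by rewrite lt_min => /andP[+ _]; exact: xP.
exists eta => // t h t0 h0 heta thT.
have tT : t <= T by apply: le_trans thT; rewrite lerDl.
rewrite [e]splitr.
pose c1 n := if (n < N)%N then (W n (t + h) - W n t) * xi n else 0.
pose c2 n := if (n < N)%N then 0 else (W n (t + h) - W n t) * xi n.
have h1 : hb s c1 (e / 2).
  apply: (@hb_le _ _ _ _ (e / 2 / (C + 1) * C)); last first.
    by rewrite mulrAC ler_pdivrMr// ler_pM2l// lerDl.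
  apply: hb_dom hxi => [|n]; first exact: ltW.
  rewrite /c1; case: ifPn => nN; last by rewrite normr0 mulr_ge0// ltW.
  rewrite normrM ler_wpM2r// etaP ?addr_ge0 ?t0//.
  by rewrite addrAC subrr add0r ger0_norm.
have h2 : hb s c2 (e / 2).
  rewrite -[e / 2]mul1r; apply: hb_dom hN => // n; rewrite /c2; case: ifPn => nN.
    by rewrite normr0 mulr0.
  by rewrite normrM ler_wpM2r// resolve_diff_norm.
apply: eq_hb (hbD lam_gt0 h1 h2) => n; rewrite /c1 /c2 /resolve mulrBl.
by case: ifPn => _; rewrite ?addr0 ?add0r.
Qed.

Lemma resolve_hoelder s xi C g t h : 0 <= g <= 1 -> 0 < t -> 0 < h ->
  hb s xi C -> hb s (fun n => resolve xi (t + h) n - resolve xi t n) ((h / t) `^ g * C).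
Proof.
move=> g01 t0 h0; apply: hb_dom => [|n]; first exact: powR_ge0.
have ht0 : 0 < h / t by rewrite divr_gt0.
rewrite /resolve -mulrBl normrM ler_wpM2r//.
apply: le_trans (min1_le_powR ht0 g01); rewrite le_min.
rewrite (resolve_diff_norm _ (ltW t0) (ltW h0))/= distrC ger0_norm.
  by apply: (relax_lip relaxW) => //; exact: ltW.
by rewrite subr_ge0; apply: (relax_noninc relaxW); rewrite ?lerDl ltW.
Qed.

Section conv.
Variables (s s' k : R).
Hypothesis k01 : 0 < k < 1.
Hypothesis sE : s = s' + 1 + k.

Definition wconv (g : R -> nat -> R) t n := \int[mu]_(x in `]0, t[) (W n (t - x) * g x n).

(** Its square bounds the integral of (t - x)^(-k) over []0, t[] for all [t <= T], so it is the
    factor from a bound on [g], uniform in time, to one on [wconv g]. *)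
Definition Theta := Num.sqrt (T `^ (1 - k) / (1 - k)).

Let k1 : 0 < 1 - k. Proof. by rewrite subr_gt0; case/andP: k01. Qed.

Lemma Theta_sqr : Theta ^+ 2 = T `^ (1 - k) / (1 - k).
Proof. by rewrite sqr_sqrtr// divr_ge0 ?powR_ge0// ltW. Qed.

Lemma Theta_ge0 : 0 <= Theta. Proof. exact: sqrtr_ge0. Qed.

Let refl_int t : 0 <= t <= T ->
  \int[mu]_(x in `]0, t[) ((t - x) `^ (- k)) <= Theta ^+ 2.
Proof.
move=> /andP[t0 tT]; rewrite Theta_sqr; apply: (le_trans (Rintegral_refl_powRN_le k01 t0)).
rewrite ler_wpM2r ?invr_ge0; [by []|exact: ltW|].
by apply: ge0_ler_powR => //; rewrite ?nnegrE// ltW.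
Qed.

Lemma wconv_hb g G t : 0 <= t <= T ->
  (forall n, measurable_fun (`]0, t[%classic : set RR) (g ^~ n)) ->
  (forall x, 0 < x < t -> hb s' (g x) G) -> 0 <= G ->
  (forall n, intble mu `]0, t[ (fun x => W n (t - x) * g x n)) /\
  hb s (wconv g t) (G * Theta).
Proof.
move=> tT mg gG G0; have /andP[t0 _] := tT.
have ik := intble_refl_powRN t k01.
apply: (relax_conv_hb lam_gt0 relaxW k01 sE _ _ mg gG).
- by rewrite t0 lexx.
- by rewrite mulr_ge0 ?Theta_ge0.
- exact: intbleZr.
- by rewrite RintegralZr// exprMn mulrC ler_wpM2l ?sqr_ge0 ?refl_int.
Qed.

Let tail_intble t h : 0 <= t -> 0 <= h ->
  intble mu `]0, h[ (fun x => (t + h - x) `^ (- k)).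
Proof.
move=> t0 h0; apply: (intbleSoo (lexx 0) _ (intble_refl_powRN (t + h) k01)).
by rewrite lerDr.
Qed.

Let tail_le t h : 0 <= t -> 0 <= h ->
  \int[mu]_(x in `]0, h[) ((t + h - x) `^ (- k)) <= h `^ (1 - k) / (1 - k).
Proof.
move=> t0 h0; apply: le_trans (Rintegral_refl_powRN_le k01 h0).
apply: le_Rintegral => //; [exact: tail_intble|exact: intble_refl_powRN|].
move=> x; rewrite /= in_itv/= => /andP[x0 xh].
case/andP: k01 => k0 _; apply: ler_powRN; lra.
Qed.

(** For [h > t] the factor (h / t)^g is at least 1 and a bound by T^(1 - k) is enough. For [h <= t]
    the integrand is at most t^(-k), and t^(-k) * h is [h / t] times t^(1 - k), where [h / t] is at
    most its power of exponent [g]. *)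
Let tail_hoelder t h g : 0 < t -> 0 < h -> t + h <= T -> 0 <= g <= 1 ->
  \int[mu]_(x in `]0, h[) ((t + h - x) `^ (- k)) <= (h / t) `^ g * Theta ^+ 2.
Proof.
move=> t0 h0 thT /andP[g0 g1]; rewrite Theta_sqr.
have ht0 : 0 < h / t by rewrite divr_gt0.
have [ht|th] := leP h t; last first.
  apply: (le_trans (tail_le (ltW t0) (ltW h0))).
  rewrite mulrA ler_wpM2r ?invr_ge0 ?(ltW k1)//.
  apply: (@le_trans _ _ (T `^ (1 - k))).
    apply: ge0_ler_powR; rewrite ?nnegrE ?(ltW k1) ?(ltW h0) ?(ltW T0)//.
    by apply: le_trans thT; rewrite lerDr ltW.
  rewrite ler_peMl ?powR_ge0// -(powRr0 (h / t)) ler_powR//.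
  by rewrite ler_pdivlMr// mul1r ltW.
apply: (@le_trans _ _ (t `^ (- k) * h)).
  have -> : t `^ (- k) * h = t `^ (- k) * (h - 0) by rewrite subr0.
  rewrite -Rintegral_cst_itvoo ?(ltW h0)//; apply: le_Rintegral => //.
  - by apply: tail_intble; exact: ltW.
  - exact: cst_intble.
  - move=> x; rewrite /= in_itv/= => /andP[x0 xh].
    case/andP: k01 => k0 _; apply: ler_powRN; lra.
have -> : t `^ (- k) * h = h / t * t `^ (1 - k).
  have -> : 1 - k = - k + 1 by ring.
  rewrite powRD ?(gt_eqF t0) ?implybT// powRr1 ?ltW//; field.
  by rewrite gt_eqF.
apply: ler_pM; rewrite ?powR_ge0 ?(ltW ht0)//.
  by apply: ger1_powR => //; rewrite ht0/= ler_pdivrMr// mul1r.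
apply: (@le_trans _ _ (T `^ (1 - k))).
  apply: ge0_ler_powR; rewrite ?nnegrE ?(ltW k1) ?(ltW t0) ?(ltW T0)//.
  by apply: le_trans thT; rewrite lerDl ltW.
rewrite ler_pdivlMr// ler_piMr ?powR_ge0//.
by case/andP: k01 => ? ?; lra.
Qed.

(** [P] accounts for the part over []0, h[], where [g] is merely bounded, and [q], [Q] for the
    increments of [g]. Uniform continuity and Hölder continuity differ only in these choices. *)
Lemma wconv_shift_hb g G P (q : R -> R) Q t h : 0 <= t -> 0 <= h -> t + h <= T ->
  ucont s' g -> 0 <= G -> (forall x, 0 <= x <= T -> hb s' (g x) G) ->
  0 <= P -> \int[mu]_(x in `]0, h[) ((t + h - x) `^ (- k)) <= P ^+ 2 ->
  (forall x, 0 < x < t -> hb s' (fun n => g (x + h) n - g x n) (q x)) ->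
  intble mu `]0, t[ (fun x => (t - x) `^ (- k) * q x ^+ 2) ->
  0 <= Q -> \int[mu]_(x in `]0, t[) ((t - x) `^ (- k) * q x ^+ 2) <= Q ^+ 2 ->
  hb s (fun n => wconv g (t + h) n - wconv g t n) (G * P + Q).
Proof.
move=> t0 h0 thT cg G0 gG P0 iP gq iq Q0 qQ.
have th0 : 0 <= t + h by exact: addr_ge0.
have tT : t <= T by apply: le_trans thT; rewrite lerDl.
have hth : h <= t + h by rewrite lerDr.
have hT : h <= T by exact: le_trans thT.
have mg n b : b <= T -> measurable_fun (`]0, b[%classic : set RR) (g ^~ n).
  by move=> bT; apply: (ucont_measurable_sub lam_gt0 _ bT cg).
have gG' b : b <= T -> forall x, 0 < x < b -> hb s' (g x) G.
  by move=> bT x /andP[x0 xb]; apply: gG; rewrite ltW//= (le_trans (ltW xb)).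
have [i1 _] := wconv_hb (ltac:(by rewrite th0) : 0 <= t + h <= T) (fun n => mg n _ thT) (gG' _ thT) G0.
have [i2 _] := wconv_hb (ltac:(by rewrite t0) : 0 <= t <= T) (fun n => mg n _ tT) (gG' _ tT) G0.
have mgh n : measurable_fun (`]0, t[%classic : set RR) (fun x => g (x + h) n - g x n).
  apply: measurable_funB; last exact: mg.
  by apply: (measurable_fun_shift h0 thT (mg n _ (lexx T))).
have [_ hb2] := relax_conv_hb lam_gt0 relaxW k01 sE (ltac:(by rewrite t0 lexx) : 0 <= t <= t) Q0 mgh gq iq qQ.
have iG : intble mu `]0, h[ (fun x => (t + h - x) `^ (- k) * G ^+ 2).
  by apply: intbleZr => //; exact: tail_intble.
have GP : \int[mu]_(x in `]0, h[) ((t + h - x) `^ (- k) * G ^+ 2) <= (G * P) ^+ 2.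
  rewrite RintegralZr//; last exact: tail_intble.
  by rewrite exprMn mulrC ler_wpM2l ?sqr_ge0.
have hth' : 0 <= h <= t + h by rewrite h0.
have [_ hb1] := relax_conv_hb lam_gt0 relaxW k01 sE hth' (mulr_ge0 G0 P0)
  (fun n => mg n _ hT) (gG' _ hT) iG GP.
apply: eq_hb (hbD lam_gt0 hb1 hb2) => n.
by rewrite /wconv (Rintegral_shift_decomp t0 h0 (i1 n) (i2 n)).
Qed.

Lemma wconv_ucont g G : ucont s' g -> 0 <= G ->
  (forall x, 0 <= x <= T -> hb s' (g x) G) -> ucont s (wconv g).
Proof.
move=> cg G0 gG e e0.
have e20 : 0 < e / 2 by rewrite divr_gt0.
have G10 : 0 < G + 1 by rewrite ltr_wpDl.
have Th10 : 0 < Theta + 1 by rewrite ltr_wpDl// Theta_ge0.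
have [y y0 yP] := cg _ (divr_gt0 e20 Th10).
set P := e / 2 / (G + 1); have P0 : 0 < P by rewrite divr_gt0.
have [x x0 xP] : exists2 x, 0 < x & forall h, 0 <= h -> h < x ->
    h `^ (1 - k) / (1 - k) <= P ^+ 2.
  (* This is the [h] at which h^(1 - k) / (1 - k) equals [P ^+ 2]. *)
  exists ((P ^+ 2 * (1 - k)) `^ (1 - k)^-1) => [|h h0 hx].
    by rewrite powR_gt0// mulr_gt0// exprn_gt0.
  rewrite ler_pdivrMr//.
  have := ge0_ler_powR (ltW k1) _ _ (ltW hx).
  rewrite -powRrM mulVf ?gt_eqF// powRr1; last by rewrite mulr_ge0 ?sqr_ge0// ltW.
  by apply; rewrite nnegrE ?powR_ge0.
exists (Num.min x y) => [|t h t0 h0]; first by rewrite lt_min x0.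
rewrite lt_min => /andP[hx hy] thT.
have tT : t <= T by apply: le_trans thT; rewrite lerDl.
set q := e / 2 / (Theta + 1); have q0 : 0 < q by rewrite divr_gt0.
have h1 : \int[mu]_(x in `]0, h[) ((t + h - x) `^ (- k)) <= P ^+ 2.
  by apply: (le_trans (tail_le t0 h0)); exact: xP.
have h2 z : 0 < z < t -> hb s' (fun n => g (z + h) n - g z n) q.
  move=> /andP[z0 zt]; apply: yP => //; first exact: ltW.
  by apply: le_trans thT; rewrite lerD2r ltW.
have h3 : intble mu `]0, t[ (fun x => (t - x) `^ (- k) * q ^+ 2).
  by apply: intbleZr => //; exact: intble_refl_powRN.
have h4 : \int[mu]_(x in `]0, t[) ((t - x) `^ (- k) * q ^+ 2) <= (q * Theta) ^+ 2.
  rewrite RintegralZr//; last exact: intble_refl_powRN.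
  by rewrite [leRHS]exprMn mulrC ler_wpM2l ?sqr_ge0 ?refl_int ?t0.
have := wconv_shift_hb t0 h0 thT cg G0 gG (ltW P0) h1 h2 h3 (mulr_ge0 (ltW q0) Theta_ge0) h4.
move=> /hb_le; apply; rewrite [leRHS]splitr; apply: lerD.
  by rewrite /P [leLHS]mulrA ler_pdivrMr// mulrC ler_pM2l// lerDl ler01.
by rewrite /q mulrAC ler_pdivrMr// ler_pM2l// lerDl ler01.
Qed.

(** The increments enter squared and give x^(-2b), which is integrable because [b < 1 / 2]. The Beta
    kernel yields t^(1 - k - 2b): the power t^(-2b) completes (h / t)^(2b), and the rest is at most
    T^(1 - k). *)
Lemma wconv_hoelder g G E b t h : 0 < b < 1 / 2 -> 0 < t -> 0 < h -> t + h <= T ->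
  ucont s' g -> 0 <= G -> (forall x, 0 <= x <= T -> hb s' (g x) G) -> 0 <= E ->
  (forall x, 0 < x < t -> hb s' (fun n => g (x + h) n - g x n) (E * (h / x) `^ b)) ->
  hb s (fun n => wconv g (t + h) n - wconv g t n)
    ((h / t) `^ b * (G * Theta +
      E * Num.sqrt (T `^ (1 - k) * beta_integral (1 - k) (1 - 2 * b)))).
Proof.
move=> /andP[b0 b12] t0 h0 thT cg G0 gG E0 gE.
have tT : t <= T by apply: le_trans thT; rewrite lerDl ltW.
have ht0 : 0 < h / t by rewrite divr_gt0.
have b2 : 0 < 2 * b < 1 by apply/andP; split; lra.
have sq x : 0 < x -> (x `^ b) ^+ 2 = x `^ (2 * b).
  by move=> x0; rewrite expr2 -powRD ?(gt_eqF x0) ?implybT//; congr (_ `^ _); ring.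
have [ib Eb] := intble_beta_kernel k01 b2 t0.
set B := beta_integral _ _ in Eb *.
have B0 : 0 <= B by apply: Rintegral_ge0 => x _; rewrite mulr_ge0 ?powR_ge0.
set c := E ^+ 2 * h `^ (2 * b).
have qE x : 0 < x -> (t - x) `^ (- k) * (E * (h / x) `^ b) ^+ 2 =
    c * ((t - x) `^ (- k) * x `^ (- (2 * b))).
  move=> x0; rewrite exprMn sq ?divr_gt0// powRM ?(ltW h0) ?invr_ge0 ?(ltW x0)//.
  by rewrite powR_invl ?ltW// /c; ring.
have iq : intble mu `]0, t[ (fun x => (t - x) `^ (- k) * (E * (h / x) `^ b) ^+ 2).
  apply: (@eq_intble _ RR _ _ _ (fun x => c * ((t - x) `^ (- k) * x `^ (- (2 * b))))) => //.
    by move=> x; rewrite inE/= in_itv/= => /andP[x0 _]; rewrite qE.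
  exact: intbleZ.
have Eq : \int[mu]_(x in `]0, t[) ((t - x) `^ (- k) * (E * (h / x) `^ b) ^+ 2) <=
    ((h / t) `^ b * (E * Num.sqrt (T `^ (1 - k) * B))) ^+ 2.
  rewrite (_ : \int[mu]_(x in _) _ = c * (t `^ (1 - k - 2 * b) * B)); last first.
    rewrite -Eb -RintegralZl//; apply: eq_Rintegral => x.
    by rewrite inE/= in_itv/= => /andP[x0 _]; rewrite qE.
  rewrite !exprMn sq// sqr_sqrtr ?mulr_ge0 ?powR_ge0//.
  have -> : (h / t) `^ (2 * b) * (E ^+ 2 * (T `^ (1 - k) * B)) =
      c * (t `^ (- (2 * b)) * T `^ (1 - k) * B).
    by rewrite powRM ?(ltW h0) ?invr_ge0 ?(ltW t0)// powR_invl ?ltW// /c; ring.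
  apply: ler_wpM2l; first by rewrite mulr_ge0 ?sqr_ge0 ?powR_ge0.
  apply: ler_wpM2r => //.
  have -> : 1 - k - 2 * b = - (2 * b) + (1 - k) by ring.
  rewrite powRD ?(gt_eqF t0) ?implybT// ler_wpM2l ?powR_ge0//.
  by apply: ge0_ler_powR; rewrite ?nnegrE ?(ltW k1) ?(ltW t0) ?(ltW T0).
have h1 : \int[mu]_(x in `]0, h[) ((t + h - x) `^ (- k)) <= ((h / t) `^ b * Theta) ^+ 2.
  rewrite exprMn sq//; apply: tail_hoelder => //.
  by apply/andP; split; lra.
have := wconv_shift_hb (ltW t0) (ltW h0) thT cg G0 gG
  (mulr_ge0 (powR_ge0 _ _) Theta_ge0) h1 gE iq
  (mulr_ge0 (powR_ge0 _ _) (mulr_ge0 E0 (sqrtr_ge0 _))) Eq.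
by move=> /hb_le; apply; apply: eq_leW; ring.
Qed.

End conv.

End resolvent_trajectories.

(** * Picard iteration *)

Section fixed_point.
Context {R : realType}.
Local Notation mu := (@lebesgue_measure R).
Local Notation RR := (measurableTypeR R).
Variable lam : nat -> R.
Hypothesis lam_gt0 : forall n, 0 < lam n.
Local Notation hb := (wbounded lam).
Variables (W : nat -> R -> R) (T : R).
Hypothesis relaxW : relaxation lam W.
Hypothesis T0 : 0 < T.
Local Notation ucont := (ucont lam T).
Variable ell : R -> R.
Hypothesis ell_i : intble mu `]0, T[ ell.
Local Notation nell := (L1norm ell T).
Variables (s s' k : R).
Hypothesis k01 : 0 < k < 1.
Hypothesis sE : s = s' + 1 + k.
Local Notation Theta := (Theta T k).
Variables (F : (nat -> R) -> (nat -> R) -> nat -> R) (rho rho' L K : R).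
Hypotheses (rho0 : 0 < rho) (L0 : 0 <= L) (K0 : 0 <= K).
Hypothesis F0 : forall n, F (fun=> 0) (fun=> 0) n = 0.
Hypothesis F_lip : forall v1 v2 w1 w2 A B, hb s v1 rho -> hb s v2 rho ->
  hb s w1 rho' -> hb s w2 rho' -> hb s (fun n => v1 n - v2 n) A ->
  hb s (fun n => w1 n - w2 n) B ->
  hb s' (fun n => F v1 w1 n - F v2 w2 n) (L * A + K * B).
Hypothesis nrho : nell * rho <= rho'.
Hypothesis contraction : (L + K * nell) * Theta <= 1 / 2.
Implicit Types (U V : R -> nat -> R) (xi : nat -> R) (t h A H : R).

Definition forcing U t := F (U t) (history ell U t).

(** The radius is what allows [F_lip] to be applied; uniform continuity provides the measurability
    of each coefficient. *)
Definition tame U := ucont s U /\ forall t, 0 <= t <= T -> hb s (U t) rho.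

Definition picard xi U t n := resolve W xi t n + wconv W (forcing U) t n.

Let rho0' : 0 <= rho'.
Proof. by apply: le_trans nrho; rewrite mulr_ge0 ?L1norm_ge0 ?ltW. Qed.

Let Lip := L + K * nell.
Let Lip0 : 0 <= Lip. Proof. by rewrite addr_ge0 ?mulr_ge0 ?L1norm_ge0. Qed.

Let Lip_half A : 0 <= A -> Lip * A * Theta <= A / 2.
Proof.
move=> A0; have := ler_wpM2r A0 contraction; rewrite -/Lip.
have -> : Lip * A * Theta = Lip * Theta * A by ring.
by rewrite mul1r (mulrC 2^-1).
Qed.

Lemma tame_measurable U n t : t <= T -> tame U ->
  measurable_fun (`]0, t[%classic : set RR) (U ^~ n).
Proof. by move=> tT [cU _]; apply: (ucont_measurable_sub lam_gt0 _ tT cU). Qed.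

Let tame_oo U t : t <= T -> tame U -> forall x, 0 < x < t -> hb s (U x) rho.
Proof.
by move=> tT [_ UA] x /andP[x0 xb]; apply: UA; rewrite ltW//= (le_trans (ltW xb)).
Qed.

Lemma mem_tame U t : tame U -> 0 <= t <= T ->
  (forall n, intble mu `]0, t[ (fun x => ell (t - x) * U x n)) /\
  hb s (history ell U t) (nell * rho).
Proof.
move=> tU tT; have /andP[_ tT'] := tT.
exact: (mem_hb lam_gt0 ell_i tT (fun n => tame_measurable n tT' tU) (tame_oo tT' tU) (ltW rho0)).
Qed.

Let mem_rho U t : tame U -> 0 <= t <= T -> hb s (history ell U t) rho'.
Proof. by move=> tU tT; have [_ /hb_le] := mem_tame tU tT; apply. Qed.

Lemma forcing_hb U t : tame U -> 0 <= t <= T -> hb s' (forcing U t) (Lip * rho).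
Proof.
move=> tU tT; have [_ Ur] := tU; have [_ hm] := mem_tame tU tT.
have := @F_lip (U t) (fun=> 0) (history ell U t) (fun=> 0) rho (nell * rho)
  (Ur t tT) (hb0 _ _ (ltW rho0)) (mem_rho tU tT) (hb0 _ _ rho0').
have -> : L * rho + K * (nell * rho) = Lip * rho by rewrite /Lip; ring.
move=> h; apply: eq_hb (h _ _) => [n||]; first by rewrite F0 subr0.
- by apply: eq_hb (Ur t tT) => n; rewrite subr0.
- by apply: eq_hb hm => n; rewrite subr0.
Qed.

Lemma forcingB_hb U V A t : tame U -> tame V -> 0 <= A ->
  (forall x, 0 <= x <= T -> hb s (fun n => U x n - V x n) A) -> 0 <= t <= T ->
  hb s' (fun n => forcing U t n - forcing V t n) (Lip * A).
Proof.
move=> tU tV A0 UV tT; have [_ Ur] := tU; have [_ Vr] := tV.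
have [iU _] := mem_tame tU tT; have [iV _] := mem_tame tV tT.
have /andP[_ tT'] := tT.
have -> : Lip * A = L * A + K * (nell * A) by rewrite /Lip; ring.
apply: F_lip; [exact: Ur|exact: Vr|exact: mem_rho|exact: mem_rho|exact: UV|].
apply: (memB_hb lam_gt0 ell_i tT (fun n => tame_measurable n tT' tU)
  (fun n => tame_measurable n tT' tV) iU iV _ A0) => x /andP[x0 xt].
by apply: UV; rewrite ltW//= (le_trans (ltW xt)).
Qed.

Lemma mem_tame_ucont U : tame U -> ucont s (history ell U).
Proof. by move=> [cU Ur]; exact: (mem_ucont lam_gt0 ell_i (ltW rho0) cU Ur). Qed.

Lemma forcing_ucont U : tame U -> ucont s' (forcing U).
Proof.
move=> tU e e0; have [cU Ur] := tU.
have LK0 : 0 < L + K + 1 by rewrite ltr_wpDl// addr_ge0.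
have d0 : 0 < e / (L + K + 1) by rewrite divr_gt0.
have [x x0 xP] := cU _ d0; have [y y0 yP] := mem_tame_ucont tU d0.
exists (Num.min x y) => [|t h t0 h0]; first by rewrite lt_min x0.
rewrite lt_min => /andP[hx hy] thT.
have [tT thT'] := shift_itv t0 h0 thT.
apply: hb_le (F_lip (Ur _ thT') (Ur _ tT) (mem_rho tU thT') (mem_rho tU tT)
  (xP _ _ t0 h0 hx thT) (yP _ _ t0 h0 hy thT)) _.
rewrite -mulrDl mulrA ler_pdivrMr// mulrC ler_pM2l//; lra.
Qed.

Let forcing_measurable U n t : t <= T -> tame U ->
  measurable_fun (`]0, t[%classic : set RR) (forcing U ^~ n).
Proof.
by move=> tT /forcing_ucont cU; apply: (ucont_measurable_sub lam_gt0 _ tT cU).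
Qed.

Let forcing_oo U t : t <= T -> tame U -> forall x, 0 < x < t -> hb s' (forcing U x) (Lip * rho).
Proof.
move=> tT tU x /andP[x0 xb]; apply: forcing_hb => //.
by rewrite ltW//= (le_trans (ltW xb)).
Qed.

Let Lrho0 : 0 <= Lip * rho. Proof. by rewrite mulr_ge0// ltW. Qed.

Lemma wconv_forcing U t : tame U -> 0 <= t <= T ->
  (forall n, intble mu `]0, t[ (fun x => W n (t - x) * forcing U x n)) /\
  hb s (wconv W (forcing U) t) (Lip * rho * Theta).
Proof.
move=> tU tT; have /andP[_ tT'] := tT.
exact: (wconv_hb lam_gt0 relaxW T0 k01 sE tT (fun n => forcing_measurable n tT' tU)
  (forcing_oo tT' tU) Lrho0).
Qed.

(** The inequality [Lip * Theta <= 1 / 2] that makes the map contract also bounds the integral term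
    by [rho / 2]; the other half of the ball is left to the initial value. *)
Lemma picard_tame xi U : hb s xi (rho / 2) -> tame U -> tame (picard xi U).
Proof.
move=> hxi tU; split.
  apply: ucontD => //; first exact: resolve_ucont hxi.
  apply: (wconv_ucont lam_gt0 relaxW T0 k01 sE (forcing_ucont tU) Lrho0) => x.
  exact: forcing_hb.
move=> t tT; have /andP[t0 _] := tT; have [_ hw] := wconv_forcing tU tT.
rewrite [rho]splitr; apply: hbD => //; first exact: resolve_hb hxi.
by apply: (hb_le hw); apply: Lip_half; exact: ltW.
Qed.

Lemma picard_contraction xi U V A : tame U -> tame V -> 0 <= A ->
  (forall t, 0 <= t <= T -> hb s (fun n => U t n - V t n) A) ->
  forall t, 0 <= t <= T ->
    hb s (fun n => picard xi U t n - picard xi V t n) (A / 2).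
Proof.
move=> tU tV A0 UV t tT; have /andP[_ tT'] := tT.
have [iU _] := wconv_forcing tU tT; have [iV _] := wconv_forcing tV tT.
have m n : measurable_fun (`]0, t[%classic : set RR)
    (fun x => forcing U x n - forcing V x n).
  by apply: measurable_funB; exact: forcing_measurable.
have hUV x : 0 < x < t -> hb s' (fun n => forcing U x n - forcing V x n) (Lip * A).
  move=> /andP[x0 xb]; apply: forcingB_hb => //.
  by rewrite ltW//= (le_trans (ltW xb)).
have [_ hw] := wconv_hb lam_gt0 relaxW T0 k01 sE tT m hUV (mulr_ge0 Lip0 A0).
apply: (@hb_le _ _ _ _ (Lip * A * Theta)); last exact: Lip_half.
apply: eq_hb hw => n; rewrite /picard opprD addrACA subrr add0r /wconv -(RintegralB _ (iU n) (iV n))//.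
by apply: eq_Rintegral => x _; rewrite mulrBr.
Qed.

Lemma tame0 : tame (fun _ _ => 0).
Proof. by split=> [|t _]; [exact: ucont0|exact/hb0/ltW]. Qed.

(** * Propagation of the Hölder bound *)

Section hoelder_bound.
Variables (g l1 l2 : R).
Hypothesis g_itv : 0 < g < 1 / 2.
Hypotheses (l1_ge0 : 0 <= l1) (l2_ge0 : 0 <= l2).
Hypothesis ell1 : forall t h, 0 < t -> 0 < h -> t + h <= T ->
  \int[mu]_(x in `]t, t + h[) `|ell x| <= l1 * (h / t) `^ g.
Hypothesis ell2 : forall t, 0 < t <= T ->
  intble mu `]0, t[ (fun x => `|ell (t - x)| * x `^ (- g)) /\
  \int[mu]_(x in `]0, t[) (`|ell (t - x)| * x `^ (- g)) <= l2 * t `^ (- g).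
Let q := Num.sqrt (T `^ (1 - k) * beta_integral (1 - k) (1 - 2 * g)).
Hypothesis hcontraction : (L + K * l2) * q < 1.

Definition hoelder_traj H U := forall t h, 0 < t -> 0 < h -> t + h <= T ->
  hb s (fun n => U (t + h) n - U t n) (H * (h / t) `^ g).

Let ratio_powR h t : 0 < h -> 0 < t -> (h / t) `^ g = h `^ g * t `^ (- g).
Proof.
move=> h0 t0; rewrite powRM ?(ltW h0) ?invr_ge0 ?(ltW t0)//; congr (_ * _).
by rewrite powR_invl// ltW.
Qed.

(** Each condition on the kernel controls one term of [mem_shift_hb]: [l1] the recent part of the
    kernel, against the bound [rho], and [l2] the weight x^(-g) carried by the increments. *)
Lemma mem_hoelder H U : tame U -> 0 <= H -> hoelder_traj H U ->
  hoelder_traj (l1 * rho + H * l2) (history ell U).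
Proof.
move=> tU H0 hU t h t0 h0 thT; have [cU Ur] := tU.
have tT : 0 < t <= T by rewrite t0 (le_trans _ thT)// lerDl ltW.
have [i2 le2] := ell2 tT.
pose B x := H * (h / x) `^ g.
have BE x : 0 < x -> `|ell (t - x)| * B x = H * h `^ g * (`|ell (t - x)| * x `^ (- g)).
  by move=> x0; rewrite /B ratio_powR//; ring.
have iB : intble mu `]0, t[ (fun x => `|ell (t - x)| * B x).
  apply: (@eq_intble _ RR _ _ _ (fun x => H * h `^ g * (`|ell (t - x)| * x `^ (- g)))) => //.
    by move=> x; rewrite inE/= in_itv/= => /andP[x0 _]; rewrite BE.
  exact: intbleZ.
have UB x : 0 < x < t -> hb s (fun n => U (x + h) n - U x n) (B x).
  move=> /andP[x0 xt]; apply: hU => //.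
  by apply: le_trans thT; rewrite lerD2r ltW.
apply: hb_le (mem_shift_hb lam_gt0 ell_i (ltW t0) (ltW h0) thT cU (ltW rho0) Ur iB UB) _.
rewrite mulrDl; apply: lerD.
  by rewrite mulrAC ler_wpM2r ?(ltW rho0)// ell1.
rewrite (@eq_Rintegral _ _ _ mu _ (fun x => H * h `^ g * (`|ell (t - x)| * x `^ (- g)))); last first.
  by move=> x; rewrite inE/= in_itv/= => /andP[x0 _]; rewrite BE.
rewrite RintegralZl// ratio_powR// (_ : H * l2 * _ = H * h `^ g * (l2 * t `^ (- g))); last by ring.
by rewrite ler_wpM2l// mulr_ge0 ?powR_ge0.
Qed.

Lemma forcing_hoelder H U t h : tame U -> 0 <= H -> hoelder_traj H U ->
  0 < t -> 0 < h -> t + h <= T ->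
  hb s' (fun n => forcing U (t + h) n - forcing U t n)
    ((L * H + K * (l1 * rho + H * l2)) * (h / t) `^ g).
Proof.
move=> tU H0 hU t0 h0 thT; have [cU Ur] := tU.
have [tT thT'] := shift_itv (ltW t0) (ltW h0) thT.
have := F_lip (Ur _ thT') (Ur _ tT) (mem_rho tU thT') (mem_rho tU tT)
  (hU _ _ t0 h0 thT) (mem_hoelder tU H0 hU t0 h0 thT).
by move=> /hb_le; apply; apply: eq_leW; ring.
Qed.

(* The solution of [H = rho + (L * H + K * (l1 * rho + H * l2)) * q]. *)
Definition hoelder_const := (rho + K * (l1 * rho) * q) / (1 - (L + K * l2) * q).

Lemma hoelder_const_ge0 : 0 <= hoelder_const.
Proof.
apply: divr_ge0; last by rewrite subr_ge0 ltW.
by rewrite addr_ge0 ?(ltW rho0)// !mulr_ge0 ?sqrtr_ge0 ?(ltW rho0).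
Qed.

(** The resolvent of [xi] and the part of the convolution over []0, h[] contribute at most [rho / 2]
    each. They add up to the term [rho] in the equation solved by [hoelder_const]. *)
Lemma picard_hoelder xi U : hb s xi (rho / 2) -> tame U ->
  hoelder_traj hoelder_const U -> hoelder_traj hoelder_const (picard xi U).
Proof.
move=> hxi tU hU t h t0 h0 thT; have H0 := hoelder_const_ge0.
case/andP: (g_itv) => g0 g1.
have g01 : 0 <= g <= 1 by apply/andP; split; lra.
have h1 := resolve_hoelder relaxW g01 t0 h0 hxi.
set E := L * hoelder_const + K * (l1 * rho + hoelder_const * l2).
have E0 : 0 <= E.
  have r0 := ltW rho0.
  by rewrite /E addr_ge0 ?(mulr_ge0 L0)// mulr_ge0// addr_ge0// mulr_ge0.
have hE x : 0 < x < t -> hb s' (fun n => forcing U (x + h) n - forcing U x n)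
    (E * (h / x) `^ g).
  move=> /andP[x0 xt]; apply: forcing_hoelder => //.
  by apply: le_trans thT; rewrite lerD2r ltW.
have h2 := wconv_hoelder lam_gt0 relaxW T0 k01 sE g_itv t0 h0 thT (forcing_ucont tU)
  Lrho0 (fun x => @forcing_hb U x tU) E0 hE.
apply: (@hb_le _ _ _ _ ((h / t) `^ g * (rho / 2) + (h / t) `^ g * (Lip * rho * Theta + E * q))).
  apply: eq_hb (hbD lam_gt0 h1 h2) => n; rewrite /picard; ring.
rewrite -mulrDr mulrC; apply: ler_wpM2r; first exact: powR_ge0.
have HE : hoelder_const * (1 - (L + K * l2) * q) = rho + K * (l1 * rho) * q.
  by rewrite /hoelder_const divfK// gt_eqF// subr_gt0.
have := Lip_half (ltW rho0).
have -> : E * q = hoelder_const * ((L + K * l2) * q) + K * (l1 * rho) * q by rewrite /E; ring.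
move: HE; rewrite mulrBr mulr1; lra.
Qed.

(** * Convergence of the iteration *)

Section iteration.
Variable xi : nat -> R.
Hypothesis hxi : hb s xi (rho / 2).

Let U_ j := iter j (picard xi) (fun _ _ => 0).

Let U_tame j : tame (U_ j).
Proof. by elim: j => [|j ih]; [exact: tame0|exact: picard_tame]. Qed.

Let U_hoelder j : hoelder_traj hoelder_const (U_ j).
Proof.
elim: j => [|j ih]; last exact: picard_hoelder.
move=> t h t0 h0 thT; apply: (@eq_hb _ _ _ (fun=> 0)) => [n|]; first by rewrite subrr.
by apply: hb0; rewrite mulr_ge0 ?powR_ge0 ?hoelder_const_ge0.
Qed.

Let half_ge0 j : 0 <= rho * 2^-1 ^+ j.
Proof. by rewrite mulr_ge0 ?exprn_ge0 ?(ltW rho0). Qed.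

Let U_step j t : 0 <= t <= T ->
  hb s (fun n => U_ j.+1 t n - U_ j t n) (rho * 2^-1 ^+ j).
Proof.
elim: j t => [|j ih] t tT.
  have [_ /(_ t tT)] := U_tame 1; rewrite expr0 mulr1.
  by apply: eq_hb => n; rewrite /= subr0.
rewrite exprSr mulrA.
exact: (picard_contraction xi (U_tame j.+1) (U_tame j) (half_ge0 j) ih).
Qed.

(** The factor 2 is the sum of the geometric series of the steps. *)
Let U_cauchy i j t : 0 <= t <= T ->
  hb s (fun n => U_ (j + i)%N t n - U_ j t n) (2 * rho * 2^-1 ^+ j).
Proof.
move=> tT; elim: i j => [|i ih] j.
  apply: (@eq_hb _ _ _ (fun=> 0)) => [n|]; first by rewrite addn0 subrr.
  by apply: hb0; rewrite -mulrA mulr_ge0.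
have := hbD lam_gt0 (U_step j tT) (ih j.+1).
have -> : rho * 2^-1 ^+ j + 2 * rho * 2^-1 ^+ j.+1 = 2 * rho * 2^-1 ^+ j.
  by rewrite exprS; field.
by apply: eq_hb => n; rewrite addSnnS; ring.
Qed.

Let Ulim t n := limn (fun j => U_ j t n).

Let U_cvg t n : 0 <= t <= T -> U_ j t n @[j --> \oo] --> Ulim t n.
Proof.
move=> tT; set c := Num.sqrt (lam n `^ s)^-1 * (2 * rho).
have c0 : 0 <= c by rewrite !mulr_ge0 ?sqrtr_ge0 ?(ltW rho0).
have cau i j : `|U_ (j + i)%N t n - U_ j t n| <= c * 2^-1 ^+ j.
  by have := hb_abs lam_gt0 n (U_cauchy i j tT); rewrite /c mulrA.
exact: geometric_cvg c0 cau.
Qed.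

Let U_err j t : 0 <= t <= T -> hb s (fun n => Ulim t n - U_ j t n) (2 * rho * 2^-1 ^+ j).
Proof.
move=> tT; apply: (hb_lim (c_ := fun i n => U_ (j + i)%N t n - U_ j t n)).
  by move=> i; exact: U_cauchy.
move=> n; apply: cvgB; last exact: cvg_cst.
under eq_fun do rewrite addnC.
by have := @U_cvg t n tT; rewrite -(cvg_shiftn j).
Qed.

Let small e : 0 < e -> exists j, 2 * rho * 2^-1 ^+ j <= e.
Proof.
move=> e0; have h0 : 2 * rho * 2^-1 ^+ j @[j --> \oo] --> (0 : R).
  by apply: cvg_geometric; rewrite ger0_norm// invf_lt1// ltr1n.
have /cvgrPdist_le/(_ _ e0)[N _ NP] := h0.
exists N; have := NP N (leqnn N); rewrite /= sub0r normrN; apply: le_trans.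
exact: ler_norm.
Qed.

Let Ulim_tame : tame Ulim.
Proof.
split=> [e e0|t tT]; last first.
  apply: (hb_lim (c_ := fun j => U_ j t)) => [j|n]; last exact: U_cvg.
  by have [_] := U_tame j; apply.
have e30 : 0 < e / 3 by rewrite divr_gt0.
have [j je] := small e30; have [cU _] := U_tame j.
have [eta eta0 etaP] := cU _ e30.
exists eta => // t h t0 h0 heta thT.
have [tT thT'] := shift_itv t0 h0 thT.
have le_e : 2 * rho * 2^-1 ^+ j + 2 * rho * 2^-1 ^+ j + e / 3 <= e by lra.
apply: eq_hb (hb_le (hbD lam_gt0 (hbB lam_gt0 (U_err j thT') (U_err j tT))
  (etaP _ _ t0 h0 heta thT)) le_e) => n; ring.
Qed.

Let Ulim_hoelder : hoelder_traj hoelder_const Ulim.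
Proof.
move=> t h t0 h0 thT.
have [tT thT'] := shift_itv (ltW t0) (ltW h0) thT.
apply: (hb_lim (c_ := fun j n => U_ j (t + h) n - U_ j t n)) => [j|n].
  exact: U_hoelder.
by apply: cvgB; exact: U_cvg.
Qed.

(** Both sides are compared with [U_ j.+1], the image of [U_ j] under [picard xi]; the error is
    below any [e], hence zero in every coefficient. *)
Let Ulim_fixed t n : 0 <= t <= T -> Ulim t n = picard xi Ulim t n.
Proof.
move=> tT; apply/eqP; rewrite -subr_eq0; apply/eqP.
apply: (@hb_eq0 _ _ lam_gt0 s (fun n => Ulim t n - picard xi Ulim t n)).
apply: hb_small => e e0; rewrite add0r.
have e20 : 0 < e / 2 by rewrite divr_gt0.
have [j je] := small e20.
have c0 : 0 <= 2 * rho * 2^-1 ^+ j by rewrite -mulrA mulr_ge0.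
have h1 := picard_contraction xi Ulim_tame (U_tame j) c0 (fun t tT => U_err j tT) tT.
have h2 := U_err j.+1 tT.
have le_e : 2 * rho * 2^-1 ^+ j.+1 + 2 * rho * 2^-1 ^+ j / 2 <= e.
  by rewrite exprS; lra.
have subrKB (a b c : R) : a - b - (c - b) = a - c by ring.
by apply: eq_hb (hb_le (hbB lam_gt0 h2 h1) le_e) => i; exact: subrKB.
Qed.

(** Two points of the ball differ by at most [2 * rho], and each application of the contraction
    halves the bound. *)
Lemma picard_fixed_point_unique U V : tame U -> tame V ->
  (forall t n, 0 <= t <= T -> U t n = picard xi U t n) ->
  (forall t n, 0 <= t <= T -> V t n = picard xi V t n) ->
  forall t n, 0 <= t <= T -> V t n = U t n.
Proof.
move=> tU tV fU fV t n tT; apply/eqP; rewrite -subr_eq0; apply/eqP.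
apply: (@hb_eq0 _ _ lam_gt0 s (fun n => V t n - U t n)).
apply: hb_small => e e0; rewrite add0r.
have [j je] := small e0; apply: hb_le je.
elim: j t tT => [|j ih] t tT.
  have [_ Ur] := tU; have [_ Vr] := tV.
  apply: hb_le (hbB lam_gt0 (Vr t tT) (Ur t tT)) _.
  by rewrite expr0; lra.
rewrite exprSr mulrA.
have c0 : 0 <= 2 * rho * 2^-1 ^+ j by rewrite -mulrA mulr_ge0.
apply: eq_hb (picard_contraction xi tV tU c0 ih tT) => i.
by rewrite -fU// -fV.
Qed.

Theorem picard_fixed_point : exists U, [/\ tame U,
  forall t n, 0 <= t <= T -> U t n = picard xi U t n &
  hoelder_traj hoelder_const U].
Proof. by exists Ulim; split; [exact: Ulim_tame|exact: Ulim_fixed|exact: Ulim_hoelder]. Qed.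

End iteration.
End hoelder_bound.
End fixed_point.

(** * The Hilbert scale and Bochner integrals *)

Lemma normrM_le_sqrD (R : realDomainType) (a b : R) : `|a * b| <= a ^+ 2 + b ^+ 2.
Proof.
rewrite normrM -(real_normK (num_real a)) -(real_normK (num_real b)).
have := sqr_ge0 (`|a| - `|b|); have := sqr_ge0 (`|a| + `|b|).
by rewrite sqrrB sqrrD -mulr_natl; lra.
Qed.

Lemma sum_mul_delta (R : pzSemiRingType) (c : nat -> R) N k :
  \sum_(n < N) c n * (n == k :> nat)%:R = if (k < N)%N then c k else 0.
Proof.
case: ifPn => kN.
  rewrite (bigD1 (Ordinal kN))//= eqxx mulr1 big1 ?addr0// => i ik.
  by rewrite (_ : (i == k :> nat) = false) ?mulr0//; apply/negbTE.
rewrite big1// => i _; rewrite (_ : (i == k :> nat) = false) ?mulr0//.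
by apply/negbTE; apply: contra kN => /eqP <-.
Qed.

(** * Square integrable functions *)

Section square_integrable.
Context d (X : measurableType d) (R : realType) (nu : {measure set X -> \bar R}).
Variable D : set X.
Hypothesis mD : measurable D.
Implicit Types (g h : X -> R).

Definition sqint g := measurable_fun D g /\ (\int[nu]_(x in D) (g x ^+ 2)%:E < +oo)%E.

Definition ip g h := \int[nu]_(x in D) (g x * h x).

Lemma sqint_intble g : sqint g -> intble nu D (fun x => g x ^+ 2).
Proof.
move=> [mg goo]; apply: intble_lty => //; first exact: measurable_funX.
by move=> x _; exact: sqr_ge0.
Qed.

Lemma sqint_mul g h : sqint g -> sqint h -> intble nu D (fun x => g x * h x).
Proof.
move=> sg sh; apply: (le_intble mD _ (intbleD mD (sqint_intble sg) (sqint_intble sh))).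
  by case: sg => mg _; case: sh => mh _; exact: measurable_funM.
by move=> x _; exact: normrM_le_sqrD.
Qed.

Lemma sqintP g h : measurable_fun D g -> intble nu D h ->
  (forall x, D x -> g x ^+ 2 <= h x) -> sqint g.
Proof.
move=> mg ih gh; split => //.
have /integrableP[_] : intble nu D (fun x => g x ^+ 2).
  apply: (le_intble mD _ ih); first exact: measurable_funX.
  by move=> x Dx; rewrite ger0_norm ?sqr_ge0// gh.
rewrite (eq_integral (fun x => (g x ^+ 2)%:E))// => x _ /=.
by rewrite ger0_norm ?sqr_ge0.
Qed.

Lemma sqint0 : sqint (fun=> 0).
Proof. by split=> //; under eq_integral do rewrite expr0n/=; rewrite integral0 ltry. Qed.

Lemma sqintD g h : sqint g -> sqint h -> sqint (fun x => g x + h x).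
Proof.
move=> sg sh; have [mg _] := sg; have [mh _] := sh.
apply: (sqintP _ (intbleD mD (intbleZ 2 mD (sqint_intble sg)) (intbleZ 2 mD (sqint_intble sh)))).
  exact: measurable_funD.
by move=> x _; have := sqr_ge0 (g x - h x); rewrite sqrrB sqrrD /=; lra.
Qed.

Lemma sqintZ a g : sqint g -> sqint (fun x => a * g x).
Proof.
move=> sg; have [mg _] := sg.
apply: (sqintP _ (intbleZ (a ^+ 2) mD (sqint_intble sg))).
  exact: measurable_funM.
by move=> x _; rewrite exprMn.
Qed.

Lemma sqintB g h : sqint g -> sqint h -> sqint (fun x => g x - h x).
Proof.
move=> sg /(sqintZ (-1)) sh; rewrite (_ : (fun _ => _) = (fun x => g x + -1 * h x)).
  exact: sqintD.
by apply/funext => x; rewrite mulN1r.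
Qed.

Lemma sqint_sum (I : Type) (s : seq I) (h : I -> X -> R) :
  (forall i, sqint (h i)) -> sqint (fun x => \sum_(i <- s) h i x).
Proof.
move=> hi; elim: s => [|i s ih].
  rewrite (_ : (fun _ => _) = (fun=> 0)); first exact: sqint0.
  by apply/funext => x; rewrite big_nil.
rewrite (_ : (fun _ => _) = (fun x => h i x + \sum_(i <- s) h i x)).
  exact: sqintD.
by apply/funext => x; rewrite big_cons.
Qed.

Lemma ipD g g' h : sqint g -> sqint g' -> sqint h ->
  ip (fun x => g x + g' x) h = ip g h + ip g' h.
Proof.
move=> sg sg' sh; rewrite /ip -(RintegralD mD (sqint_mul sg sh) (sqint_mul sg' sh)).
by apply: eq_Rintegral => x _; rewrite mulrDl.
Qed.

Lemma ipZ a g h : sqint g -> sqint h -> ip (fun x => a * g x) h = a * ip g h.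
Proof.
move=> sg sh; rewrite /ip -(RintegralZl a mD (sqint_mul sg sh)).
by apply: eq_Rintegral => x _; rewrite mulrA.
Qed.

Lemma ip_sum (I : Type) (s : seq I) (h : I -> X -> R) g :
  (forall i, sqint (h i)) -> sqint g ->
  ip (fun x => \sum_(i <- s) h i x) g = \sum_(i <- s) ip (h i) g.
Proof.
move=> hi sg; rewrite /ip -(Rintegral_sum s mD (fun i => sqint_mul (hi i) sg)).
by apply: eq_Rintegral => x _; rewrite mulr_suml.
Qed.

Lemma ipC g h : ip g h = ip h g.
Proof. by apply: eq_Rintegral => x _; rewrite mulrC. Qed.

Lemma ip_ae g g' h : sqint g -> sqint g' -> sqint h ->
  {ae nu, forall x, D x -> g x = g' x} -> ip g h = ip g' h.
Proof.
move=> [mg _] [mg' _] [mh _] gg'; congr fine; apply: ae_eq_integral => //.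
- by apply/measurable_EFinP; exact: measurable_funM.
- by apply/measurable_EFinP; exact: measurable_funM.
- by apply: filterS gg' => x gx Dx; rewrite /= gx.
Qed.

Lemma ip_eq0_ae g : sqint g -> ip g g = 0 -> {ae nu, forall x, D x -> g x = 0}.
Proof.
move=> sg g0; have [mg _] := sg.
have : (\int[nu]_(x in D) `|(g x ^+ 2)%:E| = 0)%E.
  have := EFin_Rintegral mD (sqint_intble sg).
  rewrite (_ : \int[nu]_(x in D) (g x ^+ 2) = ip g g).
    rewrite g0 => E; rewrite [RHS](_ : _ = 0%:E)// E; apply: eq_integral => x _.
    by rewrite gee0_abs// lee_fin sqr_ge0.
  by apply: eq_Rintegral => x _; rewrite expr2.
have mg2 : measurable_fun D (fun x => (g x ^+ 2)%:E).
  by apply/measurable_EFinP; exact: measurable_funX.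
move/(ae_eq_integral_abs nu mD mg2); apply: filterS => x gx Dx.
by move: (gx Dx) => [] /eqP; rewrite expf_eq0/= => /eqP.
Qed.

End square_integrable.

(** * The Riesz-Fischer theorem *)

Section riesz_fischer.
Context d (X : measurableType d) (R : realType) (nu : {measure set X -> \bar R}).
Variable D : set X.
Hypothesis mD : measurable D.
Local Notation sqint := (sqint nu D).
Local Notation ip := (ip nu D).
Variable e : nat -> X -> R.
Hypothesis se : forall n, sqint (e n).
Hypothesis orth : forall n k, ip (e n) (e k) = (n == k)%:R.
Local Notation hb1 := (wbounded (fun=> 1) 0).

Let comb (c : nat -> R) N x := \sum_(n < N) c n * e n x.

Let sqint_comb c N : sqint (comb c N).
Proof. by apply: sqint_sum => // n; exact: sqintZ. Qed.

Let ip_comb_e c N k : ip (comb c N) (e k) = if (k < N)%N then c k else 0.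
Proof.
rewrite /comb ip_sum//; last by move=> n; exact: sqintZ.
by under eq_bigr => n _ do rewrite ipZ// orth; exact: sum_mul_delta.
Qed.

Let ip_comb c N : ip (comb c N) (comb c N) = \sum_(n < N) c n ^+ 2.
Proof.
rewrite {1}/comb ip_sum//; last by move=> n; exact: sqintZ.
apply: eq_bigr => n _; rewrite ipZ// ipC ip_comb_e ltn_ord.
by rewrite -expr2.
Qed.

Let comb_widen c N M x : (N <= M)%N ->
  comb c N x = comb (fun n => if (n < N)%N then c n else 0) M x.
Proof.
move=> NM; rewrite /comb (big_ord_widen _ (fun n => c n * e n x) NM) big_mkcond/=.
by apply: eq_bigr => n _; case: ifP => _; rewrite ?mul0r.
Qed.

Let ip_combB c N M C : hb1 (fun n => (if (n < N)%N then c n else 0) -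
   (if (n < M)%N then c n else 0)) C ->
  ip (fun x => comb c N x - comb c M x) (fun x => comb c N x - comb c M x) <= C ^+ 2.
Proof.
move=> [C0 /(_ (maxn N M))]; apply: le_trans; apply: eq_leW.
pose b n := (if (n < N)%N then c n else 0) - (if (n < M)%N then c n else 0).
rewrite (_ : (fun x => _) = comb b (maxn N M)).
  by rewrite ip_comb; apply: eq_bigr => n _; rewrite powR1 mul1r.
apply/funext => x; rewrite (comb_widen c x (leq_maxl N M)) (comb_widen c x (leq_maxr N M)).
by rewrite /comb -sumrB; apply: eq_bigr => n _; rewrite mulrBl.
Qed.

(* The partial sums along a rapidly converging subsequence are dominated almost everywhere
   by the square integrable majorant [G]. *)
Theorem riesz_fischer c C : hb1 c C -> exists2 g, sqint g & forall n, ip g (e n) = c n.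
Proof.
move=> hc.
pose eps k := (4 ^ k.+1)%:R^-1 : R.
have eps0 k : 0 < eps k by rewrite invr_gt0 ltr0n expn_gt0.
have /choice[N NP] k : exists N, (k <= N)%N /\ hb1 (fun n => if (n < N)%N then 0 else c n) (eps k).
  have [N hN] := hb_tail hc (eps0 k).
  by exists (maxn k N); split; [exact: leq_maxl|apply: hN; exact: leq_maxr].
pose S k := comb c (N k).
have sS k : sqint (S k) by exact: sqint_comb.
pose dif k x := S k.+1 x - S k x.
(* The weight is small enough for the integrals to sum to at most 1, as [dif k] has norm of order
   4^(-k), and large enough that a finite sum [F x] forces [|dif k x|] to be at most 2^(-k) times
   the square root of [F x]. *)
pose f k x := 4 ^+ k * dif k x ^+ 2 : R.
have f0 k x : 0 <= f k x by rewrite mulr_ge0 ?sqr_ge0// exprn_ge0.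
have sd k : sqint (dif k) by exact: sqintB.
have mf k : measurable_fun D (f k).
  have [md _] := sd k; apply: measurable_funM => //; exact: measurable_funX.
have fi k : (\int[nu]_(x in D) (f k x)%:E <= (1 / (2 ^ k.+1)%:R)%:E)%E.
  have fE : intble nu D (f k) by apply: intbleZ => //; exact: sqint_intble.
  rewrite -EFin_Rintegral// lee_fin RintegralZl//; last exact: sqint_intble.
  have h : hb1 (fun n => (if (n < N k.+1)%N then c n else 0) -
      (if (n < N k)%N then c n else 0)) (eps k + eps k.+1).
    have [_ h1] := NP k; have [_ h2] := NP k.+1.
    apply: eq_hb (hbB (fun=> ltr01) h1 h2) => n.
    by do 2 case: ifPn => _; ring.
  have := ip_combB h; rewrite /ip => hd.
  have -> : \int[nu]_(x in D) dif k x ^+ 2 =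
      \int[nu]_(x in D) ((comb c (N k.+1) x - comb c (N k) x) *
                         (comb c (N k.+1) x - comb c (N k) x)).
    by apply: eq_Rintegral => x _; rewrite expr2.
  apply: (le_trans (ler_wpM2l _ hd)); first exact: exprn_ge0.
  have -> : eps k.+1 = eps k / 4 by rewrite /eps expnS natrM invfM mulrC.
  have -> : eps k = (4 ^+ k)^-1 / 4 by rewrite /eps expnS natrM invfM natrX mulrC.
  set a : R := 4 ^+ k; have a0 : 0 < a by rewrite exprn_gt0.
  have -> : a * (a^-1 / 4 + a^-1 / 4 / 4) ^+ 2 = 25 / 256 * a^-1.
    by field; rewrite gt_eqF.
  have -> : (2 ^ k.+1)%:R = 2 * 2 ^+ k :> R by rewrite expnS natrM natrX.
  have a2 : 2 ^+ k <= a by rewrite lerXn2r// ?nnegrE//; lra.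
  have p2 : 0 < 2 ^+ k :> R by rewrite exprn_gt0.
  have : a^-1 <= (2 ^+ k)^-1 by rewrite lef_pV2 ?posrE.
  have : 0 < (2 ^+ k)^-1 :> R by rewrite invr_gt0.
  rewrite invfM; lra.
pose F x := (\sum_(k <oo) (f k x)%:E)%E.
have mfE k : measurable_fun D (fun x => (f k x)%:E) by exact/measurable_EFinP.
have f0E k x : D x -> (0 <= (f k x)%:E)%E by rewrite lee_fin.
have mF : measurable_fun D F.
  apply: (@ge0_emeasurable_sum _ _ _ D (fun k x => (f k x)%:E) xpredT) => [k x _ _|k _].
    by rewrite lee_fin.
  exact: mfE.
have F0 x : (0 <= F x)%E by apply: nneseries_ge0 => k _ _; rewrite lee_fin.
have Fi : nu.-integrable D F.
  apply/integrableP; split=> //.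
  under eq_integral do rewrite gee0_abs//.
  rewrite (integral_nneseries nu mD mfE f0E).
  apply: (le_lt_trans (lee_nneseries _ _)); last first.
  - exact: (le_lt_trans (@epsilon_trick0 R 1 xpredT ler01)) (ltry 1).
  - by move=> k _; exact: fi.
  - by move=> k _ _; apply: integral_ge0 => x _; rewrite lee_fin.
have sdif x k y : F x = y%:E -> `|dif k x| <= 2^-1 ^+ k * Num.sqrt y.
  move=> Fy; have y0 : 0 <= y by rewrite -lee_fin -Fy.
  have : ((f k x)%:E <= F x)%E.
    have ge0 i : (0 <= i)%N -> xpredT i -> (0 <= (f i x)%:E)%E by rewrite lee_fin.
    apply: (le_trans _ (nneseries_lim_ge k.+1 ge0)).
    by rewrite big_mkord big_ord_recr/= leeDr// sume_ge0// => i _; rewrite lee_fin.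
  rewrite Fy lee_fin /f => fy.
  rewrite -(ler_pXn2r (n := 2))// ?nnegrE ?mulr_ge0 ?exprn_ge0 ?sqrtr_ge0//.
  rewrite real_normK ?num_real// exprMn sqr_sqrtr// -exprM mulnC exprM.
  have -> : 2^-1 ^+ 2 = 4^-1 :> R by rewrite expr2; lra.
  by rewrite exprVn ler_pdivlMl ?exprn_gt0.
have Scau x y : F x = y%:E -> forall j i, `|S (j + i)%N x - S j x| <= 2 * Num.sqrt y * 2^-1 ^+ j.
  move=> Fy j i; elim: i j => [|i ih] j.
    by rewrite addn0 subrr normr0 !mulr_ge0 ?sqrtr_ge0 ?exprn_ge0.
  have -> : S (j + i.+1)%N x - S j x = (S (j.+1 + i)%N x - S j.+1 x) + dif j x.
    by rewrite /dif addSnnS; ring.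
  rewrite (le_trans (ler_normD _ _))// (le_trans (lerD (ih _) (sdif _ _ _ Fy)))//.
  by rewrite exprS le_eqVlt; apply/orP; left; apply/eqP; field.
have Scvg x y : F x = y%:E -> cvgn (fun k => S k x).
  move=> Fy; apply: (@geometric_cvg _ _ (2 * Num.sqrt y)) => [|i j].
    by rewrite mulr_ge0 ?sqrtr_ge0.
  exact: Scau Fy j i.
(* The upper limit is measurable without any convergence and is the limit wherever [F] is finite. *)
pose g x := fine (limn_esup (fun k => (S k x)%:E)).
have mS k : measurable_fun D (S k) by have [] := sS k.
have mg : measurable_fun D g.
  apply: (measurableT_comp (@fine_measurable R setT _)) => //.
  apply: measurable_fun_limn_esup => k; exact/measurable_EFinP.
have gcvg x y : F x = y%:E -> S k x @[k --> \oo] --> g x.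
  move=> Fy; have /cvg_ex[l Sl] := Scvg _ _ Fy.
  suff -> : g x = l by [].
  rewrite /g; have : (S k x)%:E @[k --> \oo] --> l%:E.
    by apply: cvg_EFin; [exact: nearW|exact: Sl].
  by move=> /cvg_limn_einf_sup[_ ->].
have Ffin := integrable_ae mD Fi.
(* With [b] for [S 0%N x], this combines [a ^+ 2 <= 2 * b ^+ 2 + 2 * (a - b) ^+ 2] with the bound
   [2 * Num.sqrt y] on [|a - b|]. *)
have Sbound x y k : F x = y%:E -> S k x ^+ 2 <= 2 * S 0%N x ^+ 2 + 8 * y.
  move=> Fy; have y0 : 0 <= y by rewrite -lee_fin -Fy.
  have := Scau _ _ Fy 0%N k; rewrite add0n expr0 mulr1 => h.
  have h2 : (S k x - S 0%N x) ^+ 2 <= 4 * y.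
    rewrite -[leLHS]real_normK ?num_real// -(sqr_sqrtr y0).
    rewrite (_ : 4 * _ = (2 * Num.sqrt y) ^+ 2); last by rewrite exprMn; ring.
    by rewrite lerXn2r// nnegrE ?mulr_ge0 ?sqrtr_ge0.
  have := sqr_ge0 (S k x - 2 * S 0%N x); move: h2; rewrite !sqrrB; lra.
pose G x := ((2 * S 0%N x ^+ 2)%:E + 8%:E * F x)%E.
have G0 x : (0 <= G x)%E.
  by rewrite adde_ge0 ?mule_ge0// lee_fin mulr_ge0// sqr_ge0.
have Gi : nu.-integrable D G.
  apply: integrableD => //; last exact: integrableZl.
  exact: (intbleZ 2 mD (sqint_intble mD (sS 0%N))).
have SG : {ae nu, forall x k, D x -> ((S k x ^+ 2)%:E <= G x)%E}.
  apply: filterS Ffin => x Fx k Dx; have {}Fx := fineK (Fx Dx).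
  by rewrite /G -Fx -EFinM -EFinD lee_fin; exact: Sbound (esym Fx).
have gG : {ae nu, forall x, D x -> ((g x ^+ 2)%:E <= G x)%E}.
  apply: filterS Ffin => x Fx Dx; have {}Fx := fineK (Fx Dx).
  rewrite /G -Fx -EFinM -EFinD lee_fin.
  have h : S k x * S k x @[k --> \oo] --> g x * g x by apply: cvgM; exact: gcvg (esym Fx).
  rewrite expr2 -(cvg_lim _ h)//; apply: limr_le; first by apply/cvg_ex; eexists; exact: h.
  by apply: nearW => k; rewrite -expr2; exact: Sbound (esym Fx).
have sg : sqint g.
  split=> //; have /integrableP[mG] := Gi; apply: le_lt_trans.
  apply: ae_ge0_le_integral => //.
  - by move=> x _; rewrite lee_fin sqr_ge0.
  - by apply/measurable_EFinP; exact: measurable_funX.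
  - exact: measurableT_comp.
  - by apply: filterS gG => x gx Dx; rewrite gee0_abs// gx.
exists g => // n; have [me _] := se n.
have mSe k : measurable_fun D (fun x => (S k x * e n x)%:E).
  by apply/measurable_EFinP; exact: measurable_funM.
have mge : measurable_fun D (fun x => (g x * e n x)%:E).
  by apply/measurable_EFinP; exact: measurable_funM.
have Se_ge : {ae nu, forall x, D x -> (S k x * e n x)%:E @[k --> \oo] --> (g x * e n x)%:E}.
  apply: filterS Ffin => x Fx Dx; have {}Fx := fineK (Fx Dx).
  apply: cvg_EFin; first exact: nearW.
  by apply: cvgMl; exact: gcvg (esym Fx).
have GEi : nu.-integrable D (fun x => (G x + (e n x ^+ 2)%:E)%E).
  by apply: integrableD => //; exact: (sqint_intble mD (se n)).
have SeG : {ae nu, forall x k, D x -> (`|(S k x * e n x)%:E| <= G x + (e n x ^+ 2)%:E)%E}.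
  apply: filterS SG => x Sx k Dx; apply: (le_trans _ (leeD (Sx k Dx) (lexx _))).
  by rewrite -EFinD abse_EFin lee_fin; exact: normrM_le_sqrD.
have [_ _ lim] := dominated_convergence mD mSe mge Se_ge GEi SeG.
have {}lim : (\int[nu]_(x in D) (S k x * e n x)%:E)%E @[k --> \oo] -->
    (\int[nu]_(x in D) (g x * e n x)%:E)%E := lim.
have lim2 : (\int[nu]_(x in D) (S k x * e n x)%:E)%E @[k --> \oo] --> (c n)%:E.
  (* Because [k <= N k], the sum [S k] already has the coefficient [c n] once [k > n]. *)
  apply: cvg_near_cst; exists n.+1 => // k /= nk.
  rewrite -EFin_Rintegral//; last exact: sqint_mul.
  have := ip_comb_e c (N k) n; rewrite /ip => ->.
  by rewrite (leq_trans nk)//; have [] := NP k.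
apply: EFin_inj; rewrite /ip EFin_Rintegral//; last exact: sqint_mul.
by rewrite -(cvg_lim _ lim)// (cvg_lim _ lim2).
Qed.

End riesz_fischer.

Section weighted_series.
Context {R : realType}.
Variable lam : nat -> R.
Hypothesis lam_gt0 : forall n, 0 < lam n.
Implicit Types (s C : R) (c : nat -> R).

Let term_ge0 s c n : (0 <= (lam n `^ s * c n ^+ 2)%:E)%E.
Proof. by rewrite lee_fin mulr_ge0 ?powR_ge0 ?sqr_ge0. Qed.

Lemma hb_wseries s c C : wbounded lam s c C -> (wseries lam s c < +oo)%E /\ wnorm lam s c <= C.
Proof.
move=> [C0 cC].
have le : (wseries lam s c <= (C ^+ 2)%:E)%E.
  apply: lime_le; first by apply: is_cvg_nneseries => n _ _; exact: term_ge0.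
  by apply: nearW => N; rewrite big_mkord sumEFin lee_fin.
split; first by rewrite (le_lt_trans le)// ltry.
have w0 : (0 <= wseries lam s c)%E by apply: nneseries_ge0 => n _ _; exact: term_ge0.
rewrite /wnorm -[leRHS]ger0_norm// -sqrtr_sqr ler_sqrt ?sqr_ge0//.
by rewrite -lee_fin fineK// ge0_fin_numE// (le_lt_trans le)// ltry.
Qed.

Lemma wseries_hb s c : (wseries lam s c < +oo)%E -> wbounded lam s c (wnorm lam s c).
Proof.
move=> woo.
have w0 : (0 <= wseries lam s c)%E by apply: nneseries_ge0 => n _ _; exact: term_ge0.
split=> [|N]; first exact: sqrtr_ge0.
rewrite sqr_sqrtr ?fine_ge0// -lee_fin fineK ?ge0_fin_numE//.
have ge0 i : (0 <= i)%N -> xpredT i -> (0 <= (lam i `^ s * c i ^+ 2)%:E)%E by [].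
apply: (le_trans _ (nneseries_lim_ge N ge0)).
by rewrite big_mkord sumEFin.
Qed.

Lemma wnormP s c C : (wseries lam s c < +oo)%E -> wbounded lam s c C <-> 0 <= C /\ wnorm lam s c <= C.
Proof.
move=> woo; split=> [h|[C0 wC]]; last exact: (hb_le (wseries_hb woo) wC).
by split; [exact: hb_ge0 h|have [] := hb_wseries h].
Qed.

End weighted_series.

(** * The Hilbert scale through coefficients *)

Section hilbert_scale.
Context {R : realType} {d : nat}.
Variables (Om : set 'rV[R]_d) (lam : nat -> R) (e : nat -> 'rV[R]_d -> R).
Hypothesis Om_open : open Om.
Hypothesis eig : dirichlet_eigenbasis Om lam e.
Local Notation nu := (lebesgue_rV d).
Local Notation hb := (wbounded lam).
Local Notation coef := (coef Om e).
Local Notation Hspace := (Hspace Om lam e).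
Local Notation Hnorm := (Hnorm Om lam e).
Implicit Types (g h : 'rV[R]_d -> R) (c : nat -> R) (s : R).

Lemma eigenvalue_gt0 n : 0 < lam n.
Proof. by have [[l0 mono] _ _ _ _] := eig; apply: lt_le_trans (mono _ _ (leq0n n)). Qed.

Let lam_gt0 := eigenvalue_gt0.

Lemma measurable_domain : measurable (Om : set (borel_rV d)).
Proof. exact: sub_sigma_algebra. Qed.

Let mD := measurable_domain.

Lemma L2_eigen n : L2 Om (e n). Proof. by have [_ _ + _ _] := eig; apply. Qed.

Lemma L2D g h : L2 Om g -> L2 Om h -> L2 Om (g + h).
Proof. exact: (@sqintD _ _ _ nu Om mD). Qed.

Lemma L2Z a g : L2 Om g -> L2 Om (a *: g).
Proof. exact: (@sqintZ _ _ _ nu Om mD). Qed.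

Lemma L2B g h : L2 Om g -> L2 Om h -> L2 Om (g - h).
Proof. exact: (@sqintB _ _ _ nu Om mD). Qed.

Lemma L2_0 : L2 Om 0.
Proof. exact: (@sqint0 _ _ _ nu Om). Qed.

Lemma L2_sum N (v : nat -> 'rV[R]_d -> R) : (forall i, L2 Om (v i)) ->
  L2 Om (\sum_(i < N) v i).
Proof.
move=> hv; elim: N => [|N ih]; first by rewrite big_ord0; exact: L2_0.
by rewrite big_ord_recr; exact: L2D.
Qed.

Lemma coefD g h n : L2 Om g -> L2 Om h -> coef (g + h) n = coef g n + coef h n.
Proof. by move=> sg sh; exact: (@ipD _ _ _ nu Om mD g h (e n) sg sh (L2_eigen n)). Qed.

Lemma coefZ a g n : L2 Om g -> coef (a *: g) n = a * coef g n.
Proof. by move=> sg; exact: (@ipZ _ _ _ nu Om mD a g (e n) sg (L2_eigen n)). Qed.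

Lemma coefB g h n : L2 Om g -> L2 Om h -> coef (g - h) n = coef g n - coef h n.
Proof.
move=> sg sh; rewrite -scaleN1r coefD//; last exact: L2Z.
by rewrite coefZ// mulN1r.
Qed.

Lemma coef0 n : coef 0 n = 0.
Proof. by rewrite -(scale0r (0 : 'rV[R]_d -> R)) coefZ ?mul0r//; exact: L2_0. Qed.

Lemma coef_sum N (v : nat -> 'rV[R]_d -> R) n : (forall i, L2 Om (v i)) ->
  coef (\sum_(i < N) v i) n = \sum_(i < N) coef (v i) n.
Proof.
move=> hv; elim: N => [|N ih]; first by rewrite !big_ord0 coef0.
by rewrite !big_ord_recr/= coefD ?ih//; exact: L2_sum.
Qed.

Lemma coef_eigen n k : coef (e n) k = (n == k)%:R.
Proof. by have [_ _ _ + _] := eig; apply. Qed.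

Lemma coef_comb c N k : coef (\sum_(n < N) c n *: e n) k = if (k < N)%N then c k else 0.
Proof.
rewrite (@coef_sum N (fun n => c n *: e n) k); last by move=> i; exact/L2Z/L2_eigen.
under eq_bigr => n _ do rewrite (coefZ _ _ (L2_eigen n)) coef_eigen.
exact: sum_mul_delta.
Qed.

Lemma L2_comb c N : L2 Om (\sum_(n < N) c n *: e n).
Proof. by apply: (@L2_sum N (fun n => c n *: e n)) => n; exact/L2Z/L2_eigen. Qed.

Lemma Hspace_hb s g : Hspace s g -> hb s (coef g) (Hnorm s g).
Proof. by move=> [_ woo]; exact: wseries_hb. Qed.

Lemma hb_Hspace s g C : L2 Om g -> hb s (coef g) C -> Hspace s g /\ Hnorm s g <= C.
Proof. by move=> sg /hb_wseries[] //. Qed.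

Lemma HnormP s g C : Hspace s g -> hb s (coef g) C <-> 0 <= C /\ Hnorm s g <= C.
Proof. by move=> [_ woo]; exact: wnormP. Qed.

Lemma HspaceD s g h : Hspace s g -> Hspace s h -> Hspace s (g + h).
Proof.
move=> /[dup] /Hspace_hb hg [sg _] /[dup] /Hspace_hb hh [sh _].
apply: (hb_Hspace (L2D sg sh) _).1; apply: eq_hb (hbD lam_gt0 hg hh) => n.
by rewrite coefD.
Qed.

Lemma HspaceZ s a g : Hspace s g -> Hspace s (a *: g).
Proof.
move=> /[dup] /Hspace_hb hg [sg _].
apply: (hb_Hspace (L2Z a sg) _).1; apply: eq_hb (hbZ a hg) => n.
by rewrite coefZ.
Qed.

Lemma HspaceB s g h : Hspace s g -> Hspace s h -> Hspace s (g - h).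
Proof. by move=> hg hh; rewrite -scaleN1r; exact: (HspaceD hg (HspaceZ (-1) hh)). Qed.

Lemma Hspace0 s : Hspace s 0.
Proof.
apply: (hb_Hspace L2_0 (_ : hb s _ 0)).1.
by apply: (@eq_hb _ _ _ (fun=> 0)) => [n|]; [rewrite coef0|exact: hb0].
Qed.

Lemma Hspace_sum s N (v : nat -> 'rV[R]_d -> R) : (forall i, Hspace s (v i)) ->
  Hspace s (\sum_(i < N) v i).
Proof.
move=> hv; elim: N => [|N ih]; first by rewrite big_ord0; exact: Hspace0.
by rewrite big_ord_recr; exact: (HspaceD ih (hv N)).
Qed.

Lemma hb_truncation s c N : hb s (fun n => if (n < N)%N then c n else 0)
  (Num.sqrt (\sum_(n < N) lam n `^ s * c n ^+ 2)).
Proof.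
have t0 n : 0 <= lam n `^ s * c n ^+ 2 by rewrite mulr_ge0 ?powR_ge0 ?sqr_ge0.
split=> [|M]; first exact: sqrtr_ge0.
rewrite sqr_sqrtr; last by apply: sumr_ge0 => n _; exact: t0.
apply: (@le_trans _ _ (\sum_(n < maxn M N) lam n `^ s * (if (n < N)%N then c n else 0) ^+ 2)).
  rewrite -(big_mkord xpredT (fun n => lam n `^ s * (if (n < N)%N then c n else 0) ^+ 2)).
  rewrite -(big_mkord xpredT (fun n => lam n `^ s * (if (n < N)%N then c n else 0) ^+ 2)).
  rewrite [leRHS](big_cat_nat (n := M))//= ?leq_maxl// lerDl; apply: sumr_ge0 => n _.
  by rewrite mulr_ge0 ?powR_ge0 ?sqr_ge0.
rewrite (big_ord_widen _ (fun n => lam n `^ s * c n ^+ 2) (leq_maxr M N)).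
rewrite [leRHS]big_mkcond/=; apply: ler_sum => n _.
by case: ifP => _; rewrite ?expr0n/= ?mulr0.
Qed.

Lemma Hspace_comb s c N : Hspace s (\sum_(n < N) c n *: e n).
Proof.
apply: (hb_Hspace (L2_comb c N) _).1.
by apply: eq_hb (hb_truncation s c N) => n; rewrite coef_comb.
Qed.

Lemma Hspace_eigen s n : Hspace s (e n).
Proof.
rewrite (_ : e n = \sum_(i < n.+1) (if i == n :> nat then 1 else 0) *: e i).
  exact: (Hspace_comb s (fun i => if i == n then 1 else 0)).
rewrite big_ord_recr/= eqxx scale1r big1 ?add0r// => i _.
by rewrite (_ : (i == n :> nat) = false) ?scale0r//; apply/negbTE; rewrite neq_ltn ltn_ord.
Qed.

(** The least eigenvalue [lam 0] bounds the weights below when [s >= 0]. Thus H^s embeds in L^2,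
    where the Riesz-Fischer theorem is available. *)
Lemma hb_weight0 s c C : 0 <= s -> hb s c C ->
  exists C', wbounded (fun=> 1) 0 c C'.
Proof.
move=> s0 [C0 cC]; exists (Num.sqrt (lam 0 `^ (- s)) * C); split=> [|N].
  by rewrite mulr_ge0 ?sqrtr_ge0.
rewrite exprMn sqr_sqrtr ?powR_ge0//; apply: le_trans (ler_wpM2l (powR_ge0 _ _) (cC N)).
rewrite mulr_sumr; apply: ler_sum => n _; rewrite powR1 [leRHS]mulrA ler_wpM2r ?sqr_ge0//.
rewrite powRN mulrC ler_pdivlMr ?powR_gt0// mul1r.
have [[l0 mono] _ _ _ _] := eig.
by apply: ge0_ler_powR; rewrite ?nnegrE ?(ltW l0) ?(ltW (lam_gt0 n))//; exact: mono.
Qed.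

Lemma Hspace_representative s c C : 0 <= s -> hb s c C ->
  exists2 g, Hspace s g & coef g =1 c.
Proof.
move=> s0 hc; have [C' hc'] := hb_weight0 s0 hc.
have orth n k : ip nu Om (e n) (e k) = (n == k)%:R := coef_eigen n k.
have [g sg gE] := @riesz_fischer _ _ _ nu Om mD e L2_eigen orth c C' hc'.
exists g => //; apply: (hb_Hspace sg (C := C) _).1.
by apply: eq_hb hc => n; rewrite -gE.
Qed.

(** A coefficient is a bounded functional for the norm. This reads off the coefficients of objects
    that are defined as limits in norm: the value of [Hsum] and the Bochner integral. *)
Lemma coef_HnormB s g (v : nat -> 'rV[R]_d -> R) l n : (forall j, Hspace s (g - v j)) ->
  L2 Om g -> (forall j, L2 Om (v j)) ->
  Hnorm s (g - v j) @[j --> \oo] --> 0 -> coef (v j) n @[j --> \oo] --> l ->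
  coef g n = l.
Proof.
move=> hgv sg sv gv vl; set k := Num.sqrt (lam n `^ s)^-1.
rewrite -(cvg_lim _ vl)//; apply/esym/cvg_lim => //.
have h0 : k * Hnorm s (g - v j) @[j --> \oo] --> (0 : R).
  by rewrite -[X in _ --> X](mulr0 k); exact: cvgMr.
apply/cvgrPdist_le => r r0; have /cvgrPdist_le/(_ _ r0) := h0.
apply: filterS => j; rewrite sub0r normrN => /(le_trans _); apply.
rewrite -coefB//; apply: le_trans (ler_norm _).
by apply: (hb_abs lam_gt0); exact: Hspace_hb.
Qed.

(** The Riesz-Fischer representative shows that the set in the definition of [Hsum] is inhabited, so
    the default value 0 of [xget] does not interfere; the coefficients of the chosen element follow
    from its defining limit. *)
Lemma Hsum_spec s c C : 0 <= s -> hb s c C ->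
  Hspace s (Hsum Om lam e s c) /\ coef (Hsum Om lam e s c) =1 c.
Proof.
move=> s0 hc; have [g hg gE] := Hspace_representative s0 hc.
have [sg _] := hg.
pose P := [set g | Hspace s g /\
    Hnorm s (g - \sum_(n < N) c n *: e n) @[N --> \oo] --> 0].
have Pg : P g.
  split=> //; apply/cvgrPdist_le => r r0.
  have [N hN] := hb_tail hc r0.
  exists N => // M /= NM; rewrite sub0r normrN ger0_norm ?sqrtr_ge0//.
  apply: (hb_Hspace (L2B sg (L2_comb c M)) _).2.
  apply: eq_hb (hN M NM) => n; rewrite coefB//; last exact: L2_comb.
  by rewrite coef_comb gE; case: ifP => _; rewrite ?subrr ?subr0.
have [hS cS] : P (Hsum Om lam e s c) := xgetPex 0 (ex_intro _ g Pg).
split=> // n; have [sS _] := hS.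
apply: (coef_HnormB _ sS (L2_comb c) cS).
  by move=> j; exact: (HspaceB hS (Hspace_comb s c j)).
by apply: cvg_near_cst; exists n.+1 => // k /= nk; rewrite coef_comb nk.
Qed.

(** The expansion of [g - h] has only zero terms, so by completeness of the basis its norm is a
    constant sequence that tends to 0. *)
Lemma coef_eq_L2 g h : L2 Om g -> L2 Om h -> coef g =1 coef h -> eq_L2 Om g h.
Proof.
move=> sg sh gh; have sgh := L2B sg sh.
have c0 n : inner Om (g - h) (e n) = 0.
  by rewrite -/(coef (g - h) n) coefB// gh subrr.
have [_ _ _ _ /(_ _ sgh) cvg0] := eig.
have n0 : L2norm Om (g - h) = 0.
  rewrite -(cvg_lim _ cvg0)//; apply/esym/cvg_lim => //.
  apply: cvg_near_cst; apply: nearW => N; congr (L2norm _ _).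
  by rewrite big1 ?subr0// => n _; rewrite c0 scale0r.
have in0 : 0 <= inner Om (g - h) (g - h).
  by apply: Rintegral_ge0 => x _; rewrite -expr2 sqr_ge0.
have i0 : ip nu Om (g - h) (g - h) = 0.
  move/eqP: n0; rewrite /L2norm sqrtr_eq0 => h0.
  by apply/eqP; rewrite eq_le -/(inner Om (g - h) (g - h)) h0 in0.
have := ip_eq0_ae mD sgh i0; apply: filterS.
by move=> x ghx Ox; apply/eqP; rewrite -subr_eq0; apply/eqP; exact: ghx.
Qed.

Lemma eq_L2_coef g h : L2 Om g -> L2 Om h -> eq_L2 Om g h -> coef g =1 coef h.
Proof. by move=> sg sh gh n; exact: (@ip_ae _ _ _ nu Om mD g h _ sg sh (L2_eigen n) gh). Qed.

(** The functional is tested on the sum of lam_n^(-s) phi(e_n) e_n over [n < N]. Its value there is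
    the partial sum [S], and the H^s norm of this element is at most the square root of [S];
    dividing bounds [S] independently of [N]. *)
Lemma Hdual_hb s phi : Hdual Om lam e s phi -> exists C, hb (- s) (dual_coef e phi) C.
Proof.
move=> [lin [C phiC]].
have phi0 : phi 0 = 0.
  have := lin (-1) 0 0 (Hspace0 s) (Hspace0 s).
  by rewrite scaler0 addr0 mulN1r addNr.
have phi_comb c N : phi (\sum_(n < N) c n *: e n) = \sum_(n < N) c n * phi (e n).
  elim: N => [|N ih]; first by rewrite !big_ord0.
  rewrite !big_ord_recr/= addrC lin ?ih; [by rewrite addrC|exact: Hspace_eigen|exact: Hspace_comb].
pose C1 := `|C| + 1; have C10 : 0 < C1 by rewrite ltr_wpDl.
exists C1; split=> [|N]; first exact: ltW.
pose c n := lam n `^ (- s) * phi (e n).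
set S := \sum_(n < N) _.
have S0 : 0 <= S by apply: sumr_ge0 => n _; rewrite mulr_ge0 ?powR_ge0 ?sqr_ge0.
have SE : phi (\sum_(n < N) c n *: e n) = S.
  by rewrite phi_comb; apply: eq_bigr => n _; rewrite /c -mulrA -expr2.
have hc : hb s (fun n => if (n < N)%N then c n else 0) (Num.sqrt S).
  have -> : S = \sum_(n < N) lam n `^ s * c n ^+ 2; last exact: hb_truncation.
  by apply: eq_bigr => n _; rewrite /c /dual_coef powRN; field; rewrite gt_eqF// powR_gt0.
have hn : Hnorm s (\sum_(n < N) c n *: e n) <= Num.sqrt S.
  apply: (hb_Hspace (L2_comb c N) _).2; apply: eq_hb hc => n.
  by rewrite coef_comb.
have := phiC _ (Hspace_comb s c N); rewrite SE ger0_norm// => SC.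
have {}SC : S <= C1 * Num.sqrt S.
  apply: (le_trans SC); apply: (@le_trans _ _ (C1 * Hnorm s (\sum_(n < N) c n *: e n))).
    by apply: ler_wpM2r; [exact: sqrtr_ge0|rewrite (le_trans (ler_norm C))// lerDl].
  by apply: ler_wpM2l => //; exact: ltW.
have [->|Sn0] := eqVneq S 0; first exact: sqr_ge0.
have sS0 : 0 < Num.sqrt S by rewrite sqrtr_gt0 lt_neqAle eq_sym Sn0.
rewrite -(sqr_sqrtr S0) lerXn2r// ?nnegrE ?sqrtr_ge0 ?(ltW C10)//.
by rewrite -(ler_pM2r sS0) -expr2 sqr_sqrtr.
Qed.

End hilbert_scale.

(** * Bochner integrals and their coefficients *)

Section bochner.
Import HBSimple.
Context {R : realType} {d : nat}.
Variables (Om : set 'rV[R]_d) (lam : nat -> R) (e : nat -> 'rV[R]_d -> R).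
Hypothesis Om_open : open Om.
Hypothesis eig : dirichlet_eigenbasis Om lam e.
Local Notation mu := (@lebesgue_measure R).
Local Notation RR := (measurableTypeR R).
Local Notation hb := (wbounded lam).
Local Notation coef := (coef Om e).
Local Notation Hspace := (Hspace Om lam e).
Local Notation Hnorm := (Hnorm Om lam e).
Variables (s : R) (D : set RR).
Hypotheses (mD : measurable D) (Dfin : (mu D < +oo)%E).
Let lam_gt0 := eigenvalue_gt0 eig.

Lemma measurable_wnorm (c : R -> nat -> R) :
  (forall n, measurable_fun D (c ^~ n)) -> measurable_fun D (fun t => wnorm lam s (c t)).
Proof.
move=> mc; apply: (measurableT_comp (f := @Num.sqrt R)).
  exact: continuous_measurable_fun (@sqrt_continuous R).
apply: (measurableT_comp (@fine_measurable R setT _)) => //.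
apply: (@ge0_emeasurable_sum _ RR _ D (fun n t => (lam n `^ s * c t n ^+ 2)%:E) xpredT).
  by move=> n t _ _; rewrite lee_fin mulr_ge0 ?powR_ge0 ?sqr_ge0.
move=> n _; apply/measurable_EFinP; apply: measurable_funM => //.
exact: measurable_funX.
Qed.

Definition step K (A : nat -> set R) (v : nat -> 'rV[R]_d -> R) t :=
  \sum_(i < K) \1_(A i) t *: v i.

Definition step_integral K (A : nat -> set R) (v : nat -> 'rV[R]_d -> R) :=
  \sum_(i < K) fine (mu (A i `&` D)) *: v i.

Lemma Hspace_step K A v t : (forall i, Hspace s (v i)) -> Hspace s (step K A v t).
Proof.
move=> hv; apply: (@Hspace_sum _ _ _ lam _ Om_open eig s _ (fun i => \1_(A i) t *: v i)) => i.
exact: (HspaceZ Om_open eig _ (hv i)).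
Qed.

Lemma Hspace_step_integral K A v : (forall i, Hspace s (v i)) ->
  Hspace s (step_integral K A v).
Proof.
move=> hv; apply: (@Hspace_sum _ _ _ lam _ Om_open eig s _
  (fun i => fine (mu (A i `&` D)) *: v i)) => i.
exact: (HspaceZ Om_open eig _ (hv i)).
Qed.

Lemma coef_step K A v t n : (forall i, L2 Om (v i)) ->
  coef (step K A v t) n = \sum_(i < K) \1_(A i) t * coef (v i) n.
Proof.
move=> sv; rewrite (@coef_sum _ _ _ lam _ Om_open eig K (fun i => \1_(A i) t *: v i)).
  by apply: eq_bigr => i _; rewrite (coefZ Om_open eig).
by move=> i; exact: L2Z.
Qed.

Let indic_intble A : measurable A -> intble mu D \1_A.
Proof.
move=> mA; apply: (@intble_bounded _ RR _ _ _ _ 1) => //.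
by move=> x _; rewrite indicE; case: (_ \in _); rewrite ?normr1 ?normr0.
Qed.

Lemma coef_step_intble K A v n : (forall i, measurable (A i)) ->
  (forall i, L2 Om (v i)) -> intble mu D (fun t => coef (step K A v t) n).
Proof.
move=> mA sv.
rewrite (_ : (fun t => _) = (fun t => \sum_(i < K) coef (v i) n * \1_(A i) t)).
  apply: (@intble_sum _ _ _ mu D _ _ (fun (i : 'I_K) t => coef (v i) n * \1_(A i) t)) => // i.
  exact: (intbleZ _ mD (indic_intble (mA i))).
by apply/funext => t; rewrite coef_step//; apply: eq_bigr => i _; rewrite mulrC.
Qed.

Lemma coef_step_integral K A v n : (forall i, measurable (A i)) ->
  (forall i, L2 Om (v i)) ->
  coef (step_integral K A v) n = \int[mu]_(t in D) coef (step K A v t) n.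
Proof.
move=> mA sv.
rewrite (@coef_sum _ _ _ lam _ Om_open eig K (fun i => fine (mu (A i `&` D)) *: v i)); last first.
  by move=> i; exact: L2Z.
rewrite (_ : (fun t => _) = (fun t => \sum_(i < K) coef (v i) n * \1_(A i) t)); last first.
  by apply/funext => t; rewrite coef_step//; apply: eq_bigr => i _; rewrite mulrC.
rewrite (@Rintegral_sum _ _ _ mu D _ _ (fun (i : 'I_K) t => coef (v i) n * \1_(A i) t))//.
  apply: eq_bigr => i _; rewrite (coefZ Om_open eig)//.
  rewrite (RintegralZl _ mD (indic_intble (mA i))) mulrC; congr (_ * _).
  by rewrite /Rintegral integral_indic//; exact: mA.
by move=> i; exact: (intbleZ _ mD (indic_intble (mA i))).
Qed.

Lemma step_cat K1 A1 v1 K2 A2 v2 :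
  (forall i, measurable (A1 i) /\ Hspace s (v1 i)) ->
  (forall i, measurable (A2 i) /\ Hspace s (v2 i)) ->
  exists K A v, (forall i, measurable (A i) /\ Hspace s (v i)) /\
    forall t, step K A v t = step K1 A1 v1 t + step K2 A2 v2 t.
Proof.
move=> h1 h2; exists (K1 + K2)%N, (fun i => if (i < K1)%N then A1 i else A2 (i - K1)%N),
  (fun i => if (i < K1)%N then v1 i else v2 (i - K1)%N); split.
  by move=> i; case: ifP.
move=> t; rewrite /step big_split_ord/=; congr (_ + _).
  by apply: eq_bigr => i _; rewrite ltn_ord.
by apply: eq_bigr => i _; rewrite ltnNge leq_addr/= addKn.
Qed.

(** The term of index [n] is itself a step function: on the level set of each value [r] of [g n] it
    equals [r *: e n]. *)
Lemma step_combination N (g : nat -> {sfun RR >-> R}) :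
  exists K A v, (forall i, measurable (A i) /\ Hspace s (v i)) /\
    forall t, step K A v t = \sum_(n < N) g n t *: e n.
Proof.
elim: N => [|N [K1 [A1 [v1 [h1 E1]]]]].
  exists 0%N, (fun=> set0), (fun=> 0); split=> [i|t]; last by rewrite /step !big_ord0.
  by split=> //; exact: Hspace0.
pose f := g N; pose r : seq R := finmap.enum_fset (fset_set (f @` setT)).
pose A2 i := f @^-1` [set r`_i]; pose v2 i := r`_i *: e N.
have h2 i : measurable (A2 i) /\ Hspace s (v2 i).
  split; first by rewrite /A2; exact: measurable_funPTI.
  exact: (HspaceZ Om_open eig _ (Hspace_eigen Om_open eig s N)).
have [K [A [v [h E]]]] := @step_cat K1 A1 v1 (size r) A2 v2 h1 h2.
exists K, A, v; split=> // t; rewrite E E1 big_ord_recr/=; congr (_ + _).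
rewrite /step [in RHS](fimfunEord (g N)) scaler_suml; apply: eq_bigr => i _.
by rewrite /v2 /A2 scalerA mulrC.
Qed.

Section approximation.
Variables (G : R -> 'rV[R]_d -> R) (C : R -> R).
Hypothesis mG : forall n, measurable_fun D (fun t => coef (G t) n).
Hypothesis iC : intble mu D C.
Hypothesis HG : forall t, D t -> Hspace s (G t).
Hypothesis GC : forall t, D t -> hb s (coef (G t)) (C t).

Let tail N t := wnorm lam s (fun n => if (n < N)%N then 0 else coef (G t) n).

Let tail_hb N t : D t -> hb s (fun n => if (n < N)%N then 0 else coef (G t) n) (tail N t) /\
  tail N t <= C t.
Proof.
move=> Dt.
have h : hb s (fun n => if (n < N)%N then 0 else coef (G t) n) (C t).
  rewrite -[C t]mul1r; apply: hb_dom (GC Dt) => // n; rewrite mul1r.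
  by case: ifP => // _; rewrite normr0.
by have [woo wC] := hb_wseries h; split=> //; exact: wseries_hb.
Qed.

Let mtail N : measurable_fun D (tail N).
Proof.
apply: (measurable_wnorm (c := fun t n => if (n < N)%N then 0 else coef (G t) n)) => n.
by case: (n < N)%N.
Qed.

Let itail N : intble mu D (tail N).
Proof.
apply: (le_intble mD (mtail N) iC) => t Dt; have [_ tC] := tail_hb N Dt.
by rewrite ger0_norm ?sqrtr_ge0.
Qed.

Let tail_small r : 0 < r -> exists N, \int[mu]_(t in D) tail N t <= r.
Proof.
move=> r0.
have tcvg : {ae mu, forall t, D t -> (tail N t)%:E @[N --> \oo] --> (0%E : \bar R)}.
  apply: aeW => t Dt; apply: cvg_EFin; first exact: nearW.
  apply/cvgrPdist_le => q q0.
  have [N hN] := hb_tail (GC Dt) q0.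
  exists N => // M /= NM; rewrite sub0r normrN ger0_norm ?sqrtr_ge0//.
  by have [] := hb_wseries (hN M NM).
have tC : {ae mu, forall t N, D t -> (`|(tail N t)%:E| <= (C t)%:E)%E}.
  apply: aeW => t N Dt; have [_ tC] := tail_hb N Dt.
  by rewrite abse_EFin lee_fin ger0_norm ?sqrtr_ge0.
have mt N : measurable_fun D (fun t => (tail N t)%:E) by exact/measurable_EFinP.
have [_ _ lim] := dominated_convergence mD mt (measurable_cst (0%E : \bar R)) tcvg iC tC.
have {}lim : (\int[mu]_(t in D) (tail N t)%:E)%E @[N --> \oo] --> (0%:E : \bar R).
  by move: lim; rewrite integral0.
have /fine_cvgP[_ /cvgrPdist_le/(_ _ r0)[N _ NP]] := lim.
exists N; have := NP N (leqnn N); rewrite /= sub0r normrN; apply: le_trans.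
exact: ler_norm.
Qed.

(* Truncate to finitely many coefficients, then approximate each by a simple function. *)
Lemma step_approximation r : 0 < r -> exists K A v (b : R -> R),
  [/\ forall i, measurable (A i) /\ Hspace s (v i), intble mu D b,
      forall t, D t -> hb s (fun n => coef (G t) n - coef (step K A v t) n) (b t) &
      \int[mu]_(t in D) b t <= r].
Proof.
move=> r0; have r20 : 0 < r / 2 by rewrite divr_gt0.
have [N tN] := tail_small r20.
have iG n : intble mu D (fun t => coef (G t) n) := hb_intble lam_gt0 n mD mG iC GC.
(* [w n] is the norm of [e n] in H^s. The tolerances [q n] share [r / 2] among the [N] retained
   coefficients; the summands 1 keep the divisors positive. *)
pose w n := Num.sqrt (lam n `^ s); have w0 n : 0 <= w n by exact: sqrtr_ge0.
pose q n := r / 2 / (N%:R + 1) / (w n + 1).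
have q0 n : 0 < q n by rewrite !divr_gt0// ltr_wpDl.
have /choice[g gP] n : exists g : {sfun RR >-> R}, intble mu D (fun t => `|coef (G t) n - g t|) /\
    \int[mu]_(t in D) `|coef (G t) n - g t| <= q n.
  have [g_ [ig _ /fine_cvgP[_ /cvgrPdist_le/(_ _ (q0 n))[M _ MP]]]] :=
    approximation_sfun_integrable mD (iG n).
  exists (g_ M); have ib : intble mu D (fun t => coef (G t) n - g_ M t).
    by apply: intbleB => //; exact: ig.
  split; first exact: intble_norm.
  have := MP M (leqnn M); rewrite /= sub0r normrN; apply: le_trans.
  exact: ler_norm.
have [K [A [v [h E]]]] := step_combination N g.
exists K, A, v, (fun t => tail N t + \sum_(n < N) w n * `|coef (G t) n - g n t|).
have isum (n : 'I_N) : intble mu D (fun t => w n * `|coef (G t) n - g n t|).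
  by apply: intbleZ => //; have [] := gP n.
have iS : intble mu D (fun t => \sum_(n < N) w n * `|coef (G t) n - g n t|).
  exact: (@intble_sum _ _ _ mu D _ _ (fun (n : 'I_N) t => w n * `|coef (G t) n - g n t|)).
split=> //.
- exact: intbleD.
- move=> t Dt; have [h1 _] := tail_hb N Dt.
  have h2 M : (M <= N)%N -> hb s (fun k => if (k < M)%N then coef (G t) k - g k t else 0)
      (\sum_(n < M) w n * `|coef (G t) n - g n t|).
    elim: M => [|M ih] MN; first by rewrite big_ord0; exact: hb0.
    rewrite big_ord_recr/=.
    have hs : hb s (fun k => if k == M then coef (G t) k - g k t else 0)
        (w M * `|coef (G t) M - g M t|).
      split=> [|L]; first by rewrite mulr_ge0.
      rewrite exprMn /w sqr_sqrtr ?powR_ge0// real_normK ?num_real//.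
      have t0 : 0 <= lam M `^ s * (coef (G t) M - g M t) ^+ 2.
        by rewrite mulr_ge0 ?powR_ge0 ?sqr_ge0.
      have [ML|LM] := ltnP M L.
        rewrite (bigD1 (Ordinal ML))//= eqxx big1 ?addr0// => i iM.
        rewrite (_ : (i == M :> nat) = false) ?expr0n/= ?mulr0//; exact/negbTE.
      rewrite big1// => i _; rewrite (_ : (i == M :> nat) = false) ?expr0n/= ?mulr0//.
      by apply/negbTE; rewrite neq_ltn (leq_trans (ltn_ord i) LM).
    apply: eq_hb (hbD lam_gt0 (ih (ltnW MN)) hs) => k.
    rewrite /= [(k < M.+1)%N]ltnS.
    by have [kM|kM|->] := ltngtP k M; rewrite ?addr0 ?add0r.
  apply: eq_hb (hbD lam_gt0 h1 (h2 N (leqnn N))) => n.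
  rewrite E (coef_comb Om_open eig (fun n => g n t) N n).
  by case: ifP => _; rewrite ?add0r ?addr0 ?subr0.
- rewrite (RintegralD mD (itail N) iS) [leRHS]splitr lerD//.
  rewrite (Rintegral_sum _ mD isum).
  apply: (@le_trans _ _ (\sum_(n < N) r / 2 / (N%:R + 1))).
    apply: ler_sum => n _; have [ig gq] := gP n.
    rewrite (RintegralZl _ mD ig); apply: (le_trans (ler_wpM2l (w0 n) gq)).
    rewrite /q mulrA ler_pdivrMr ?ltr_wpDl// mulrC ler_wpM2l ?lerDl//.
    by rewrite !divr_ge0 ?(ltW r0)// addr_ge0.
  rewrite sumr_const card_ord -[leLHS]mulr_natr -[leLHS]mulrA ler_piMr ?(ltW r20)//.
  by rewrite mulrC ler_pdivrMr ?ltr_wpDl// mul1r lerDl.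
Qed.

(** The integral is the element whose coefficients are the integrals of the coefficients. The mean
    errors are made as small as 4^(-(j + 1)), so that convergence in mean also gives convergence
    almost everywhere. *)
Lemma bochner_exists : 0 <= s -> exists I, is_bochner Om lam e s D G I.
Proof.
move=> s0.
have iG n : intble mu D (fun t => coef (G t) n) := hb_intble lam_gt0 n mD mG iC GC.
have hI := hb_Rintegral lam_gt0 mD mG iC GC.
have [I hsI IE] := Hspace_representative Om_open eig s0 hI.
exists I; pose eps j := (4 ^ j.+1)%:R^-1 : R.
have eps0 j : 0 < eps j by rewrite invr_gt0 ltr0n expn_gt0.
have /choice[K /choice[A /choice[v /choice[b bP]]]] j := step_approximation (eps0 j).
split=> //; exists K, A, v => simple.
have simpleE j t : simple j t = step (K j) (A j) (v j) t by [].
have mA j i : measurable (A j i) by have [h _ _ _] := bP j; have [] := h i.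
have Hv j i : Hspace s (v j i) by have [h _ _ _] := bP j; have [] := h i.
have sv j i : L2 Om (v j i) by have [] := Hv j i.
have Hs j t : Hspace s (step (K j) (A j) (v j) t).
  exact: Hspace_step (Hv j).
have ib j : intble mu D (b j) by have [] := bP j.
have Gb j t : D t -> hb s (coef (G t - step (K j) (A j) (v j) t)) (b j t).
  move=> Dt; have [_ _ h _] := bP j; apply: eq_hb (h t Dt) => n.
  by rewrite (coefB Om_open eig)//; [have [] := HG Dt|have [] := Hs j t].
have b0 j t : D t -> 0 <= b j t by move=> /(Gb j) /hb_ge0.
have Nb j t : D t -> Hnorm s (G t - step (K j) (A j) (v j) t) <= b j t.
  by move=> Dt; have [] := hb_wseries (Gb j t Dt).
have bint j : (\int[mu]_(t in D) (b j t)%:E <= (eps j)%:E)%E.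
  by rewrite -EFin_Rintegral// lee_fin; have [] := bP j.
have epscvg : (eps j) @[j --> \oo] --> (0 : R).
  rewrite (_ : eps = fun j => 4^-1 * 4^-1 ^+ j).
    by apply: cvg_geometric; rewrite ger0_norm// invf_lt1// ltr1n.
  by apply/funext => j; rewrite /eps natrX exprVn -invfM -exprS.
split.
- by move=> j i; split; [exact: mA|exact: Hv].
(* The integrals of [f j] sum to at most 1, so their sum [F] is finite almost everywhere; there
   [b j t] is at most [F t] times 2^(-j). *)
- pose f j t := (2 ^+ j * `|b j t|)%:E.
  have mf j : measurable_fun D (f j).
    apply/measurable_EFinP; apply: measurable_funM => //; apply: measurableT_comp => //.
    exact: intble_measurable (ib j).
  have f0 j t : D t -> (0 <= f j t)%E by rewrite lee_fin mulr_ge0// exprn_ge0.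
  have fint j : (\int[mu]_(t in D) f j t <= (1 / (2 ^ j.+1)%:R)%:E)%E.
    have -> : (\int[mu]_(t in D) f j t = (2 ^+ j)%:E * \int[mu]_(t in D) (b j t)%:E)%E.
      rewrite -integralZl//; last exact: ib.
      by apply: eq_integral => t /set_mem Dt; rewrite /f -EFinM ger0_norm ?b0.
    apply: (le_trans (lee_pmul _ _ (lexx _) (bint j))).
    + by rewrite lee_fin exprn_ge0.
    + by apply: integral_ge0 => t Dt; rewrite lee_fin b0.
    rewrite -EFinM lee_fin /eps !natrX.
    have -> : (4 : R) ^+ j.+1 = 2 ^+ j.+1 * 2 ^+ j.+1 by rewrite -exprMn; congr (_ ^+ _); ring.
    rewrite invfM mulrA mul1r ler_piMl ?invr_ge0 ?exprn_ge0//.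
    by rewrite exprS invfM mulrCA mulfV ?mulr1 ?gt_eqF ?exprn_gt0// invf_le1// ler1n.
  pose F t := (\sum_(j <oo) f j t)%E.
  have mF : measurable_fun D F.
    apply: (@ge0_emeasurable_sum _ RR _ D f xpredT) => [j t Dt _|j _]; last exact: mf.
    exact: f0.
  have F0 t : (0 <= F t)%E.
    by apply: nneseries_ge0 => j _ _; rewrite lee_fin mulr_ge0// exprn_ge0.
  have Fi : mu.-integrable D F.
    apply/integrableP; split=> //.
    under eq_integral do rewrite gee0_abs//.
    rewrite (integral_nneseries mu mD mf f0).
    apply: (le_lt_trans _ (ltry 1)); apply: le_trans (@epsilon_trick0 R 1 xpredT ler01).
    apply: lee_nneseries => [j _ _|j _]; first by apply: integral_ge0 => t; exact: f0.
    exact: fint.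
  have := integrable_ae mD Fi; apply: filterS => t Ft Dt.
  have /fineK Fy := Ft Dt; set y := fine (F t) in Fy.
  have bj j : b j t <= y * 2^-1 ^+ j.
    have ge0 i : (0 <= i)%N -> xpredT i -> (0 <= f i t)%E by move=> _ _; exact: f0.
    have : (f j t <= F t)%E.
      apply: (le_trans _ (nneseries_lim_ge j.+1 ge0)).
      by rewrite big_mkord big_ord_recr/= leeDr// sume_ge0// => i _; exact: f0.
    rewrite -Fy lee_fin ger0_norm ?b0// => h.
    by rewrite exprVn ler_pdivlMr ?exprn_gt0// mulrC.
  apply: (squeeze_cvgr (f := fun=> 0) (h := fun j => y * 2^-1 ^+ j)).
  + apply: nearW => j; rewrite sqrtr_ge0/=; apply: le_trans (bj j).
    by rewrite simpleE; exact: Nb.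
  + exact: cvg_cst.
  + by apply: cvg_geometric; rewrite ger0_norm// invf_lt1// ltr1n.
- apply: (squeeze_cvge (f := fun=> 0%E) (h := fun j => (eps j)%:E)).
  + apply: nearW => j; apply/andP; split.
      by apply: integral_ge0 => t _; rewrite lee_fin sqrtr_ge0.
    apply: le_trans (bint j); apply: ge0_le_integral => //.
    * by move=> t _; rewrite lee_fin sqrtr_ge0.
    * apply/measurable_EFinP; apply: (measurable_wnorm (c := fun t => coef (G t - simple j t))) => n.
      apply: (@eq_measurable_fun _ _ RR R D (fun t => coef (G t) n - coef (step (K j) (A j) (v j) t) n)).
        move=> t /set_mem Dt; rewrite (coefB Om_open eig)//; first by have [] := HG Dt.
        by have [] := Hs j t.
      apply: measurable_funB => //.
      exact: (intble_measurable (coef_step_intble (K j) n (mA j) (sv j))).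
    * by apply/measurable_EFinP; exact: intble_measurable (ib j).
    * by move=> t Dt; rewrite lee_fin simpleE; exact: Nb.
  + exact: cvg_cst.
  + by apply: cvg_EFin; [exact: nearW|exact: epscvg].
- have HJ j : Hspace s (step_integral (K j) (A j) (v j)).
    exact: Hspace_step_integral (Hv j).
  apply: (squeeze_cvgr (f := fun=> 0) (h := eps)) => //; last exact: cvg_cst.
  apply: nearW => j; rewrite sqrtr_ge0/=.
  have mGs n : measurable_fun D (fun t => coef (G t) n - coef (step (K j) (A j) (v j) t) n).
    apply: measurable_funB => //.
    exact: (intble_measurable (coef_step_intble (K j) n (mA j) (sv j))).
  have Gb' t : D t -> hb s (fun n => coef (G t) n - coef (step (K j) (A j) (v j) t) n) (b j t).
    by have [_ _ + _] := bP j; apply.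
  have := hb_Rintegral lam_gt0 mD mGs (ib j) Gb' => hJ.
  have sI : L2 Om I by have [] := hsI.
  have sJ : L2 Om (step_integral (K j) (A j) (v j)) by have [] := HJ j.
  have [_ _ _ bj] := bP j; apply: le_trans bj.
  apply: (hb_Hspace (L2B Om_open sI sJ) _).2.
  apply: eq_hb hJ => n; rewrite (coefB Om_open eig)// IE.
  by rewrite (coef_step_integral (K j) n (mA j) (sv j)) -(RintegralB mD (iG n) (coef_step_intble (K j) n (mA j) (sv j))).
Qed.

End approximation.

(** Taking a coefficient commutes with the integral of step functions and is continuous for both
    limits in the definition. All Bochner integrals of [G] therefore have the same coefficients. *)
Lemma bochner_coef (G : R -> 'rV[R]_d -> R) I :
  (forall n, intble mu D (fun t => coef (G t) n)) -> is_bochner Om lam e s D G I ->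
  forall n, coef I n = \int[mu]_(t in D) coef (G t) n.
Proof.
move=> iG [HG HI [K [A [v /= [AV _ simple_mean simple_int]]]]] n.
have mA j i : measurable (A j i) by have [] := AV j i.
have Hv j i : Hspace s (v j i) by have [] := AV j i.
have sv j i : L2 Om (v j i) by have [] := Hv j i.
have sI : L2 Om I by have [] := HI.
have HJ j : Hspace s (step_integral (K j) (A j) (v j)).
  exact: Hspace_step_integral (Hv j).
have Hs j t : Hspace s (step (K j) (A j) (v j) t).
  exact: Hspace_step (Hv j).
apply: (coef_HnormB Om_open eig (v := fun j => step_integral (K j) (A j) (v j)) _ sI _ simple_int).
- by move=> j; exact: (HspaceB Om_open eig HI (HJ j)).
- by move=> j; have [] := HJ j.
set k := Num.sqrt (lam n `^ s)^-1.
have k0 : 0 <= k by exact: sqrtr_ge0.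
pose x j := (\int[mu]_(t in D) (Hnorm s (G t - step (K j) (A j) (v j) t))%:E)%E.
have cvgx : x j @[j --> \oo] --> (0%:E : \bar R) := simple_mean.
have ist j : intble mu D (fun t => coef (step (K j) (A j) (v j) t) n).
  exact: coef_step_intble.
have bound j : (`|\int[mu]_(t in D) coef (G t) n -
    coef (step_integral (K j) (A j) (v j)) n|%:E <= k%:E * x j)%E.
  rewrite (coef_step_integral (K j) n (mA j) (sv j)) -(RintegralB mD (iG n) (ist j)).
  have iB : intble mu D (fun t => coef (G t) n - coef (step (K j) (A j) (v j) t) n).
    exact: intbleB.
  have mH : measurable_fun D (fun t => Hnorm s (G t - step (K j) (A j) (v j) t)).
    apply: (measurable_wnorm (c := fun t => coef (G t - step (K j) (A j) (v j) t))) => i.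
    apply: (@eq_measurable_fun _ _ RR R D (fun t => coef (G t) i - coef (step (K j) (A j) (v j) t) i)).
      move=> t /set_mem Dt; rewrite (coefB Om_open eig)//; first by have [] := HG _ Dt.
      by have [] := Hs j t.
    apply: measurable_funB; first exact: intble_measurable (iG i).
    exact: (intble_measurable (coef_step_intble (K j) i (mA j) (sv j))).
  rewrite EFin_normr_Rintegral//.
  apply: (le_trans (le_abse_integral mu mD _)).
    by apply/measurable_EFinP; exact: intble_measurable iB.
  rewrite /x -ge0_integralZl//; last 2 first.
  - exact/measurable_EFinP.
  - by move=> t _; rewrite lee_fin sqrtr_ge0.
  apply: ge0_le_integral => //.
  - apply/measurable_EFinP; apply: measurableT_comp => //.
    exact: intble_measurable iB.
  - by apply/measurable_EFinP; apply: measurable_funM.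
  - move=> t Dt /=; rewrite -EFinM lee_fin.
    have sG : L2 Om (G t) by have [] := HG _ Dt.
    have ss : L2 Om (step (K j) (A j) (v j) t) by have [] := Hs j t.
    rewrite -(coefB Om_open eig)//; apply: (hb_abs lam_gt0).
    exact: (Hspace_hb (HspaceB Om_open eig (HG t Dt) (Hs j t))).
have lim0 : (k%:E * x j)%E @[j --> \oo] --> (0%:E : \bar R).
  by rewrite -[X in _ --> X](mule0 k%:E); exact: cvgeZl.
have lim1 : `|\int[mu]_(t in D) coef (G t) n -
    coef (step_integral (K j) (A j) (v j)) n|%:E @[j --> \oo] --> (0%:E : \bar R).
  apply: (squeeze_cvge (f := fun=> 0%E) (h := fun j => k%:E * x j)%E) => //; last exact: cvg_cst.
  by apply: nearW => j; rewrite bound lee_fin normr_ge0.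
have /fine_cvgP[_ /cvgrPdist_le lim2] := lim1.
apply/cvgrPdist_le => r r0; have := lim2 _ r0; apply: filterS => j /=.
by rewrite sub0r normrN normr_id.
Qed.

End bochner.

(** * The semilinear problem *)

Section limsup.
Context {R : realType}.

Lemma limf_esup_right0_lt (g : R -> R) (l r : R) : limf_esup (EFin \o g) 0^'+ = l%:E ->
  0 < r -> exists2 a, 0 < a & forall x, 0 < x < a -> g x <= l + r.
Proof.
move=> gl r0.
have : (limf_esup (EFin \o g) 0^'+ < (l + r)%:E)%E by rewrite gl lte_fin ltrDl.
rewrite limf_esupE => /ereal_inf_lt[_ [V V0 <-] supV].
move: V0 => /= [a /= a0 aV]; exists a => // x /andP[x0 xa].
rewrite -lee_fin (le_trans _ (ltW supV))//; apply: ereal_sup_ubound; exists x => //.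
by apply: aV => //=; rewrite sub0r normrN gtr0_norm.
Qed.

(** Strict inequalities between continuous functions of [r] persist near 0. The slack [r] covers the
    excess of the Lipschitz moduli over their upper limits at small radii. *)
Lemma exists_small_perturbation (c1 c2 a1 a2 l k : R) :
  c1 * (l ^+ 2 + k ^+ 2 * a1) < 1 -> c2 * (l ^+ 2 + k ^+ 2 * a2) < 1 ->
  exists2 r, 0 < r & c1 * ((l + r) ^+ 2 + (k + r) ^+ 2 * a1) < 1 /\
    c2 * ((l + r) ^+ 2 + (k + r) ^+ 2 * a2) < 1.
Proof.
have cvgp (c a : R) : c * ((l + r) ^+ 2 + (k + r) ^+ 2 * a) @[r --> 0^'+] -->
    c * (l ^+ 2 + k ^+ 2 * a).
  rewrite -[X in _ --> c * (X ^+ 2 + _)](addr0 l) -[X in _ --> c * (_ + X ^+ 2 * _)](addr0 k).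
  apply: cvg_at_right_filter.
  have cx (x : R) : x + r @[r --> (0 : R)] --> x + 0 by apply: cvgD; [exact: cvg_cst|exact: cvg_id].
  have sq (x : R) : (x + r) ^+ 2 @[r --> (0 : R)] --> (x + 0) ^+ 2.
    by under eq_fun do rewrite expr2; rewrite expr2; apply: cvgM; exact: cx.
  apply: cvgMr; apply: cvgD; first exact: sq.
  by apply: cvgMl; exact: sq.
move=> h1 h2.
have n1 := cvgr_lt _ (cvgp c1 a1) _ h1; have n2 := cvgr_lt _ (cvgp c2 a2) _ h2.
have [r [r0 [r1 r2]]] : exists r, 0 < r /\ (c1 * ((l + r) ^+ 2 + (k + r) ^+ 2 * a1) < 1 /\
    c2 * ((l + r) ^+ 2 + (k + r) ^+ 2 * a2) < 1).
  near (0 : R)^'+ => r; exists r; split; first by near: r; exact: nbhs_right_gt.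
  by split; near: r; [exact: n1|exact: n2].
by exists r.
Unshelve. all: by end_near. Qed.

(** The square of a sum is at most twice the sum of the squares, and reaching [c^-1] costs [c ^+ 2].
    With [c = 2], for the ratio 1/2, the coefficient is the 8 of the first smallness condition. *)
Lemma sum_mul_le1 (l k a q l' k' C c : R) : 0 <= l -> 0 <= k -> 0 <= a -> 0 <= q -> 0 <= C ->
  l <= l' -> k <= k' -> 0 < c -> q ^+ 2 = C ->
  2 * c ^+ 2 * C * (l' ^+ 2 + k' ^+ 2 * a ^+ 2) < 1 -> (l + k * a) * q < c^-1.
Proof.
move=> l0 k0 a0 q0 C0 ll kk c0 qC h.
have x0 : 0 <= (l + k * a) * q by rewrite mulr_ge0// addr_ge0// mulr_ge0.
rewrite -(ltr_pXn2r (n := 2))// ?nnegrE ?invr_ge0 ?(ltW c0)//.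
rewrite exprVn -[ltRHS]mul1r ltr_pdivlMr ?exprn_gt0// exprMn qC.
apply: le_lt_trans h.
have l2 : l ^+ 2 <= l' ^+ 2 by rewrite lerXn2r// ?nnegrE// (le_trans l0).
have k2 : k ^+ 2 <= k' ^+ 2 by rewrite lerXn2r// ?nnegrE// (le_trans k0).
have sq : (l + k * a) ^+ 2 <= 2 * (l ^+ 2 + k ^+ 2 * a ^+ 2).
  by have := sqr_ge0 (l - k * a); rewrite sqrrB sqrrD exprMn; lra.
have k2a : k ^+ 2 * a ^+ 2 <= k' ^+ 2 * a ^+ 2 by rewrite ler_wpM2r// sqr_ge0.
have -> : 2 * c ^+ 2 * C * (l' ^+ 2 + k' ^+ 2 * a ^+ 2) =
    2 * (l' ^+ 2 + k' ^+ 2 * a ^+ 2) * C * c ^+ 2 by ring.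
rewrite ler_wpM2r ?sqr_ge0// ler_wpM2r//; lra.
Qed.

End limsup.

(** * The conditions on the memory kernel as integral bounds *)

Section kernel_conditions.
Context {R : realType}.
Local Notation mu := (@lebesgue_measure R).
Variables (ell : R -> R) (T g : R).
Hypotheses (T0 : 0 < T) (g0 : 0 < g).
Hypothesis ell_i : intble mu `]0, T[ ell.

Lemma ell1_starP : (ell1_star ell T g < +oo)%E -> 0 <= fine (ell1_star ell T g) /\
  forall t h, 0 < t -> 0 < h -> t + h <= T ->
  \int[mu]_(x in `]t, t + h[) `|ell x| <= fine (ell1_star ell T g) * (h / t) `^ g.
Proof.
move=> foo; set l := ell1_star ell T g in foo *.
have lb t h : 0 < t -> 0 < h -> t + h <= T ->
    ((((t / h) `^ g) * \int[mu]_(x in `]t, t + h[) `|ell x|)%:E <= l)%E.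
  move=> t0 h0 thT; rewrite EFinM EFin_Rintegral//; last first.
    by apply: intble_norm; apply: intbleSoo ell_i => //; exact: ltW.
  apply: ereal_sup_ubound; exists h, t; split=> //.
  by rewrite t0 lerBrDr.
have T2 : 0 < T / 2 by rewrite divr_gt0.
(* The pair [t = h = T / 2] is admissible, so the supremum is nonnegative and hence finite. *)
have l0 : (0 <= l)%E.
  apply: le_trans (lb (T / 2) (T / 2) T2 T2 _); last by rewrite -splitr.
  by rewrite lee_fin mulr_ge0 ?powR_ge0//; apply: Rintegral_ge0.
have lE : l = (fine l)%:E by rewrite fineK// ge0_fin_numE.
split=> [|t h t0 h0 thT]; first exact: fine_ge0.
have := lb t h t0 h0 thT; rewrite lE lee_fin/=.
have ht : (h / t) `^ g = ((t / h) `^ g)^-1.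
  by rewrite -powRN -invf_div powR_invl// divr_ge0// ltW.
by rewrite ht ler_pdivlMr ?powR_gt0 ?divr_gt0// mulrC.
Qed.

(** The reflection [x] to [t - x] moves the singular weight to 0, where the Hölder quotients of
    trajectories have it. A finite supremum bounds the extended integral, which gives
    integrability. *)
Lemma ell2_starP : (ell2_star ell T g < +oo)%E -> 0 <= fine (ell2_star ell T g) /\
  forall t, 0 < t <= T ->
  intble mu `]0, t[ (fun x => `|ell (t - x)| * x `^ (- g)) /\
  \int[mu]_(x in `]0, t[) (`|ell (t - x)| * x `^ (- g)) <=
    fine (ell2_star ell T g) * t `^ (- g).
Proof.
move=> foo; set l := ell2_star ell T g in foo *.
have lb t : 0 < t <= T -> ((t `^ g)%:E * \int[mu]_(x in `]0%R, t[)
    (`|ell x| / (t - x) `^ g)%:E <= l)%E.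
  by move=> tT; apply: ereal_sup_ubound; exists t.
have ge0 t : (0 <= \int[mu]_(x in `]0%R, t[) (`|ell x| / (t - x) `^ g)%:E)%E.
  by apply: integral_ge0 => x _; rewrite lee_fin divr_ge0 ?powR_ge0.
have l0 : (0 <= l)%E.
  by apply: le_trans (lb T _); rewrite ?T0 ?lexx// mule_ge0// lee_fin powR_ge0.
have lE : l = (fine l)%:E by rewrite fineK// ge0_fin_numE.
split=> [|t tT]; first exact: fine_ge0.
have /andP[t0 tT'] := tT.
have tg0 : 0 < t `^ g by exact: powR_gt0.
have ti : intble mu `]0, t[ (fun x => `|ell x| / (t - x) `^ g).
  apply: intble_lty => //.
  - apply: measurable_funM.
      apply: intble_measurable (intble_norm _); exact: (intbleSoo (lexx 0) tT' ell_i).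
    have := @measurable_fun_powRr_itv R setT (- g).
    move=> mp; rewrite (_ : (fun x => _) = (fun x => (t - x) `^ (- g))).
      by apply: (measurableT_comp mp) => //; exact: measurable_funB.
    by apply/funext => x; rewrite powRN.
  - by move=> x _; rewrite divr_ge0 ?powR_ge0.
  - have := lb t tT; rewrite lE => h; rewrite ltNge leye_eq; apply/negP => /eqP Eoo.
    by move: h; rewrite Eoo gt0_muley ?lte_fin.
have E x : `|ell (t - x)| * x `^ (- g) = `|ell (t - x)| / (t - (t - x)) `^ g.
  by rewrite powRN; congr (_ / _ `^ _); ring.
split; first by apply: eq_intble (intble_refl0 ti) => // x _; rewrite E.
under eq_Rintegral do rewrite E.
rewrite (Rintegral_refl0 ti) powRN ler_pdivlMr// -lee_fin -lE mulrC EFinM EFin_Rintegral//.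
exact: lb.
Qed.

End kernel_conditions.

(** * Mild solutions as fixed points on coefficients *)

Section semilinear_problem.
Context {R : realType} {d : nat}.
Variables (Om : set 'rV[R]_d) (lam : nat -> R) (e : nat -> 'rV[R]_d -> R).
Hypothesis Om_open : open Om.
Hypothesis eig : dirichlet_eigenbasis Om lam e.
Local Notation leb := (@lebesgue_measure R).
Local Notation RR := (measurableTypeR R).
Local Notation hb := (wbounded lam).
Local Notation coef := (coef Om e).
Local Notation Hspace := (Hspace Om lam e).
Local Notation Hnorm := (Hnorm Om lam e).
Variables (T : R) (ell m : R -> R).
Hypotheses (T0 : 0 < T) (ell_i : intble leb `]0, T[ ell).
Hypotheses (m_std : standing_assumption m)
  (m_noninc : forall s t, 0 < s -> s <= t -> m t <= m s).
Variables p delta theta : R.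
Hypotheses (p0 : 0 < p) (delta_itv : 0 < delta < 1) (theta_def : theta = 1 + delta - p).
Variable f : ('rV[R]_d -> R) -> ('rV[R]_d -> R) -> ('rV[R]_d -> R) -> R.
Hypothesis f_dual : forall v w, Hspace p v -> Hspace p w -> Hdual Om lam e theta (f v w).
Hypothesis f00 : forall g, Hspace theta g -> f 0 0 g = 0.
Variables rho rho' L K : R.
Hypotheses (rho0 : 0 < rho) (rho0' : 0 < rho') (L0 : 0 <= L) (K0 : 0 <= K).
Hypothesis f_lip : forall v1 v2 w1 w2,
  Hspace p v1 -> Hspace p v2 -> Hspace p w1 -> Hspace p w2 ->
  Hnorm p v1 <= rho -> Hnorm p v2 <= rho -> Hnorm p w1 <= rho' -> Hnorm p w2 <= rho' ->
  Hdual_norm lam e theta (f v1 w1 - f v2 w2) <=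
    L * Hnorm p (v1 - v2) + K * Hnorm p (w1 - w2).
Local Notation nell := (L1norm ell T).
Hypothesis nrho : nell * rho <= rho'.
Hypothesis contraction : (L + K * nell) * Theta T delta <= 1 / 2.

Let lam_gt0 := eigenvalue_gt0 eig.
Let p_ge0 : 0 <= p. Proof. exact: ltW. Qed.

Let W n t := omega m t (lam n).

Let relaxW : relaxation lam W.
Proof.
split.
- by move=> n; have [] := omega_volterra (lam_gt0 n) m_std.
- by move=> n t; exact: (omega_intble (lam_gt0 n) m_std).
- by move=> n t t0; apply: (omega_ge0 (lam_gt0 n) m_std).
- by move=> n t t0; apply: (omega_le1 (lam_gt0 n) m_std).
- by move=> n s t s0 st; apply: (omega_noninc (lam_gt0 n) m_std).
- by move=> n t t0; apply: (omega_Rintegral_le (lam_gt0 n) m_std).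
- by move=> n t t0; apply: (omega_decay (lam_gt0 n) m_std m_noninc).
- by move=> n t h t0 h0; apply: (omega_lipschitz (lam_gt0 n) m_std m_noninc).
Qed.

(** The gap between [- theta] and [p] is exactly the gain [1 + delta] of the convolution
    estimate. *)
Let weightE : p = - theta + 1 + delta. Proof. by rewrite theta_def; ring. Qed.

(** A right inverse of [coef] on bounded sequences; it lets [f], which acts on functions, act on
    sequences through [F]. *)
Let rep := Hsum Om lam e p.
Let F c w := dual_coef e (f (rep c) (rep w)).

Lemma force_lip v1 v2 w1 w2 A B :
  Hspace p v1 -> Hspace p v2 -> Hspace p w1 -> Hspace p w2 ->
  hb p (coef v1) rho -> hb p (coef v2) rho ->
  hb p (coef w1) rho' -> hb p (coef w2) rho' ->
  hb p (fun n => coef v1 n - coef v2 n) A -> hb p (fun n => coef w1 n - coef w2 n) B ->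
  hb (- theta) (fun n => dual_coef e (f v1 w1) n - dual_coef e (f v2 w2) n) (L * A + K * B).
Proof.
move=> H1 H2 H3 H4 /(HnormP _ H1)[_ n1] /(HnormP _ H2)[_ n2] /(HnormP _ H3)[_ n3]
  /(HnormP _ H4)[_ n4] hA hB.
have A0 := hb_ge0 hA; have B0 := hb_ge0 hB.
have [C1 hC1] := Hdual_hb Om_open eig (f_dual H1 H3).
have [C2 hC2] := Hdual_hb Om_open eig (f_dual H2 H4).
have [woo _] := hb_wseries (hbB lam_gt0 hC1 hC2).
apply/(wnormP _ woo); split; first by rewrite addr_ge0 ?mulr_ge0.
apply: (le_trans (f_lip H1 H2 H3 H4 n1 n2 n3 n4)).
have [s1 _] := H1; have [s2 _] := H2; have [s3 _] := H3; have [s4 _] := H4.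
apply: lerD; apply: ler_wpM2l => //.
  apply: (hb_Hspace (L2B Om_open s1 s2) _).2; apply: eq_hb hA => n.
  by rewrite (coefB Om_open eig).
apply: (hb_Hspace (L2B Om_open s3 s4) _).2; apply: eq_hb hB => n.
by rewrite (coefB Om_open eig).
Qed.

Let rep_spec c C : hb p c C -> Hspace p (rep c) /\ coef (rep c) =1 c.
Proof. exact: Hsum_spec. Qed.

Let F_lip v1 v2 w1 w2 A B : hb p v1 rho -> hb p v2 rho -> hb p w1 rho' -> hb p w2 rho' ->
  hb p (fun n => v1 n - v2 n) A -> hb p (fun n => w1 n - w2 n) B ->
  hb (- theta) (fun n => F v1 w1 n - F v2 w2 n) (L * A + K * B).
Proof.
move=> h1 h2 h3 h4 hA hB.
have [H1 E1] := rep_spec h1; have [H2 E2] := rep_spec h2.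
have [H3 E3] := rep_spec h3; have [H4 E4] := rep_spec h4.
rewrite /F; move: (rep v1) (rep v2) (rep w1) (rep w2) H1 E1 H2 E2 H3 E3 H4 E4.
move=> r1 r2 r3 r4 H1 E1 H2 E2 H3 E3 H4 E4; apply: force_lip => //.
- by apply: eq_hb h1 => n; rewrite E1.
- by apply: eq_hb h2 => n; rewrite E2.
- by apply: eq_hb h3 => n; rewrite E3.
- by apply: eq_hb h4 => n; rewrite E4.
- by apply: eq_hb hA => n; rewrite E1 E2.
- by apply: eq_hb hB => n; rewrite E3 E4.
Qed.

(** The arguments of [f] are functions and not classes. Representatives with equal coefficients have
    distance 0, and the Lipschitz condition with [A = B = 0] makes the coefficients of the two
    forces equal. *)
Lemma force_rep v w c c' : Hspace p v -> Hspace p w -> coef v =1 c -> coef w =1 c' ->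
  hb p c rho -> hb p c' rho' -> dual_coef e (f v w) =1 F c c'.
Proof.
move=> Hv Hw vc wc hc hc' n.
have [H1 E1] := rep_spec hc; have [H2 E2] := rep_spec hc'.
apply/eqP; rewrite -subr_eq0; apply/eqP.
apply: (@hb_eq0 _ _ lam_gt0 (- theta) (fun n => dual_coef e (f v w) n - F c c' n)).
rewrite (_ : 0 = L * 0 + K * 0); last by ring.
apply: force_lip => //.
- by apply: eq_hb hc => k; rewrite vc.
- by apply: eq_hb hc => k; rewrite E1.
- by apply: eq_hb hc' => k; rewrite wc.
- by apply: eq_hb hc' => k; rewrite E2.
- by apply: (@eq_hb _ _ _ (fun=> 0)) => [k|]; [rewrite vc E1 subrr|exact: hb0].
- by apply: (@eq_hb _ _ _ (fun=> 0)) => [k|]; [rewrite wc E2 subrr|exact: hb0].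
Qed.

Let F0 n : F (fun=> 0) (fun=> 0) n = 0.
Proof.
have h0 := Hspace0 Om_open eig p.
rewrite -(force_rep h0 h0 (coef0 Om_open eig) (coef0 Om_open eig) (hb0 _ _ (ltW rho0)) (hb0 _ _ (ltW rho0'))).
exact/f00/Hspace_eigen.
Qed.

Local Notation tame := (tame lam T p rho).
Local Notation forcing := (forcing ell F).
Local Notation picard xi := (picard W ell F xi).
Let Lip := L + K * nell.

(** [bochner_exists], with the majorant [rho * |ell (t - x)|], ensures that the choice in [memory]
    is a genuine integral and not the default 0. *)
Lemma memory_spec (v : R -> 'rV[R]_d -> R) t : 0 <= t <= T ->
  (forall x, 0 <= x <= T -> Hspace p (v x)) -> tame (fun x => coef (v x)) ->
  Hspace p (memory Om lam e p ell v t) /\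
  coef (memory Om lam e p ell v t) =1 history ell (fun x => coef (v x)) t.
Proof.
move=> tT Hv tv; have /andP[t0 tT'] := tT.
have mD : measurable (`]0, t[%classic : set RR) by exact: measurable_itv.
have [iU _] := mem_tame lam_gt0 ell_i rho0 tv tT.
have Dx x : (`]0, t[%classic : set RR) x -> 0 <= x <= T.
  by rewrite /= in_itv/= => /andP[x0 xt]; rewrite ltW//= (le_trans (ltW xt)).
pose G x := ell (t - x) *: v x.
have cG x n : (`]0, t[%classic : set RR) x -> coef (G x) n = ell (t - x) * coef (v x) n.
  by move=> /Dx/Hv[sv _]; rewrite (coefZ Om_open eig).
have iG n : intble leb `]0, t[ (fun x => coef (G x) n).
  by apply: eq_intble (iU n) => // x /set_mem Dx'; rewrite cG.
have iC : intble leb `]0, t[ (fun x => rho * `|ell (t - x)|).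
  by apply: intbleZ => //; exact: (ell_refl_intble ell_i tT').
have GH x : (`]0, t[%classic : set RR) x -> Hspace p (G x).
  by move=> /Dx/Hv Hx; exact: HspaceZ.
have GC x : (`]0, t[%classic : set RR) x -> hb p (coef (G x)) (rho * `|ell (t - x)|).
  move=> Dx'; have [_ /(_ x (Dx x Dx')) hx] := tv; rewrite mulrC.
  by apply: eq_hb (hbZ (ell (t - x)) hx) => n; rewrite cG.
have [I bI] := bochner_exists Om_open eig mD (lebesgue_measure_itvoo 0 t)
  (fun n => intble_measurable (iG n)) iC GH GC p_ge0.
have bM : is_bochner Om lam e p `]0, t[ G (memory Om lam e p ell v t).
  exact: (xgetPex 0 (ex_intro _ I bI)).
split=> [|n]; first by have [] := bM.
rewrite (bochner_coef Om_open eig mD (lebesgue_measure_itvoo 0 t) iG bM).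
by apply: eq_Rintegral => x /set_mem Dx'; rewrite cG.
Qed.

Let mem_rho V t : tame V -> 0 <= t <= T -> hb p (history ell V t) rho'.
Proof. by move=> tV tT; have [_ /hb_le] := mem_tame lam_gt0 ell_i rho0 tV tT; apply. Qed.

Lemma force_trajectory (v : R -> 'rV[R]_d -> R) t : 0 <= t <= T ->
  (forall x, 0 <= x <= T -> Hspace p (v x)) -> tame (fun x => coef (v x)) ->
  dual_coef e (f (v t) (memory Om lam e p ell v t)) =1 forcing (fun x => coef (v x)) t.
Proof.
move=> tT Hv tv; have [HM ME] := memory_spec tT Hv tv.
apply: force_rep => //; first exact: Hv.
  by have [_] := tv; apply.
exact: mem_rho.
Qed.

Lemma mild_integral (v : R -> 'rV[R]_d -> R) t : 0 <= t <= T ->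
  (forall x, 0 <= x <= T -> Hspace p (v x)) -> tame (fun x => coef (v x)) ->
  let G tau := resolvent Om lam e p m (t - tau)
    (dual_coef e (f (v tau) (memory Om lam e p ell v tau))) in
  (exists I, is_bochner Om lam e p `]0, t[ G I) /\
  forall I, is_bochner Om lam e p `]0, t[ G I ->
    coef I =1 wconv W (forcing (fun x => coef (v x))) t.
Proof.
move=> tT Hv tv G; have /andP[t0 tT'] := tT.
have mD : measurable (`]0, t[%classic : set RR) by exact: measurable_itv.
set V := fun x => coef (v x) in tv *.
have [iW _] := wconv_forcing lam_gt0 relaxW T0 ell_i delta_itv weightE rho0 L0 K0 F0 F_lip nrho tv tT.
have Dx x : (`]0, t[%classic : set RR) x -> 0 <= x <= T /\ 0 < t - x.
  rewrite /= in_itv/= => /andP[x0 xt]; rewrite subr_gt0 xt; split=> //.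
  by rewrite ltW//= (le_trans (ltW xt)).
(* At a fixed time the whole gain [1 + delta = k + k] comes from the decay. The resulting factor (t
   - x)^(-k) is still integrable since [delta < 1]; it places the integrand in H^p and is its
   majorant. *)
pose k := (1 + delta) / 2.
have /andP[d0 d1] := delta_itv.
have k01 : 0 < k < 1 by apply/andP; split; rewrite /k; lra.
have sk : p = - theta + k + k by rewrite weightE /k; lra.
have Wf x : (`]0, t[%classic : set RR) x ->
    hb p (fun n => W n (t - x) * forcing V x n) ((t - x) `^ (- k) * (Lip * rho)).
  move=> /Dx[xT tx].
  have hF := forcing_hb lam_gt0 ell_i rho0 F0 F_lip nrho tv xT.
  apply: (relax_pointwise lam_gt0 relaxW tx _ sk hF).
  by case/andP: k01 => ? ?; rewrite !ltW.
have GE x : (`]0, t[%classic : set RR) x -> Hspace p (G x) /\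
    coef (G x) =1 (fun n => W n (t - x) * forcing V x n).
  move=> Dx'; have [xT _] := Dx x Dx'.
  have -> : G x = rep (fun n => W n (t - x) * forcing V x n).
    congr (Hsum _ _ _ _ _); apply/funext => n.
    by rewrite (force_trajectory xT Hv tv).
  exact: rep_spec (Wf x Dx').
have iG n : intble leb `]0, t[ (fun x => coef (G x) n).
  by apply: eq_intble (iW n) => // x /set_mem Dx'; have [_ ->] := GE x Dx'.
split.
  have iC : intble leb `]0, t[ (fun x => (t - x) `^ (- k) * (Lip * rho)).
    by apply: intbleZr => //; exact: intble_refl_powRN.
  have GH x : (`]0, t[%classic : set RR) x -> Hspace p (G x) by move=> /GE[].
  have GC x : (`]0, t[%classic : set RR) x -> hb p (coef (G x)) ((t - x) `^ (- k) * (Lip * rho)).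
    by move=> Dx'; apply: eq_hb (Wf x Dx') => n; have [_ ->] := GE x Dx'.
  have [I bI] := bochner_exists Om_open eig mD (lebesgue_measure_itvoo 0 t)
    (fun n => intble_measurable (iG n)) iC GH GC p_ge0.
  by exists I.
move=> I bI n; rewrite (bochner_coef Om_open eig mD (lebesgue_measure_itvoo 0 t) iG bI).
by apply: eq_Rintegral => x /set_mem Dx'; have [_ ->] := GE x Dx'.
Qed.

Section initial_value.
Variable xi : 'rV[R]_d -> R.
Hypotheses (Hxi : Hspace p xi) (xi_small : Hnorm p xi <= rho / 2).

Let hxi : hb p (coef xi) (rho / 2).
Proof. by apply/(HnormP _ Hxi); split=> //; rewrite divr_ge0// ltW. Qed.

Let resolvent_spec t : 0 <= t -> Hspace p (resolvent Om lam e p m t (coef xi)) /\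
  coef (resolvent Om lam e p m t (coef xi)) =1 resolve W (coef xi) t.
Proof. by move=> t0; exact: rep_spec (resolve_hb relaxW t0 hxi). Qed.

(** Equality in L^2 amounts to equality of coefficients, and every Bochner integral of the integrand
    has the coefficients given by [wconv]. *)
Lemma mild_solution_fixed_point (v : R -> 'rV[R]_d -> R) :
  (forall x, 0 <= x <= T -> Hspace p (v x)) -> tame (fun x => coef (v x)) ->
  (forall t, 0 <= t <= T -> exists I,
    is_bochner Om lam e p `]0, t[ (fun tau => resolvent Om lam e p m (t - tau)
      (dual_coef e (f (v tau) (memory Om lam e p ell v tau)))) I /\
    eq_L2 Om (v t) (resolvent Om lam e p m t (coef xi) + I)) <->
  forall t n, 0 <= t <= T -> coef (v t) n = picard (coef xi) (fun x => coef (v x)) t n.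
Proof.
move=> Hv tv; split=> [sol t n tT|fixed t tT].
  have [I [bI vI]] := sol t tT; have [_ IE] := mild_integral tT Hv tv.
  have /andP[t0 _] := tT.
  have [[sS _] SE] := resolvent_spec t0; have [_ [sI _] _] := bI; have [sv _] := Hv t tT.
  rewrite (eq_L2_coef Om_open eig sv (L2D Om_open sS sI) vI) (coefD Om_open eig)//.
  by rewrite SE (IE I bI).
have [[I bI] IE] := mild_integral tT Hv tv; exists I; split=> //.
have /andP[t0 _] := tT.
have [[sS _] SE] := resolvent_spec t0; have [_ [sI _] _] := bI; have [sv _] := Hv t tT.
apply: (coef_eq_L2 Om_open eig sv (L2D Om_open sS sI)) => n.
by rewrite fixed// (coefD Om_open eig)// SE (IE I bI).
Qed.

(** A competitor in the uniqueness statement is only continuous at each time; Heine-Cantor upgrades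
    this to the uniform continuity required by the fixed point argument. *)
Lemma Hcontinuous_tame (v : R -> 'rV[R]_d -> R) :
  Hcontinuous Om lam e p T v -> (forall t, 0 <= t <= T -> Hnorm p (v t) <= rho) ->
  tame (fun x => coef (v x)).
Proof.
move=> [Hv cv] vrho; split; last first.
  by move=> t tT; apply/(HnormP _ (Hv t tT)); split; [exact: ltW|exact: vrho].
have unif : forall r, 0 < r -> exists2 eta, 0 < eta &
    forall x y, 0 <= x <= T -> 0 <= y <= T -> `|x - y| < eta ->
      hb p (fun n => coef (v x) n - coef (v y) n) r.
  apply: heine_cantor => [r z x y h1 h2|y yT r r0].
    by apply: eq_hb (hbB lam_gt0 h1 h2) => n; ring.
  have := cv y yT => /cvgrPdist_le/(_ _ r0).
  rewrite /prop_near1/= /within/= => /nbhs_ballP[eta /= eta0 etaP].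
  exists eta => // x xT xy.
  have Hxy := HspaceB Om_open eig (Hv x xT) (Hv y yT).
  have : Hnorm p (v x - v y) <= r.
    have := etaP x; rewrite /ball/= distrC => /(_ xy).
    rewrite in_itv/= => /(_ xT); rewrite sub0r normrN; apply: le_trans.
    exact: ler_norm.
  move=> nr; have /(HnormP _ Hxy) : 0 <= r /\ Hnorm p (v x - v y) <= r by split=> //; exact: ltW.
  have [sx _] := Hv x xT; have [sy _] := Hv y yT.
  by apply: eq_hb => n; rewrite (coefB Om_open eig).
move=> r r0; have [eta eta0 etaP] := unif r r0; exists eta => // t h t0 h0 heta thT.
have [tT thT'] := shift_itv t0 h0 thT.
by apply: etaP => //; rewrite addrAC subrr add0r ger0_norm.
Qed.

Lemma tame_Hcontinuous (v : R -> 'rV[R]_d -> R) :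
  (forall x, 0 <= x <= T -> Hspace p (v x)) -> tame (fun x => coef (v x)) ->
  Hcontinuous Om lam e p T v.
Proof.
move=> Hv [cv _]; split=> // t tT; apply/cvgrPdist_le => r r0.
have [eta eta0 etaP] := cv r r0.
rewrite /prop_near1/= /within/=; apply/nbhs_ballP; exists eta => //= x.
rewrite /ball/= => tx; rewrite in_itv/= => xT.
rewrite sub0r normrN ger0_norm ?sqrtr_ge0//.
have [sx _] := Hv x xT; have [st _] := Hv t tT.
have /andP[x0 xT'] := xT; have /andP[t0 tT'] := tT.
apply: (hb_Hspace (L2B Om_open sx st) _).2.
have [xt|xt] := leP t x.
  apply: eq_hb (etaP t (x - t) t0 _ _ _) => [n|||].
  - by rewrite (coefB Om_open eig)//= (_ : t + (x - t) = x)//; ring.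
  - by rewrite subr_ge0.
  - by move: tx; rewrite distrC ger0_norm// subr_ge0.
  - by rewrite (_ : t + (x - t) = x)//; ring.
apply: eq_hb (hbN (etaP x (t - x) x0 _ _ _)) => [n|||].
- by rewrite (coefB Om_open eig)//= (_ : x + (t - x) = t) ?opprB//; ring.
- by rewrite subr_ge0 ltW.
- by move: tx; rewrite gtr0_norm// subr_gt0.
- by rewrite (_ : x + (t - x) = t)//; ring.
Qed.

Variables (g l1 l2 : R).
Hypothesis g_itv : 0 < g < 1 / 2.
Hypotheses (l1_ge0 : 0 <= l1) (l2_ge0 : 0 <= l2).
Hypothesis ell1 : forall t h, 0 < t -> 0 < h -> t + h <= T ->
  \int[leb]_(x in `]t, t + h[) `|ell x| <= l1 * (h / t) `^ g.
Hypothesis ell2 : forall t, 0 < t <= T ->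
  intble leb `]0, t[ (fun x => `|ell (t - x)| * x `^ (- g)) /\
  \int[leb]_(x in `]0, t[) (`|ell (t - x)| * x `^ (- g)) <= l2 * t `^ (- g).
Hypothesis hcontraction : (L + K * l2) *
  Num.sqrt (T `^ (1 - delta) * beta_integral (1 - delta) (1 - 2 * g)) < 1.

Lemma mild_solution_exists_unique : exists u : R -> 'rV[R]_d -> R,
  [/\ mild_solution Om lam e p T m ell f xi u,
      forall t, 0 <= t <= T -> Hnorm p (u t) <= rho,
      forall v : R -> 'rV[R]_d -> R,
        mild_solution Om lam e p T m ell f xi v ->
        (forall t, 0 <= t <= T -> Hnorm p (v t) <= rho) ->
        forall t, 0 <= t <= T -> eq_L2 Om (v t) (u t) &
      (ereal_sup (holder_quotients Om lam e p T g u) < +oo)%E].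
Proof.
have [U [tU fU hU]] := picard_fixed_point lam_gt0 relaxW T0 ell_i delta_itv weightE
  rho0 L0 K0 F0 F_lip nrho contraction g_itv l1_ge0 l2_ge0 ell1 ell2 hcontraction hxi.
have [u uspec] : exists u, forall t, 0 <= t <= T -> Hspace p (u t) /\ coef (u t) =1 U t.
  exists (fun t => rep (U t)) => t tT.
  by have [_ /(_ t tT)] := tU; exact: rep_spec.
have Hu t : 0 <= t <= T -> Hspace p (u t) by move=> /uspec[].
have cu t n : 0 <= t <= T -> coef (u t) n = U t n by move=> /uspec[_ ->].
have tu : tame (fun x => coef (u x)).
  have [cU Ur] := tU; split=> [r r0|t tT]; last first.
    by apply: eq_hb (Ur t tT) => n; rewrite cu.
  have [eta eta0 etaP] := cU r r0; exists eta => // t h t0 h0 heta thT.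
  have [tT thT'] := shift_itv t0 h0 thT.
  by apply: eq_hb (etaP t h t0 h0 heta thT) => n; rewrite !cu.
have forcingE t : 0 <= t <= T -> forcing (fun x => coef (u x)) t = forcing U t.
  move=> tT; rewrite -[LHS]/(F (coef (u t)) (history ell (fun x => coef (u x)) t)).
  rewrite (_ : coef (u t) = U t); last first.
    by apply/funext => n; rewrite cu.
  congr (F _ _); apply/funext => n; apply: eq_Rintegral => x.
  rewrite inE/= in_itv/= => /andP[x0 xt]; rewrite cu//.
  by case/andP: tT => _ tT; rewrite ltW//= (le_trans (ltW xt)).
have fu t n : 0 <= t <= T -> coef (u t) n = picard (coef xi) (fun x => coef (u x)) t n.
  move=> tT; rewrite (cu t n tT) (fU t n tT).
  apply: (congr1 (fun z => resolve W (coef xi) t n + z)); apply: eq_Rintegral => x.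
  rewrite inE/= in_itv/= => /andP[x0 xt]; rewrite forcingE//.
  by case/andP: tT => _ tT; rewrite ltW//= (le_trans (ltW xt)).
exists u; split.
- split; first exact: tame_Hcontinuous.
  by apply/(mild_solution_fixed_point Hu tu).
- move=> t tT; have [_ /(_ t tT)] := tu => ht.
  by have /(HnormP _ (Hu t tT))[] := ht.
- move=> v [cv solv] vrho t tT.
  have tv := Hcontinuous_tame cv vrho; have [Hv _] := cv.
  have fv := (mild_solution_fixed_point Hv tv).1 solv.
  have [sv _] := Hv t tT; have [su _] := Hu t tT.
  apply: (coef_eq_L2 Om_open eig sv su) => n.
  exact: (picard_fixed_point_unique lam_gt0 relaxW T0 ell_i delta_itv weightE
    rho0 L0 K0 F0 F_lip nrho contraction tu tv fu fv).
- set H := hoelder_const _ _ _ _ _ _ _ _ in hU.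
  apply: (@le_lt_trans _ _ H%:E); last exact: ltry.
  apply: ge_ereal_sup => _ [h [t [h0 /andP[t0 tTh] ->]]].
  have thT : t + h <= T by rewrite -lerBrDr.
  have [tT thT'] := shift_itv (ltW t0) (ltW h0) thT.
  have [su _] := Hu t tT; have [suh _] := Hu _ thT'.
  have nu : Hnorm p (u (t + h) - u t) <= H * (h / t) `^ g.
    apply: (hb_Hspace (L2B Om_open suh su) _).2; apply: eq_hb (hU t h t0 h0 thT) => n.
    by rewrite (coefB Om_open eig)// !cu.
  rewrite lee_fin ler_pdivrMr ?powR_gt0//.
  apply: (le_trans (ler_wpM2l (powR_ge0 t g) nu)).
  apply: eq_leW.
  rewrite mulrCA -powRM ?(ltW t0) ?divr_ge0 ?ltW//; congr (_ * _ `^ _).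
  by field; rewrite gt_eqF.
Qed.

End initial_value.
End semilinear_problem.

Theorem theorem3p3 (R : realType) (d : nat) (d_gt0 : (0 < d)%N)
  (Om : set 'rV[R]_d) (Om_dom : smooth_bounded_domain Om)
  (lam : nat -> R) (e : nat -> 'rV[R]_d -> R)
  (eig : dirichlet_eigenbasis Om lam e)
  (T : R) (T_gt0 : 0 < T)
  (ell : R -> R) (ell_L1 : lebesgue_measure.-integrable `]0, T[ (EFin \o ell))
  (m : R -> R) (m_std : standing_assumption m)
  (mu delta theta : R) (mu_itv : 0 < mu < 2) (delta_itv : 0 < delta < 1)
  (theta_def : theta = 1 + delta - mu) (theta_gt0 : 0 < theta)
  (m_noninc : forall s t, 0 < s -> s <= t -> m t <= m s)
  (f : ('rV[R]_d -> R) -> ('rV[R]_d -> R) -> ('rV[R]_d -> R) -> R)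
  (f_dual : forall v w, Hspace Om lam e mu v -> Hspace Om lam e mu w ->
     Hdual Om lam e theta (f v w))
  (f00 : forall g, Hspace Om lam e theta g -> f 0 0 g = 0)
  (Lf Kf : R -> R)
  (Lf_ge0 : forall rho, 0 < rho -> 0 <= Lf rho)
  (Kf_ge0 : forall rho, 0 < rho -> 0 <= Kf rho)
  (f_lip : forall rho rho', 0 < rho -> 0 < rho' ->
     forall v1 v2 w1 w2,
     Hspace Om lam e mu v1 -> Hspace Om lam e mu v2 ->
     Hspace Om lam e mu w1 -> Hspace Om lam e mu w2 ->
     Hnorm Om lam e mu v1 <= rho -> Hnorm Om lam e mu v2 <= rho ->
     Hnorm Om lam e mu w1 <= rho' -> Hnorm Om lam e mu w2 <= rho' ->
     Hdual_norm lam e theta (f v1 w1 - f v2 w2) <=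
       Lf rho * Hnorm Om lam e mu (v1 - v2) +
       Kf rho' * Hnorm Om lam e mu (w1 - w2))
  (Lstar Kstar : R)
  (Lstar_lim : limf_esup (EFin \o Lf) 0^'+ = Lstar%:E)
  (Kstar_lim : limf_esup (EFin \o Kf) 0^'+ = Kstar%:E)
  (small1 : 8 * T `^ (1 - delta) * (1 - delta)^-1 *
     (Lstar ^+ 2 + Kstar ^+ 2 * L1norm ell T ^+ 2) < 1)
  (gamma : R) (gamma_itv : delta / 2 < gamma < 1 / 2)
  (ell1_fin : (ell1_star ell T gamma < +oo)%E)
  (ell2_fin : (ell2_star ell T gamma < +oo)%E)
  (small2 : 16 * beta_integral (1 - delta) (1 - 2 * gamma) *
     T `^ (1 - delta) *
     (Lstar ^+ 2 + Kstar ^+ 2 * fine (ell2_star ell T gamma) ^+ 2) < 1) :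
  exists2 rhostar : R, 0 < rhostar &
    forall xi, Hspace Om lam e mu xi -> Hnorm Om lam e mu xi <= rhostar / 2 ->
    exists u : R -> 'rV[R]_d -> R,
      [/\ mild_solution Om lam e mu T m ell f xi u,
          forall t, 0 <= t <= T -> Hnorm Om lam e mu (u t) <= rhostar,
          forall v : R -> 'rV[R]_d -> R,
            mild_solution Om lam e mu T m ell f xi v ->
            (forall t, 0 <= t <= T -> Hnorm Om lam e mu (v t) <= rhostar) ->
            forall t, 0 <= t <= T -> eq_L2 Om (v t) (u t) &
          (ereal_sup (holder_quotients Om lam e mu T gamma u) < +oo)%E].
Proof.
have [Om_open _ _ _ _] := Om_dom.
have /andP[mu0 _] := mu_itv; have /andP[d0 d1] := delta_itv.
have g_itv : 0 < gamma < 1 / 2.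
  by case/andP: gamma_itv => g1 ->; rewrite andbT (lt_trans _ g1)// divr_gt0.
have /andP[g0 g12] := g_itv.
have [l10 ell1] := ell1_starP T_gt0 ell_L1 ell1_fin.
have [l20 ell2] := ell2_starP T_gt0 ell_L1 ell2_fin.
set l2 := fine (ell2_star ell T gamma) in small2 l20 ell2.
have n0 : 0 <= L1norm ell T := L1norm_ge0 T ell.
set B := beta_integral _ _ in small2.
have B0 : 0 <= B by apply: Rintegral_ge0 => x _; rewrite mulr_ge0 ?powR_ge0.
have [r r0 [s1 s2]] := exists_small_perturbation small1 small2.
have [a1 a10 a1P] := limf_esup_right0_lt Lstar_lim r0.
have [a2 a20 a2P] := limf_esup_right0_lt Kstar_lim r0.
(* The radius for memory values is fixed first by [Kf]; [rho] is then taken so small that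
   trajectories in its ball have memory values in the ball of radius [rho']. Halving [a1] and [a2]
   meets the strict bounds of the upper limits. *)
pose rho' := a2 / 2; have rho0' : 0 < rho' by rewrite divr_gt0.
have n10 : 0 < L1norm ell T + 1 by rewrite ltr_wpDl.
pose rho := Num.min (a1 / 2) (rho' / (L1norm ell T + 1)).
have rho0 : 0 < rho by rewrite lt_min !divr_gt0.
have nrho : L1norm ell T * rho <= rho'.
  have : rho <= rho' / (L1norm ell T + 1) by rewrite ge_min lexx orbT.
  rewrite ler_pdivlMr// mulrDr mulr1 mulrC; apply: le_trans.
  by rewrite lerDl ltW.
have L1 : Lf rho <= Lstar + r.
  apply: a1P; rewrite rho0/= gt_min; apply/orP; left.
  by rewrite ltr_pdivrMr// ltr_pMr// ltr1n.
have K1 : Kf rho' <= Kstar + r.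
  by apply: a2P; rewrite rho0'/= ltr_pdivrMr// ltr_pMr// ltr1n.
have L0 := Lf_ge0 _ rho0; have K0 := Kf_ge0 _ rho0'.
have contraction : (Lf rho + Kf rho' * L1norm ell T) * Theta T delta <= 1 / 2.
  rewrite mul1r; apply/ltW.
  apply: (sum_mul_le1 (C := T `^ (1 - delta) / (1 - delta)) L0 K0 n0 (Theta_ge0 _ _) _ L1 K1) => //.
  - by rewrite divr_ge0 ?powR_ge0// subr_ge0 ltW.
  - exact: Theta_sqr.
  - by move: s1; rewrite (_ : 2 * 2 ^+ 2 = 8 :> R) ?mulrA//; ring.
have hcontraction : (Lf rho + Kf rho' * l2) * Num.sqrt (T `^ (1 - delta) * B) < 1.
  rewrite -[ltRHS]invr1.
  apply: (sum_mul_le1 (C := T `^ (1 - delta) * B) L0 K0 l20 (sqrtr_ge0 _) _ L1 K1) => //.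
  - by rewrite mulr_ge0 ?powR_ge0.
  - by apply: sqr_sqrtr; rewrite mulr_ge0 ?powR_ge0.
  - apply: le_lt_trans s2; apply: ler_wpM2r.
      by rewrite addr_ge0 ?sqr_ge0//; apply: mulr_ge0; exact: sqr_ge0.
    have : 0 <= B * T `^ (1 - delta) by rewrite mulr_ge0 ?powR_ge0.
    rewrite expr1n mulr1 -[16 * B * _]mulrA (mulrC _ B); lra.
exists rho => // xi Hxi xi_small.
exact: (mild_solution_exists_unique Om_open eig T_gt0 ell_L1 m_std m_noninc mu0 delta_itv
  theta_def f_dual f00 rho0 rho0' L0 K0 (f_lip rho rho' rho0 rho0') nrho contraction
  Hxi xi_small g_itv l10 l20 ell1 ell2 hcontraction).
Qed.
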